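(* Let $m\ge2$. The transversal Radon transform $R_T$ acts as an isomorphism from $\Phi(\mathbb{R}^m)$ onto $\Phi(\tilde{\mathbb{R}}^m)$.
   Context: Points of $\mathbb{R}^m$ are written $x=(x',x_m)$, $x'\in\mathbb{R}^{m-1}$; $\tilde{\mathbb{R}}^m=\mathbb{R}^{m-1}\times\mathbb{R}$ is a second copy of $\mathbb{R}^m$ with points $(a,b)$. The transversal Radon transform is $$(R_T f)(a,b)=\int_{\mathbb{R}^{m-1}} f(x',a\cdot x'+b)\,dx',\qquad (a,b)\in\tilde{\mathbb{R}}^m.$$ The Fourier transform is $(\mathcal{F}f)(y)=\int_{\mathbb{R}^m}f(x)e^{ix\cdot y}\,dx$. $S(\mathbb{R}^m)$ is the Schwartz space. $\Psi(\mathbb{R}^m)$ is the subspace of functions $\psi\in S(\mathbb{R}^m)$ vanishing together with all derivatives $\partial_m^k\psi$, $k=0,1,2,\ldots$ (in the last variable) on the hyperplane $x_m=0$; $\Phi(\mathbb{R}^m)=\mathcal{F}[\Psi(\mathbb{R}^m)]$. The spaces $\Psi(\tilde{\mathbb{R}}^m)$ and $\Phi(\tilde{\mathbb{R}}^m)$ have the same meaning on $\tilde{\mathbb{R}}^m$ (with $b$ the last variable). All these spaces carry the topology induced from the Schwartz space, and isomorphism means linear homeomorphic bijection. *)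

(* Defs.v *)
From HB Require Import structures.
From mathcomp Require Import all_boot all_order all_algebra.
From mathcomp Require Import all_classical all_reals all_analysis.
From mathcomp Require Import complex.

Set Implicit Arguments.
Unset Strict Implicit.
Unset Printing Implicit Defensive.

Import Order.TTheory GRing.Theory Num.Theory.
Import numFieldNormedType.Exports.

Local Open Scope classical_set_scope.
Local Open Scope ring_scope.

(* Functions on R^n are complex-valued functions on 'rV[R]_n.  There is no
   normed R-module structure on R[i], so differentiation and integration act on
   real and imaginary parts. *)

Section Smooth.
Variables (R : realType) (n : nat).
Implicit Types (f : 'rV[R]_n -> R[i]) (i : 'I_n) (s : seq 'I_n).

Definition Re_fun f : 'rV[R]_n -> R := fun x => complex.Re (f x).
Definition Im_fun f : 'rV[R]_n -> R := fun x => complex.Im (f x).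

Definition partial i f : 'rV[R]_n -> R[i] := fun x =>
  Complex ('D_(delta_mx ord0 i) (Re_fun f) x) ('D_(delta_mx ord0 i) (Im_fun f) x).

(* Iterated partial derivatives are indexed by words in the coordinates.  On
   smooth functions partial derivatives commute, so that these are exactly the
   multi-index derivatives, the order being the length of the word. *)
Definition dpartial s f : 'rV[R]_n -> R[i] := foldr partial f s.

Definition smooth f : Prop := forall s,
  [/\ continuous (Re_fun (dpartial s f)),
      continuous (Im_fun (dpartial s f)) &
      forall i x, derivable (Re_fun (dpartial s f)) x (delta_mx ord0 i) /\
                  derivable (Im_fun (dpartial s f)) x (delta_mx ord0 i)].

(* sup over x and over derivatives of order <= k of (1 + |x|)^k |d^s f(x)|.
   |x| is the library norm of 'rV[R]_n, i.e. the maximum norm; the Euclidean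
   norm gives equivalent seminorms. *)
Definition schwartz_norm (k : nat) f : \bar R :=
  ereal_sup [set ((1 + `|p.2|) ^+ k * ComplexField.Normc.normc (dpartial p.1 f p.2))%:E |
               p in [set p : seq 'I_n * 'rV[R]_n | (size p.1 <= k)%N]].

Definition is_schwartz f : Prop :=
  smooth f /\ forall k, (schwartz_norm k f < +oo)%E.

End Smooth.

Record schwartz (R : realType) (n : nat) := Schwartz {
  schwartz_fun :> 'rV[R]_n -> R[i];
  schwartzP : is_schwartz schwartz_fun }.

HB.instance Definition _ (R : realType) (n : nat) := gen_eqMixin (schwartz R n).
HB.instance Definition _ (R : realType) (n : nat) :=
  gen_choiceMixin (schwartz R n).

Section Topology.
Variables (R : realType) (n : nat).

Definition schwartz_open (U : set (schwartz R n)) : Prop :=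
  forall f, U f -> exists k : nat, exists2 e : R, 0 < e &
    forall g, (schwartz_norm k (schwartz_fun g - schwartz_fun f)%R < e%:E)%E -> U g.

Lemma schwartz_norm_le (j k : nat) (f : 'rV[R]_n -> R[i]) : (j <= k)%N ->
  (schwartz_norm j f <= schwartz_norm k f)%E.
Proof.
move=> jk; apply: ge_ereal_sup => _ [[s x] /= sj <-].
apply: (@le_trans _ _
  ((1 + `|x|) ^+ k * ComplexField.Normc.normc (dpartial s f x))%:E).
  rewrite lee_fin ler_wpM2r//; last by apply: ler_weXn2l => //; rewrite lerDl.
  by case: (dpartial s f x) => a b /=; exact: sqrtr_ge0.
by apply: ereal_sup_ubound; exists (s, x) => //=; exact: leq_trans jk.
Qed.

Let openT : schwartz_open setT.
Proof. by move=> f _; exists 0%N, 1. Qed.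

Let openI : setI_closed schwartz_open.
Proof.
move=> U V oU oV f [/oU[j [d d0 Ud]] /oV[k [e e0 Ve]]].
exists (maxn j k), (Num.min d e) => [|g]; first by rewrite lt_min d0.
move=> gf; split; [apply: Ud|apply: Ve].
- apply: le_lt_trans (schwartz_norm_le _ (leq_maxl j k)) (lt_le_trans gf _).
  by rewrite lee_fin ge_min lexx.
- apply: le_lt_trans (schwartz_norm_le _ (leq_maxr j k)) (lt_le_trans gf _).
  by rewrite lee_fin ge_min lexx orbT.
Qed.

Let open_bigU (I : Type) (F : I -> set (schwartz R n)) :
  (forall i, schwartz_open (F i)) -> schwartz_open (\bigcup_i F i).
Proof.
move=> oF f [i _ /oF[k [e e0 Fe]]]; exists k, e => // g gf.
by exists i => //; exact: Fe.
Qed.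

HB.instance Definition _ :=
  isOpenTopological.Build (schwartz R n) openT openI open_bigU.

End Topology.

Section Integration.
Variable R : realType.

Definition tcons (n : nat) (p : n.-tuple (measurableTypeR R) * measurableTypeR R) :
  n.+1.-tuple (measurableTypeR R) := [tuple of p.2 :: p.1].

Lemma measurable_tcons (n : nat) : measurable_fun setT (@tcons n).
Proof. exact: measurable_cons. Qed.

Section LebesgueStep.
Variables (n : nat) (mu : {measure set (n.-tuple (measurableTypeR R)) -> \bar R}).

Definition lebesgue_step : set (n.+1.-tuple (measurableTypeR R)) -> \bar R :=
  pushforward (mu \x (@lebesgue_measure R))%E (@tcons n).

HB.instance Definition _ := Measure.copy lebesgue_step
  (measure_function_pushforward__canonical__measure_function_Measure
    (mu \x (@lebesgue_measure R))%E (@measurable_tcons n)).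

End LebesgueStep.

(* Lebesgue measure on R^n, on the product sigma-algebra: the n-fold product of
   the one-dimensional Lebesgue measure. *)
Fixpoint lebesgue_tuple (n : nat) :
    {measure set (n.-tuple (measurableTypeR R)) -> \bar R} :=
  if n is m.+1 then lebesgue_step (lebesgue_tuple m) else \d_([tuple]).

Definition row_of_tuple (n : nat) (t : n.-tuple R) : 'rV[R]_n :=
  \row_(i < n) tnth t i.

Definition integral_rV (n : nat) (f : 'rV[R]_n -> R[i]) : R[i] :=
  Complex (\int[lebesgue_tuple n]_t Re_fun f (row_of_tuple t))
          (\int[lebesgue_tuple n]_t Im_fun f (row_of_tuple t)).

End Integration.

Section Transforms.
Variables (R : realType).

Definition dot (n : nat) (x y : 'rV[R]_n) : R := \sum_(i < n) x ord0 i * y ord0 i.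

Definition expi (t : R) : R[i] := Complex (cos t) (sin t).

Definition fourier (n : nat) (f : 'rV[R]_n -> R[i]) : 'rV[R]_n -> R[i] :=
  fun y => integral_rV (fun x => f x * expi (dot x y)).

(* With m = n + 1, the point (x', x_m) of R^m is row_mx x' x_m%:M. *)
Definition last_idx (n : nat) : 'I_(n + 1) := rshift n ord0.

Definition radonT (n : nat) (f : 'rV[R]_(n + 1) -> R[i]) :
    'rV[R]_(n + 1) -> R[i] := fun y =>
  let a : 'rV[R]_n := lsubmx y in let b := y ord0 (last_idx n) in
  integral_rV (fun x' : 'rV[R]_n => f (row_mx x' (dot a x' + b)%:M)).

Definition Psi (n : nat) : set (schwartz R (n + 1)) :=
  [set psi : schwartz R (n + 1) | forall (k : nat) (x : 'rV[R]_(n + 1)),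
     x ord0 (last_idx n) = 0 -> dpartial (nseq k (last_idx n)) psi x = 0].

(* The image of Psi under the Fourier transform; as the latter maps the Schwartz
   space into itself, asking phi to be a Schwartz function loses nothing. *)
Definition Phi (n : nat) : set (schwartz R (n + 1)) :=
  [set phi : schwartz R (n + 1) |
     exists2 psi : schwartz R (n + 1), Psi psi & fourier psi = phi :> ('rV[R]_(n + 1) -> R[i])].

End Transforms.

(* T, defined on functions, restricts to a linear homeomorphic bijection from A
   onto B; set_type A carries the topology induced from the Schwartz space. *)
Definition schwartz_isomorphism (R : realType) (n : nat)
    (T : ('rV[R]_n -> R[i]) -> 'rV[R]_n -> R[i])
    (A B : set (schwartz R n)) : Prop :=
  (forall (a : R[i]) (f g : schwartz R n), A f -> A g ->
     T (a *: schwartz_fun f + schwartz_fun g) = a *: T f + T g) /\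
  exists (F : set_type A -> set_type B) (G : set_type B -> set_type A),
    [/\ forall f : set_type A, schwartz_fun (\val (F f)) = T (\val f),
        cancel F G, cancel G F, continuous F & continuous G].

(* Main.v *)
(* Let F_i be the Fourier transform in the i-th coordinate alone, F' the
   composite of the F_i over the first m - 1 coordinates, and F_m the one in the
   last coordinate.  Since F' maps Psi onto itself, Phi = F_m(Psi).  For g in Psi
   put (D g)(a, s) = g(s a, s); flatness of g at s = 0 makes D a bijection of Psi,
   with inverse g |-> g(a / s, s).  Exchanging the order of integration,
     R_T (F_m g)(a, b) = int int g(x', s) e^(i s (a . x' + b)) ds dx'
                       = int (F' g)(s a, s) e^(i s b) ds = F_m (D (F' g)) (a, b),
   so that R_T = F_m D F' F_m^-1 on Phi.

   Each F_i satisfies F_i F_i f (x) = 2 pi f(.., - x_i, ..), obtained from the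
   one-dimensional inversion formula by Abel summation (the transform of
   e^(-e|s|) is the Poisson kernel); hence F_i^-1 = (2 pi)^-2 F_i^3. *)
From HB Require Import structures.
Require Import Defs.
From mathcomp Require Import all_boot all_order all_algebra.
From mathcomp Require Import all_classical all_reals all_analysis.
From mathcomp Require Import measurable_realfun complex ring lra.

Set Implicit Arguments.
Unset Strict Implicit.
Unset Printing Implicit Defensive.

Import Order.TTheory GRing.Theory Num.Theory.
Import numFieldNormedType.Exports.

Local Open Scope classical_set_scope.
Local Open Scope ring_scope.


(** Both directions of continuity are proved by explicit seminorm estimates: R_T and its inverse
    have the form F_m B F_m^-1, where B is D F' or its inverse F'^-1 D^-1, and every factor is
    bounded in the Schwartz seminorms.

    The obstacle is the dilation. D^-1 divides by s, and each derivative brings further negative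
    powers; even for D, controlling |a| by the dilated point (s a, s) costs a division by s.
    Flatness on s = 0 pays for all of them: a function of Psi is bounded by any power of |s| times a
    seminorm. D and D^-1 are therefore embedded in the family x_l^p f(x_l^e x', x_l) with integers e
    and p, whose span, with tame operators acting first on f, is stable under differentiation.

    Transforming one coordinate at a time reduces Fourier inversion to slices on the line, all
    dominated by multiples of 1 / (1 + t^2). The cube formula for F_i^-1 lets linearity, boundedness
    and stability of Psi pass from F_i to its inverse. *)

Notation normc := ComplexField.Normc.normc.

(** * Complex-valued functions of real variables *)

Section ComplexModulus.
Variable R : realType.
Implicit Types z w : R[i].

Lemma ReD z w : complex.Re (z + w) = complex.Re z + complex.Re w.
Proof. by case: z => a b; case: w => c d. Qed.

Lemma ImD z w : complex.Im (z + w) = complex.Im z + complex.Im w.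
Proof. by case: z => a b; case: w => c d. Qed.

Lemma ReN z : complex.Re (- z) = - complex.Re z.
Proof. by case: z. Qed.

Lemma ImN z : complex.Im (- z) = - complex.Im z.
Proof. by case: z. Qed.

Lemma ReM z w : complex.Re (z * w) =
  complex.Re z * complex.Re w - complex.Im z * complex.Im w.
Proof. by case: z => a b; case: w => c d. Qed.

Lemma ImM z w : complex.Im (z * w) =
  complex.Re z * complex.Im w + complex.Im z * complex.Re w.
Proof. by case: z => a b; case: w => c d. Qed.

Definition ReImE := (ReD, ImD, ReN, ImN, ReM, ImM).

Lemma complexP z w : complex.Re z = complex.Re w ->
  complex.Im z = complex.Im w -> z = w.
Proof. by case: z => a b; case: w => c d /= -> ->. Qed.

Lemma normc_ge0 z : 0 <= normc z.
Proof. by case: z => a b /=; exact: sqrtr_ge0. Qed.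

Lemma normcD z w : normc (z + w) <= normc z + normc w.
Proof. exact: le_normcD. Qed.

Lemma normcM z w : normc (z * w) = normc z * normc w.
Proof. exact: ComplexField.Normc.normcM. Qed.

Lemma normcN z : normc (- z) = normc z.
Proof. exact: normcN. Qed.

Lemma normc_real (x : R) : normc (x%:C)%C = `|x|.
Proof. by rewrite /normc /= expr0n /= addr0 sqrtr_sqr. Qed.

Lemma normc0 : normc (0 : R[i]) = 0.
Proof. exact: ComplexField.Normc.normc0. Qed.

Lemma normc_i : normc ('i%C : R[i]) = 1.
Proof. by rewrite /normc /= expr0n /= add0r expr1n sqrtr1. Qed.

Lemma Re_le_normc z : `|complex.Re z| <= normc z.
Proof.
case: z => a b /=; rewrite -sqrtr_sqr ler_wsqrtr// lerDl; exact: sqr_ge0.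
Qed.

Lemma Im_le_normc z : `|complex.Im z| <= normc z.
Proof.
case: z => a b /=; rewrite -sqrtr_sqr ler_wsqrtr// lerDr; exact: sqr_ge0.
Qed.

Lemma normc_le_ReIm z : normc z <= `|complex.Re z| + `|complex.Im z|.
Proof.
case: z => a b /=.
rewrite -[leRHS]ger0_norm ?addr_ge0// -sqrtr_sqr ler_wsqrtr//.
rewrite sqrrD !real_normK ?num_real//.
by rewrite addrAC lerDl mulrn_wge0// mulr_ge0.
Qed.

Lemma expiD (s t : R) : expi (s + t) = expi s * expi t.
Proof.
rewrite /expi; apply: complexP; rewrite ?ReM ?ImM /= ?cosD ?sinD//.
by rewrite addrC [sin s * _]mulrC [cos s * _]mulrC; ring.
Qed.

Lemma expi0 : expi 0 = 1 :> R[i].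
Proof. by rewrite /expi cos0 sin0. Qed.

Lemma normc_expi (t : R) : normc (expi t) = 1.
Proof. by rewrite /= cos2Dsin2 sqrtr1. Qed.

End ComplexModulus.

(** * Derivatives of complex-valued functions on the line *)

Section ComplexDerivative.
Variable R : realType.
Implicit Types (h k : R -> R[i]) (t : R) (a b d : R[i]).

Definition cder h t d :=
  is_derive t 1 (fun s => complex.Re (h s) : R) (complex.Re d) /\
  is_derive t 1 (fun s => complex.Im (h s) : R) (complex.Im d).

Lemma cder_cst a t : cder (fun=> a) t 0.
Proof. by split; exact: is_derive_cst. Qed.

Lemma cderD h k t a b : cder h t a -> cder k t b ->
  cder (fun s => h s + k s) t (a + b).
Proof.
move=> [h1 h2] [k1 k2]; split.
  rewrite ReD; under eq_fun do rewrite ReD; exact: is_deriveD.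
rewrite ImD; under eq_fun do rewrite ImD; exact: is_deriveD.
Qed.

Lemma cderM h k t a b : cder h t a -> cder k t b ->
  cder (fun s => h s * k s) t (a * k t + h t * b).
Proof.
move=> [h1 h2] [k1 k2]; split.
  rewrite ReD !ReM; under eq_fun do rewrite ReM.
  have H := is_deriveB (is_deriveM h1 k1) (is_deriveM h2 k2).
  apply: (is_derive_eq H).
  by rewrite /= /GRing.scale /=; ring.
rewrite ImD !ImM; under eq_fun do rewrite ImM.
have H := is_deriveD (is_deriveM h1 k2) (is_deriveM h2 k1).
apply: (is_derive_eq H).
by rewrite /= /GRing.scale /=; ring.
Qed.

Lemma cder_real (f : R -> R) t (d : R) : is_derive t 1 f d ->
  cder (fun s => (f s)%:C%C) t d%:C%C.
Proof. by move=> fd; split => //=; exact: is_derive_cst. Qed.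

Lemma cderZ a h t d : cder h t d -> cder (fun s => a * h s) t (a * d).
Proof.
move=> hd; have := cderM (cder_cst a t) hd; by rewrite mul0r add0r.
Qed.

Lemma cder_comp h (g : R -> R) t (d : R) a :
  is_derive t 1 g d -> cder h (g t) a -> cder (fun s => h (g s)) t (d%:C%C * a).
Proof.
move=> gd [h1 h2]; split.
- apply: (is_derive_eq (is_derive1_comp h1 gd)).
  by rewrite ReM /= mul0r subr0 mulrC.
- apply: (is_derive_eq (is_derive1_comp h2 gd)).
  by rewrite ImM /= mul0r addr0 mulrC.
Qed.

Lemma cder_expi t : cder (@expi R) t ('i%C * expi t).
Proof.
split; rewrite /expi /=; last by rewrite mul0r add0r mul1r; exact: is_derive_sin.
rewrite mul0r sub0r mul1r; exact: is_derive_cos.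
Qed.

Lemma cder_eq h t d d' : cder h t d -> d = d' -> cder h t d'.
Proof. by move=> ? <-. Qed.

Lemma cder_continuous h t d : cder h t d ->
  {for t, continuous (fun s => complex.Re (h s) : R)} /\
  {for t, continuous (fun s => complex.Im (h s) : R)}.
Proof.
by move=> [[h1 _] [h2 _]]; split;
  apply/differentiable_continuous/derivable1_diffP.
Qed.

Lemma real_mean_value_bound (f df : R -> R) (a b L : R) :
  (forall t, Num.min a b <= t <= Num.max a b -> is_derive t 1 f (df t)) ->
  (forall t, Num.min a b <= t <= Num.max a b -> `|df t| <= L) ->
  `|f b - f a| <= L * `|b - a|.
Proof.
wlog ab : a b / a <= b => [WL|].
  case/orP: (le_total a b) => [ab|ba]; first exact: WL.
  move=> fd fL; rewrite distrC [`|b - a|]distrC; apply: WL => // t.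
    by rewrite minC maxC; exact: fd.
  by rewrite minC maxC; exact: fL.
rewrite min_l// max_r// => fd fL.
have [||c cab ->] := @MVT_segment R f df a b ab.
- by move=> x xab; apply: fd; rewrite !ltW// (itvP xab).
- apply: derivable_within_continuous => x xab.
  by have [] := fd x ltac:(by rewrite !(itvP xab)).
- rewrite normrM ler_wpM2r// fL//; by rewrite (itvP cab).
Qed.

(** The factor 2 arises because the mean value theorem is applied to real and imaginary parts
    separately, with different intermediate points. *)
Lemma mean_value_bound h (dh : R -> R[i]) (a b L : R) :
  (forall t, Num.min a b <= t <= Num.max a b -> cder h t (dh t)) ->
  (forall t, Num.min a b <= t <= Num.max a b -> normc (dh t) <= L) ->
  normc (h b - h a) <= 2 * L * `|b - a|.
Proof.
move=> hd hL; apply: le_trans (normc_le_ReIm _) _; rewrite !ReImE.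
rewrite -mulrA mulrDl !mul1r; apply: lerD.
- apply: (@real_mean_value_bound (fun s => complex.Re (h s))
    (fun s => complex.Re (dh s))) => t tab; first by have [] := hd t tab.
  exact: le_trans (Re_le_normc _) (hL t tab).
- apply: (@real_mean_value_bound (fun s => complex.Im (h s))
    (fun s => complex.Im (dh s))) => t tab; first by have [] := hd t tab.
  exact: le_trans (Im_le_normc _) (hL t tab).
Qed.

End ComplexDerivative.

(** * Partial derivatives as derivatives on coordinate lines *)

Section PartialDerivatives.
Variables (R : realType) (m : nat).
Implicit Types (f g : 'rV[R]_m -> R[i]) (x y : 'rV[R]_m) (i j : 'I_m).

Definition upd x i (t : R) : 'rV[R]_m :=
  \row_j (if j == i then t else x ord0 j).

Lemma updE x i t j : upd x i t ord0 j = if j == i then t else x ord0 j.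
Proof. by rewrite mxE. Qed.

Lemma upd_id x i : upd x i (x ord0 i) = x.
Proof. by apply/rowP => j; rewrite updE; case: eqP => [->|]. Qed.

Lemma upd_upd x i s t : upd (upd x i s) i t = upd x i t.
Proof. by apply/rowP => j; rewrite !updE; case: eqP. Qed.

Lemma updC x i j s t : i != j -> upd (upd x i s) j t = upd (upd x j t) i s.
Proof.
move=> ij; apply/rowP => k; rewrite !updE; case: eqP => [->|//].
by rewrite eq_sym (negbTE ij).
Qed.

Lemma upd_add x i t u : upd x i t + u *: delta_mx ord0 i = upd x i (t + u).
Proof.
apply/rowP => j; rewrite !mxE eqxx /=; case: eqP => _ /=; first by rewrite mulr1.
by rewrite mulr0 addr0.
Qed.

Lemma add_delta x i u : x + u *: delta_mx ord0 i = upd x i (x ord0 i + u).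
Proof. by rewrite -upd_add upd_id. Qed.

Lemma is_derive_line (F : 'rV[R]_m -> R) x v (d : R) :
  is_derive x v F d <-> is_derive (0 : R) 1 (fun u => F (x + u *: v)) d.
Proof.
have E : (fun h => h^-1 *: ((F \o shift x) (h *: v) - F x)) =
    (fun h : R => h^-1 *: (((fun u => F (x + u *: v)) \o shift (0 : R)) (h *: 1)
      - (fun u => F (x + u *: v)) 0)).
  apply/funext => h /=.
  by rewrite scale0r !addr0 [h%:A]mulr1 [h *: v + x]addrC.
split=> -[]; rewrite /derivable /derive /= => c dE.
  by apply: DeriveDef; rewrite /derivable /derive /= -E.
by apply: DeriveDef; rewrite /derivable /derive /= E.
Qed.

(** Freezing the other coordinates makes the one-dimensional rules for [cder] available; [cpartE]
    translates back to the directional derivatives in [partial]. *)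
Definition cpart i f x d := cder (fun u => f (upd x i u)) (x ord0 i) d.

Lemma cpartE i f x d : cpart i f x d <->
  is_derive x (delta_mx ord0 i) (Re_fun f) (complex.Re d) /\
  is_derive x (delta_mx ord0 i) (Im_fun f) (complex.Im d).
Proof.
have H (F : 'rV[R]_m -> R) (e : R) : is_derive (x ord0 i) 1 (fun u => F (upd x i u)) e <->
   is_derive x (delta_mx ord0 i) F e.
  rewrite is_derive_line; under [X in _ <-> is_derive _ _ X _]eq_fun do rewrite add_delta.
  have d1 (c : R) t : is_derive t (1 : R) (fun u : R => c + u) 1.
    apply: (is_derive_eq (is_deriveD (is_derive_cst c t 1) (is_derive_id t 1))).
    by rewrite add0r.
  split=> Fe.
    have := @is_derive1_comp _ (fun u => F (upd x i u)) (fun u => x ord0 i + u) 0 e 1.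
    by rewrite addr0 mulr1; apply.
  have := @is_derive1_comp _ (fun u => F (upd x i (x ord0 i + u)))
     (fun u => - x ord0 i + u) (x ord0 i) e 1.
  rewrite addNr mulr1 => /(_ Fe (d1 _ _)).
  rewrite (_ : _ \o _ = (fun u => F (upd x i u)))//.
  by apply/funext => u /=; rewrite addNKr.
by split=> -[f1 f2]; split;
  [exact/(H (Re_fun f))|exact/(H (Im_fun f))|exact/(H (Re_fun f))|exact/(H (Im_fun f))].
Qed.

Lemma cpart_partial i f x d : cpart i f x d -> partial i f x = d.
Proof.
by move/cpartE => [[_ h1] [_ h2]]; apply: complexP; rewrite /partial /= ?h1 ?h2.
Qed.

Lemma cpart_derivable i f x d : cpart i f x d ->
  derivable (Re_fun f) x (delta_mx ord0 i) /\
  derivable (Im_fun f) x (delta_mx ord0 i).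
Proof. by move/cpartE => [[? _] [? _]]. Qed.

Lemma derivable_cpart i f x :
  derivable (Re_fun f) x (delta_mx ord0 i) ->
  derivable (Im_fun f) x (delta_mx ord0 i) -> cpart i f x (partial i f x).
Proof. by move=> h1 h2; apply/cpartE; split; apply: DeriveDef. Qed.

Lemma cpart_upd i f x t d : cpart i f (upd x i t) d <->
  cder (fun u => f (upd x i u)) t d.
Proof.
by rewrite /cpart updE eqxx; under eq_fun do rewrite upd_upd.
Qed.

Lemma smooth_cpart f s i x : smooth f ->
  cpart i (dpartial s f) x (dpartial (i :: s) f x).
Proof. by move=> /(_ s) [_ _ /(_ i x) [? ?]]; exact: derivable_cpart. Qed.

Lemma dpartial_rcons s i f : dpartial (rcons s i) f = dpartial s (partial i f).
Proof. by rewrite /dpartial foldr_rcons. Qed.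

Lemma dpartial_cat s s' f : dpartial (s ++ s') f = dpartial s (dpartial s' f).
Proof. by rewrite /dpartial foldr_cat. Qed.

Lemma smooth_dpartial f s : smooth f -> smooth (dpartial s f).
Proof. by move=> sf s'; have := sf (s' ++ s); rewrite dpartial_cat. Qed.

Lemma partialD i f g x d e : cpart i f x d -> cpart i g x e ->
  partial i (f + g) x = d + e.
Proof. by move=> fd ge; apply: cpart_partial; exact: cderD. Qed.

End PartialDerivatives.

(** * Operators bounded in the Schwartz seminorms *)

Section RowNorm.
Variables (R : realType) (m : nat).
Implicit Types (x y : 'rV[R]_m) (i : 'I_m).

Lemma coord_le_norm x i : `|x ord0 i| <= `|x|.
Proof.
rewrite /Num.Def.normr /= mx_normrE.
exact: (le_bigmax _ (fun j : 'I_1 * 'I_m => `|x j.1 j.2|) (ord0, i)).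
Qed.

Lemma norm_le_coord x (r : R) : 0 <= r -> (forall i, `|x ord0 i| <= r) -> `|x| <= r.
Proof.
move=> r0 xr; rewrite /Num.Def.normr /= mx_normrE; apply: bigmax_le => // -[j i] _ /=.
by rewrite ord1.
Qed.

Lemma norm_upd x i (t : R) : `|upd x i t| <= Num.max `|x| `|t|.
Proof.
apply: norm_le_coord => [|j]; first by rewrite le_max normr_ge0.
by rewrite updE le_max; case: eqP => _; rewrite ?lexx ?orbT ?coord_le_norm.
Qed.

(** The vertices of a path from [x] to [y] whose edges are parallel to the axes. *)
Definition mix x y k : 'rV[R]_m := \row_j (if (j < k)%N then y ord0 j else x ord0 j).

Lemma mix0 x y : mix x y 0 = x.
Proof. by apply/rowP => j; rewrite mxE. Qed.

Lemma mix_all x y : mix x y m = y.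
Proof. by apply/rowP => j; rewrite mxE ltn_ord. Qed.

Lemma mixS x y i : mix x y i.+1 = upd (mix x y i) i (y ord0 i).
Proof.
apply/rowP => j; rewrite !mxE ltnS leq_eqVlt.
by rewrite -[(j == i :> nat)]/(j == i); case: eqP => [->|].
Qed.

Lemma mix_coord x y i : mix x y i ord0 i = x ord0 i.
Proof. by rewrite mxE ltnn. Qed.

End RowNorm.

(** * Mean value theorem along the axes, chain rule *)

Section Telescoping.
Variables (R : realType) (m : nat).
Implicit Types (x y : 'rV[R]_m) (i : 'I_m).

(** Each edge of the path through the points [mix x y k] is handled by the mean value theorem on the
    line. The second clause keeps every [xi i] as close to [x] as [y] is, coordinate by
    coordinate. *)
Lemma telescoping_mean_value (F : 'rV[R]_m -> R) (G : 'I_m -> 'rV[R]_m -> R) :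
  (forall x i, is_derive (x ord0 i) 1 (fun u => F (upd x i u)) (G i x)) ->
  forall x y, exists xi : 'I_m -> 'rV[R]_m,
    F y - F x = \sum_i G i (xi i) * (y ord0 i - x ord0 i) /\
    forall i j, `|xi i ord0 j - x ord0 j| <= `|y ord0 j - x ord0 j|.
Proof.
move=> FG x y.
have step i : exists z : 'rV[R]_m,
    F (mix x y i.+1) - F (mix x y i) = G i z * (y ord0 i - x ord0 i) /\
    forall j, `|z ord0 j - x ord0 j| <= `|y ord0 j - x ord0 j|.
  set w := mix x y i.
  have wj j : j != i -> `|w ord0 j - x ord0 j| <= `|y ord0 j - x ord0 j|.
    by move=> _; rewrite mxE; case: ifP => // _; rewrite subrr normr0.
  have FD (u : R) : is_derive u 1 (fun u => F (upd w i u)) (G i (upd w i u)).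
    have := FG (upd w i u) i; rewrite updE eqxx.
    by under eq_fun do rewrite upd_upd.
  have cont (I : set R) : {within I, continuous (fun u => F (upd w i u))}.
    apply: continuous_subspaceT => u.
    by apply/differentiable_continuous/derivable1_diffP; have [] := FD u.
  have E : F (mix x y i.+1) - F (mix x y i) =
      (fun u => F (upd w i u)) (y ord0 i) - (fun u => F (upd w i u)) (x ord0 i).
    by rewrite mixS -/w -(mix_coord x y i) -/w /= upd_id.
  case/orP: (le_total (x ord0 i) (y ord0 i)) => xy.
  - have [c] := MVT_segment xy (fun u _ => FD u) (cont _).
    rewrite in_itv /= => /andP[xc cy] Ec.
    exists (upd w i c); split; first by rewrite E Ec.
    move=> j; rewrite updE; case: eqP => [->|/eqP/wj//].
    by rewrite !ger0_norm ?subr_ge0// lerD2r.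
  - have [c] := MVT_segment xy (fun u _ => FD u) (cont _).
    rewrite in_itv /= => /andP[yc cx] Ec.
    exists (upd w i c); split.
      by rewrite E -[LHS]opprB Ec -mulrN opprB.
    move=> j; rewrite updE; case: eqP => [->|/eqP/wj//].
    by rewrite !ler0_norm ?subr_le0// !opprB lerD2l lerN2.
have [xi xiP] := fin_all_exists step.
exists xi; split; last by move=> i j; have [] := xiP i.
have -> : F y - F x = \sum_(0 <= k < m) (F (mix x y k.+1) - F (mix x y k)).
  by rewrite (telescope_sumr (fun k => F (mix x y k)))// mix_all mix0.
rewrite big_mkord.
by apply: eq_bigr => i _; have [] := xiP i.
Qed.

Lemma cvg_sumr (I : Type) (r : seq I) (T : Type) (F : set_system T) {FF : Filter F}
    (f : I -> T -> R) (l : I -> R) : (forall k, f k x @[x --> F] --> l k) ->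
  \sum_(k <- r) f k x @[x --> F] --> \sum_(k <- r) l k.
Proof.
move=> fl; elim: r => [|i r IHr].
  by rewrite big_nil; under eq_fun do rewrite big_nil; exact: cvg_cst.
by rewrite big_cons; under eq_fun do rewrite big_cons; exact: cvgD.
Qed.

(** The increment of [F] along the curve is telescoped over the coordinates. The intermediate points
    tend to [c t] with the increment, so continuity of the partial derivatives gives the limit of
    the difference quotient. *)
Lemma is_derive_curve (F : 'rV[R]_m -> R) (G : 'I_m -> 'rV[R]_m -> R)
    (c : R -> 'rV[R]_m) (t : R) (dc : 'I_m -> R) :
  (forall x i, is_derive (x ord0 i) 1 (fun u => F (upd x i u)) (G i x)) ->
  (forall i, continuous (G i)) ->
  (forall i, is_derive t 1 (fun u => c u ord0 i : R) (dc i)) ->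
  is_derive t 1 (fun u => F (c u)) (\sum_i G i (c t) * dc i).
Proof.
move=> FG cG cd.
have [xi xiP] := choice (fun h : R => telescoping_mean_value FG (c t) (c (h + t))).
have cvgc i : c (h + t) ord0 i @[h --> (0:R)^'] --> c t ord0 i.
  have : {for t, continuous (fun u => c u ord0 i : R)}.
    by apply/differentiable_continuous/derivable1_diffP; have [] := cd i.
  rewrite /continuous_at => ct.
  have H : h + t @[h --> (0:R)^'] --> 0 + t.
    by apply: cvgD; [exact: cvg_within|exact: cvg_cst].
  rewrite add0r in H.
  exact: (@cvg_comp _ _ _ (fun h => h + t) (fun u => c u ord0 i) _ (nbhs t)).
have cvgxi i : xi h i @[h --> (0:R)^'] --> c t.
  apply/cvgrPdist_le => e e0.
  have : \forall h \near (0:R)^', forall j, `|c t ord0 j - c (h + t) ord0 j| <= e.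
    apply: filter_forall => j.
    by have /cvgrPdist_le := cvgc j; apply.
  apply: filterS => h hj; apply: norm_le_coord => [|j]; first exact: ltW.
  rewrite !mxE distrC; apply: le_trans ((xiP h).2 i j) _; by rewrite distrC.
have hlim : (h^-1 *: (F (c (h *: 1 + t)) - F (c t)) : R) @[h --> (0:R)^'] -->
    \sum_i G i (c t) * dc i.
  rewrite (_ : (fun h => _) = (fun h => \sum_i G i (xi h i) *
      (h^-1 *: (c (h *: 1 + t) ord0 i - c t ord0 i)))); last first.
    apply/funext => h; rewrite /GRing.scale /= mulr1 (xiP h).1 mulr_sumr.
    by apply: eq_bigr => i _; rewrite mulrCA.
  apply: cvg_sumr => i; apply: cvgM.
    apply: (@cvg_comp _ _ _ (fun h => xi h i) (G i) _ (nbhs (c t)));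
      [exact: cvgxi|exact: cG].
  by have [cdi <-] := cd i; exact: cdi.
by apply: DeriveDef; [exact: cvgP hlim|exact: cvg_lim hlim].
Qed.

Lemma cder_curve (f : 'rV[R]_m -> R[i]) (c : R -> 'rV[R]_m) (t : R) (dc : 'I_m -> R) :
  smooth f -> (forall i, is_derive t 1 (fun u => c u ord0 i : R) (dc i)) ->
  cder (fun u => f (c u)) t (\sum_i (dc i)%:C%C * partial i f (c t)).
Proof.
move=> sf cd.
have fp x i : cpart i f x (partial i f x) by exact: (smooth_cpart [::] i x sf).
split.
  have E : complex.Re (\sum_i (dc i)%:C%C * partial i f (c t)) =
      \sum_i Re_fun (partial i f) (c t) * dc i.
    rewrite (big_morph (@complex.Re R) (@ReD R) (erefl _)).
    by apply: eq_bigr => i _; rewrite ReM /= mul0r subr0 mulrC.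
  rewrite E; apply: (@is_derive_curve (Re_fun f) (fun i => Re_fun (partial i f))) => //.
  - by move=> x i; have [] := fp x i.
  - by move=> i; have [] := sf [:: i].
have E : complex.Im (\sum_i (dc i)%:C%C * partial i f (c t)) =
    \sum_i Im_fun (partial i f) (c t) * dc i.
  rewrite (big_morph (@complex.Im R) (@ImD R) (erefl _)).
  by apply: eq_bigr => i _; rewrite ImM /= mul0r addr0 mulrC.
rewrite E; apply: (@is_derive_curve (Im_fun f) (fun i => Im_fun (partial i f))) => //.
- by move=> x i; have [] := fp x i.
- by move=> i; have [] := sf [:: i].
Qed.

(** Telescoping makes [F] Lipschitz. This supplies the continuity that [smooth] asks of functions
    known only through estimates. *)
Lemma bounded_partials_continuous (F : 'rV[R]_m -> R) (G : 'I_m -> 'rV[R]_m -> R) (L : R) :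
  (forall x i, is_derive (x ord0 i) 1 (fun u => F (upd x i u)) (G i x)) ->
  (forall i x, `|G i x| <= L) -> continuous F.
Proof.
move=> FG GL x; apply/(@cvgrPdist_le _ _ _ (nbhs x)) => e e0.
(* The summand 1 keeps [K] positive when [m] or [L] is 0. *)
pose K : R := `|L| *+ m + 1.
have K0 : 0 < K by rewrite ltr_pwDr// mulrn_wge0.
have near_x : \forall y \near x, `|x - y| < e / K.
  by have := @nbhsx_ballx R 'rV[R]_m x _ (divr_gt0 e0 K0); rewrite -ball_normE.
apply: filterS near_x => y /ltW xy; have [xi [-> _]] := telescoping_mean_value FG y x.
apply: le_trans (ler_norm_sum _ _ _) _.
apply: (@le_trans _ _ (\sum_(i < m) `|L| * (e / K))).
  apply: ler_sum => i _; rewrite normrM ler_pM//.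
    exact: le_trans (GL i _) (ler_norm _).
  by apply: le_trans xy; have := coord_le_norm (x - y) i; rewrite !mxE.
rewrite sumr_const card_ord -mulrnAl mulrA ler_pdivrMr// mulrC ler_wpM2l//; first exact: ltW.
by rewrite lerDl.
Qed.

End Telescoping.

(** * Tame operators *)

Section Tame.
Variables (R : realType) (m : nat).
Implicit Types (f g : 'rV[R]_m -> R[i]) (P Q : set ('rV[R]_m -> R[i])).
Implicit Types (S T U : ('rV[R]_m -> R[i]) -> 'rV[R]_m -> R[i]) (M C : R).

Definition wbounded (k : nat) f M := forall x, (1 + `|x|) ^+ k * normc (f x) <= M.

(** The inequality between [schwartz_norm k f] and the real number [M] with the supremum unfolded
    ([schwartz_normP]), which avoids extended reals in the estimates. *)
Definition seminorm_le (k : nat) f M :=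
  forall s, (size s <= k)%N -> wbounded k (dpartial s f) M.

Lemma weight_ge1 k (x : 'rV[R]_m) : 1 <= (1 + `|x|) ^+ k.
Proof. by rewrite exprn_ege1// lerDl. Qed.

Lemma wbounded_ge0 k f M : wbounded k f M -> 0 <= M.
Proof.
by move/(_ 0); apply: le_trans; rewrite mulr_ge0 ?normc_ge0.
Qed.

Lemma seminorm_le_ge0 k f M : seminorm_le k f M -> 0 <= M.
Proof. by move/(_ [::] isT)/wbounded_ge0. Qed.

Lemma wboundedW j k f M N : (j <= k)%N -> M <= N -> wbounded k f M -> wbounded j f N.
Proof.
move=> jk MN fM x; apply: le_trans MN; apply: le_trans (fM x).
by rewrite ler_wpM2r ?normc_ge0// ler_weXn2l// lerDl.
Qed.

Lemma seminorm_leW j k f M N : (j <= k)%N -> M <= N ->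
  seminorm_le k f M -> seminorm_le j f N.
Proof.
move=> jk MN fM s sj; apply: (wboundedW jk MN); apply: fM; exact: leq_trans jk.
Qed.

Lemma wbounded0 k f M x : wbounded k f M -> normc (f x) <= M.
Proof.
move/(_ x); apply: le_trans; rewrite ler_peMl ?normc_ge0//; exact: weight_ge1.
Qed.

Lemma seminorm_le_dpartial j k s f M : seminorm_le k f M -> (j + size s <= k)%N ->
  seminorm_le j (dpartial s f) M.
Proof.
move=> fM jk s' s'j; rewrite -dpartial_cat.
apply: (@wboundedW j k) => //; first exact: leq_trans (leq_addr _ _) jk.
by apply: fM; rewrite size_cat; apply: leq_trans jk; rewrite leq_add2r.
Qed.

Lemma schwartz_normP k f M : (schwartz_norm k f <= M%:E)%E <-> seminorm_le k f M.
Proof.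
split=> [fM s sk x|fM].
  rewrite -lee_fin; apply: le_trans fM.
  by apply: ereal_sup_ubound; exists (s, x).
by apply: ge_ereal_sup => _ [[s x] /= sk <-]; rewrite lee_fin; exact: fM.
Qed.

Lemma is_schwartz_bounded k f : is_schwartz f -> exists M, seminorm_le k f M.
Proof.
move=> [_ /(_ k)]; case E : (schwartz_norm k f) => [r| |] // _.
  by exists r; apply/schwartz_normP; rewrite E.
by exists 0; apply/schwartz_normP; rewrite E leNye.
Qed.

Definition order0 P T := forall k, exists k' C, 0 <= C /\
  forall f M, P f -> seminorm_le k' f M -> wbounded k (T f) (C * M).

(** The bound is linear in [M] and may use a higher seminorm of [f]; for operators compatible with
    differences this yields continuity ([tame_continuous]). The domain [P] is kept as a parameter
    because the estimates for dilations rest on flatness. *)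
Definition tame P T := (forall f, P f -> is_schwartz (T f)) /\
  forall k, exists k' C, 0 <= C /\
  forall f M, P f -> seminorm_le k' f M -> seminorm_le k (T f) (C * M).

Lemma order0_comp P Q T D : (forall f, P f -> Q (D f)) -> tame P D -> order0 Q T ->
  order0 P (fun f => T (D f)).
Proof.
move=> DQ [_ tD] oT k; have [k' [C [C0 TC]]] := oT k; have [l [B [B0 DB]]] := tD k'.
exists l, (C * B); split; first exact: mulr_ge0.
by move=> f M Pf fM; rewrite -mulrA; apply: TC (DQ _ Pf) _; exact: DB.
Qed.

Lemma tame_comp P Q T D : (forall f, P f -> Q (D f)) -> tame P D -> tame Q T ->
  tame P (fun f => T (D f)).
Proof.
move=> DQ [_ tD] [sT oT]; split=> [f Pf|k]; first exact/sT/DQ.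
have [k' [C [C0 TC]]] := oT k; have [l [B [B0 DB]]] := tD k'.
exists l, (C * B); split; first exact: mulr_ge0.
by move=> f M Pf fM; rewrite -mulrA; apply: TC (DQ _ Pf) _; exact: DB.
Qed.

Lemma tame_id P : P `<=` is_schwartz (n:=m) -> tame P id.
Proof.
move=> PS; split=> // k; exists k, 1; split=> // f M _; by rewrite mul1r.
Qed.

Lemma tame_sub P Q T : P `<=` Q -> tame Q T -> tame P T.
Proof.
move=> PQ [sT tT]; split=> [f /PQ/sT//|k].
by have [k' [C [C0 TC]]] := tT k; exists k', C; split=> // f M /PQ; exact: TC.
Qed.

(* To see that an operator is tame it is enough to find a class G of operators
   containing it such that the values of each T in G are bounded by seminorms of
   the argument, and each partial derivative of T f is a combination of values
   U f with U in G: by induction all derivatives of T f are then bounded by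
   seminorms of f, and they are continuous because their partial derivatives are
   bounded. *)
Inductive op_span (G : set (('rV[R]_m -> R[i]) -> 'rV[R]_m -> R[i])) :
    (('rV[R]_m -> R[i]) -> 'rV[R]_m -> R[i]) -> Prop :=
| span_gen T : G T -> op_span G T
| span_zero : op_span G (fun _ _ => 0)
| span_add T U : op_span G T -> op_span G U -> op_span G (fun f x => T f x + U f x)
| span_scale (a : R[i]) T : op_span G T -> op_span G (fun f x => a * T f x).

Lemma span_sum G (I : finType) (F : I -> ('rV[R]_m -> R[i]) -> 'rV[R]_m -> R[i]) :
  (forall i, op_span G (F i)) -> op_span G (fun f x => \sum_i F i f x).
Proof.
move=> GF; elim: (index_enum I) => [|i r IHr].
  by under eq_fun do under eq_fun do rewrite big_nil; exact: span_zero.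
by under eq_fun do under eq_fun do rewrite big_cons; exact: span_add.
Qed.

Section Span.
Variables (P : set ('rV[R]_m -> R[i])).
Variable (G : set (('rV[R]_m -> R[i]) -> 'rV[R]_m -> R[i])).
Hypothesis PS : P `<=` is_schwartz (n:=m).
Hypothesis G_order0 : forall T, G T -> order0 P T.
Hypothesis G_partial : forall T i, G T -> exists U, op_span G U /\
  forall f x, P f -> cpart i (T f) x (U f x).

Lemma span_order0 T : op_span G T -> order0 P T.
Proof.
elim=> [|k|{}T U _ IHT _ IHU k|a {}T _ IHT k]; first exact: G_order0.
- exists 0%N, 0; split=> // f M _ _ x; by rewrite normc0 mulr0 mul0r.
- have [k1 [C [C0 TC]]] := IHT k; have [k2 [B [B0 UB]]] := IHU k.
  exists (maxn k1 k2), (C + B); split; first exact: addr_ge0.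
  move=> f M Pf fM x; rewrite mulrDl.
  apply: le_trans (lerD (TC f M Pf _ x) (UB f M Pf _ x)).
  + by rewrite -mulrDr ler_wpM2l ?normcD//; apply: le_trans (weight_ge1 _ _).
  + exact: (seminorm_leW (leq_maxl _ _) (lexx _) fM).
  + exact: (seminorm_leW (leq_maxr _ _) (lexx _) fM).
- have [k1 [C [C0 TC]]] := IHT k.
  exists k1, (normc a * C); split; first by rewrite mulr_ge0 ?normc_ge0.
  move=> f M Pf fM x; rewrite normcM mulrCA -mulrA ler_wpM2l ?normc_ge0//.
  exact: TC.
Qed.

Lemma span_partial T i : op_span G T -> exists U, op_span G U /\
  forall f x, P f -> cpart i (T f) x (U f x).
Proof.
elim=> [{}T|{T}|{}T U _ [T' [GT T'E]] _ [U' [GU U'E]]|a {}T _ [T' [GT T'E]]].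
- exact: G_partial.
- exists (fun _ _ => 0); split=> [|f x _]; first exact: span_zero.
  exact: cder_cst.
- exists (fun f x => T' f x + U' f x); split=> [|f x Pf]; first exact: span_add.
  by apply: cderD; [exact: T'E|exact: U'E].
- exists (fun f x => a * T' f x); split=> [|f x Pf]; first exact: span_scale.
  exact/cderZ/T'E.
Qed.

Lemma span_dpartial T s : op_span G T -> exists U, op_span G U /\
  forall f, P f -> dpartial s (T f) = U f.
Proof.
move=> GT; elim: s => [|i s [U [GU UE]]]; first by exists T.
have [V [GV VE]] := span_partial i GU.
exists V; split=> // f Pf; apply/funext => x /=; rewrite -/(dpartial _ _) UE//.
exact/cpart_partial/VE.
Qed.

Lemma span_continuous T f : op_span G T -> P f ->
  continuous (Re_fun (T f)) /\ continuous (Im_fun (T f)).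
Proof.
move=> GT Pf.
have dT i : exists h : 'rV[R]_m -> R[i], (forall x, cpart i (T f) x (h x)) /\
      exists L, 0 <= L /\ forall x, normc (h x) <= L.
  have [U [GU UE]] := span_partial i GT; exists (U f); split=> [x|]; first exact: (UE f x Pf).
  have [k [C [C0 UC]]] := span_order0 GU 0.
  have [M fM] := is_schwartz_bounded k (PS Pf).
  exists (C * M); split; first by rewrite mulr_ge0// (seminorm_le_ge0 fM).
  by move=> x; exact: (wbounded0 x (UC f M Pf fM)).
have [U UP] := fin_all_exists dT.
have [L LP] := fin_all_exists (fun i => (UP i).2).
have UL i x : normc (U i x) <= \sum_i L i.
  rewrite (le_trans ((LP i).2 x))// (bigD1 i)//= lerDl sumr_ge0// => j _.
  exact: (LP j).1.
split.
  apply: (@bounded_partials_continuous _ _ _ (fun i => Re_fun (U i)) (\sum_i L i)).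
    by move=> x i; have [] := (UP i).1 x.
  by move=> i x; apply: le_trans (UL i x); exact: Re_le_normc.
apply: (@bounded_partials_continuous _ _ _ (fun i => Im_fun (U i)) (\sum_i L i)).
  by move=> x i; have [] := (UP i).1 x.
by move=> i x; apply: le_trans (UL i x); exact: Im_le_normc.
Qed.

Lemma span_tame T : op_span G T -> tame P T.
Proof.
move=> GT.
(* The weight [k] and the order [j] of differentiation are separated, so that the induction on [j]
   runs over all of the span at fixed weight; the seminorm takes both equal at the end. *)
have est k j U : op_span G U -> exists k' C, 0 <= C /\ forall f M, P f ->
    seminorm_le k' f M -> forall s, (size s <= j)%N -> wbounded k (dpartial s (U f)) (C * M).
  elim: j U => [|j IHj] U GU.
    have [k' [C [C0 UC]]] := span_order0 GU k; exists k', C; split=> // f M Pf fM [|//] _.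
    exact: UC.
  have [k1 [C1 [C10 UC1]]] := IHj U GU.
  have step i : exists V, (forall f, P f -> partial i (U f) = V f) /\
     exists k', exists C, 0 <= C /\ forall f M, P f ->
     seminorm_le k' f M -> forall s, (size s <= j)%N -> wbounded k (dpartial s (V f)) (C * M).
    have [V [GV VE]] := span_partial i GU; exists V; split; last exact: IHj.
    by move=> f Pf; apply/funext => x; exact/cpart_partial/VE.
  have [V VP] := fin_all_exists step.
  have [k' k'P] := fin_all_exists (fun i => (VP i).2).
  have [C CP] := fin_all_exists k'P.
  have C0 : 0 <= \sum_i C i by apply: sumr_ge0 => i _; exact: (CP i).1.
  exists (maxn k1 (\max_i k' i)), (C1 + \sum_i C i); split; first exact: addr_ge0.
  move=> f M Pf fM s; have M0 := seminorm_le_ge0 fM.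
  (* The innermost derivative is removed: it turns [U f] into [V f] with [V] again in the span, to
     which the induction hypothesis applies. *)
  case/lastP: s => [_|s i].
    apply: (@wboundedW k k _ (C1 * M)) => //; first by rewrite ler_wpM2r// lerDl.
    exact: (UC1 f M Pf (seminorm_leW (leq_maxl _ _) (lexx _) fM) [::]).
  rewrite size_rcons ltnS dpartial_rcons (VP i).1// => sj.
  apply: (@wboundedW k k _ (C i * M)) => //.
    rewrite ler_wpM2r// (bigD1 i)//= addrCA lerDl addr_ge0// sumr_ge0// => l _.
    exact: (CP l).1.
  apply: (CP i).2 => //; apply: seminorm_leW (lexx _) fM.
  by apply: leq_trans (leq_maxr _ _); exact: leq_bigmax.
split=> [f Pf|k]; last first.
  have [k' [C [C0 TC]]] := est k k T GT; by exists k', C.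
split=> [s|k].
  have [U [GU UE]] := span_dpartial s GT; rewrite UE//.
  have [cR cI] := span_continuous GU Pf; split=> // i x.
  have [V [GV VE]] := span_partial i GU; exact: (cpart_derivable (VE f x Pf)).
have [k' [C [C0 TC]]] := est k k T GT.
have [M fM] := is_schwartz_bounded k' (PS Pf).
apply: (@le_lt_trans _ _ (C * M)%:E); last exact: ltry.
apply/schwartz_normP => s; exact: (TC f M Pf fM).
Qed.

End Span.

End Tame.

(** * Linear structure, derivatives and coordinate multiplications *)

Section SchwartzAlgebra.
Variables (R : realType) (m : nat).
Implicit Types (f g : 'rV[R]_m -> R[i]) (x : 'rV[R]_m) (i j : 'I_m) (s : seq 'I_m).

Lemma dpartialD s f g : smooth f -> smooth g ->
  dpartial s (f + g) = dpartial s f + dpartial s g.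
Proof.
move=> sf sg; elim: s => [//|i s IHs] /=; rewrite -/(dpartial _ _) IHs.
apply/funext => x; apply: partialD; exact: smooth_cpart.
Qed.

Lemma dpartialZ s (a : R[i]) f : smooth f ->
  dpartial s (a *: f) = a *: dpartial s f.
Proof.
move=> sf; elim: s => [//|i s IHs] /=; rewrite -/(dpartial _ _) IHs.
apply/funext => x; apply: cpart_partial; apply: cderZ; exact: smooth_cpart.
Qed.

Lemma smoothP f : smooth f <-> forall s, continuous (Re_fun (dpartial s f)) /\
  continuous (Im_fun (dpartial s f)) /\
  forall i x, exists d, cpart i (dpartial s f) x d.
Proof.
split=> [sf s|H s].
  have [? ? _] := sf s; split=> //; split=> // i x.
  by exists (dpartial (i :: s) f x); exact: smooth_cpart.
have [c1 [c2 dd]] := H s; split=> // i x.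
have [d dP] := dd i x; exact: cpart_derivable dP.
Qed.

Lemma smoothD f g : smooth f -> smooth g -> smooth (f + g).
Proof.
move=> sf sg; apply/smoothP => s; rewrite dpartialD//.
have [f1 f2 _] := sf s; have [g1 g2 _] := sg s; split; last split.
- move=> x; rewrite (_ : Re_fun _ = (fun x => Re_fun (dpartial s f) x + Re_fun (dpartial s g) x)).
    exact: (cvgD (f1 x) (g1 x)).
  by apply/funext => y; exact: ReD.
- move=> x; rewrite (_ : Im_fun _ = (fun x => Im_fun (dpartial s f) x + Im_fun (dpartial s g) x)).
    exact: (cvgD (f2 x) (g2 x)).
  by apply/funext => y; exact: ImD.
- move=> i x; exists (dpartial (i :: s) f x + dpartial (i :: s) g x).
  apply: cderD; exact: smooth_cpart.
Qed.

Lemma smoothZ (a : R[i]) f : smooth f -> smooth (a *: f).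
Proof.
move=> sf; apply/smoothP => s; rewrite dpartialZ//.
have [f1 f2 _] := sf s; split; last split.
- move=> x; rewrite (_ : Re_fun _ = (fun x => complex.Re a * Re_fun (dpartial s f) x
      - complex.Im a * Im_fun (dpartial s f) x)).
    exact: (cvgB (cvgM (cvg_cst _) (f1 x)) (cvgM (cvg_cst _) (f2 x))).
  by apply/funext => y; exact: ReM.
- move=> x; rewrite (_ : Im_fun _ = (fun x => complex.Re a * Im_fun (dpartial s f) x
      + complex.Im a * Re_fun (dpartial s f) x)).
    exact: (cvgD (cvgM (cvg_cst _) (f2 x)) (cvgM (cvg_cst _) (f1 x))).
  by apply/funext => y; exact: ImM.
- move=> i x; exists (a * dpartial (i :: s) f x).
  apply: cderZ; exact: smooth_cpart.
Qed.

Lemma seminorm_leD k f g (M N : R) : smooth f -> smooth g ->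
  seminorm_le k f M -> seminorm_le k g N -> seminorm_le k (f + g) (M + N).
Proof.
move=> sf sg fM gN s sk x; rewrite dpartialD//.
apply: le_trans (lerD (fM s sk x) (gN s sk x)).
by rewrite -mulrDr ler_wpM2l ?normcD// (le_trans _ (weight_ge1 _ _)).
Qed.

Lemma seminorm_leZ k (a : R[i]) f (M : R) : smooth f ->
  seminorm_le k f M -> seminorm_le k (a *: f) (normc a * M).
Proof.
move=> sf fM s sk x; rewrite dpartialZ//.
rewrite (_ : (a *: dpartial s f) x = a * dpartial s f x)//.
by rewrite normcM mulrCA ler_wpM2l ?normc_ge0//; exact: fM.
Qed.

Lemma is_schwartz_bounds f : smooth f -> (forall k, exists M, seminorm_le k f M) ->
  is_schwartz f.
Proof.
move=> sf H; split=> // k; have [M fM] := H k.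
by apply: (@le_lt_trans _ _ M%:E); [exact/schwartz_normP|exact: ltry].
Qed.

Lemma is_schwartzD f g : is_schwartz f -> is_schwartz g -> is_schwartz (f + g).
Proof.
move=> Sf Sg; apply: is_schwartz_bounds.
  exact: smoothD Sf.1 Sg.1.
move=> k; have [M fM] := is_schwartz_bounded k Sf; have [N gN] := is_schwartz_bounded k Sg.
exists (M + N); apply: seminorm_leD => //; [exact: Sf.1|exact: Sg.1].
Qed.

Lemma is_schwartzZ (a : R[i]) f : is_schwartz f -> is_schwartz (a *: f).
Proof.
move=> Sf; apply: is_schwartz_bounds; first exact: smoothZ Sf.1.
move=> k; have [M fM] := is_schwartz_bounded k Sf.
exists (normc a * M); apply: seminorm_leZ => //; exact: Sf.1.
Qed.

Definition coordmul j f : 'rV[R]_m -> R[i] := fun x => (x ord0 j)%:C%C * f x.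

Lemma is_derive_upd x i j (t : R) :
  is_derive t 1 (fun u : R => upd x i u ord0 j : R) (j == i)%:R.
Proof.
under eq_fun do rewrite updE.
case: eqP => _ /=; [exact: is_derive_id|exact: is_derive_cst].
Qed.

Lemma coordmul_cpart i j f x d : cpart i f x d ->
  cpart i (coordmul j f) x ((j == i)%:R%:C%C * f x + (x ord0 j)%:C%C * d).
Proof.
move=> fd; have := cderM (cder_real (is_derive_upd x i j (x ord0 i))) fd.
by rewrite !upd_id.
Qed.

(** The span of this class is closed under differentiation by the product rule: differentiating x_j
    d^s f in direction i gives delta_ij d^s f plus x_j times a derivative of f of one higher
    order. *)
Let basic_ops : set (('rV[R]_m -> R[i]) -> 'rV[R]_m -> R[i]) :=
  [set T | (exists s, T = dpartial s) \/ exists j s, T = coordmul j \o dpartial s].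

Let basic_order0 T : basic_ops T -> order0 (@is_schwartz R m) T.
Proof.
move=> [[s ->]|[j [s ->]]] k.
  exists (k + size s)%N, 1; split=> // f M _ fM; rewrite mul1r.
  apply: (@wboundedW _ _ _ _ _ M _ (leq_addr (size s) k)) => //.
  by apply: fM; rewrite leq_addl.
exists (k.+1 + size s)%N, 1; split=> // f M _ fM x; rewrite mul1r.
have /(_ x) := @wboundedW _ _ _ _ _ M _ (leq_addr (size s) k.+1) (lexx M)
  (fM s (leq_addl _ _)); apply: le_trans.
rewrite exprS -mulrA mulrCA ler_wpM2l//.
rewrite /= /coordmul normcM normc_real ler_wpM2r ?normc_ge0//.
by rewrite (le_trans (coord_le_norm x j))// lerDr.
Qed.

Let basic_partial T i : basic_ops T -> exists U, op_span basic_ops U /\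
  forall f x, is_schwartz f -> cpart i (T f) x (U f x).
Proof.
move=> [[s ->]|[j [s ->]]].
  exists (dpartial (i :: s)); split; first by apply: span_gen; left; exists (i :: s).
  by move=> f x [sf _]; exact: smooth_cpart.
exists (fun f x => (j == i)%:R%:C%C * dpartial s f x + coordmul j (dpartial (i :: s) f) x).
split.
  apply: span_add; last by apply: span_gen; right; exists j, (i :: s).
  by apply: span_scale; apply: span_gen; left; exists s.
by move=> f x [sf _]; apply: coordmul_cpart; exact: smooth_cpart.
Qed.

Lemma tame_dpartial s : tame (@is_schwartz R m) (dpartial s).
Proof.
apply: (span_tame _ basic_order0 basic_partial) => //.
by apply: span_gen; left; exists s.
Qed.

Lemma tame_coordmul j : tame (@is_schwartz R m) (coordmul j).
Proof.
apply: (span_tame _ basic_order0 basic_partial) => //.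
by apply: span_gen; right; exists j, [::].
Qed.

Lemma is_schwartz_dpartial s f : is_schwartz f -> is_schwartz (dpartial s f).
Proof. by move=> Sf; apply: (tame_dpartial s).1. Qed.

Lemma is_schwartz_coordmul j f : is_schwartz f -> is_schwartz (coordmul j f).
Proof. exact: (tame_coordmul j).1. Qed.

Lemma tame_scale (a : R[i]) : tame (@is_schwartz R m) (fun f => a *: f).
Proof.
split=> [f|k]; first exact: is_schwartzZ.
exists k, (normc a); split; first exact: normc_ge0.
by move=> f M [sf _] fM; exact: seminorm_leZ.
Qed.

End SchwartzAlgebra.

(** * Integration of complex-valued functions *)

Section ComplexSequences.
Variable R : realType.
Implicit Types (u : nat -> R[i]) (l : R[i]).

(** Convergence is stated through the moduli, so that only limits of real sequences occur. *)
Definition ccvg u l := normc (u n - l) @[n --> \oo] --> (0 : R).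

Lemma cvg0_squeeze (v w : nat -> R) : (forall n, 0 <= v n <= w n) ->
  w n @[n --> \oo] --> (0 : R) -> v n @[n --> \oo] --> (0 : R).
Proof.
move=> vw w0.
exact: (@squeeze_cvgr _ _ _ _ (cst 0) w v (nearW _ vw) 0 (cvg_cst 0) w0).
Qed.

Lemma ccvgP u l : ccvg u l <->
  complex.Re (u n) @[n --> \oo] --> complex.Re l /\
  complex.Im (u n) @[n --> \oo] --> complex.Im l.
Proof.
split=> [ul|[u1 u2]].
  have sq (f : R[i] -> R) : (forall z w, f (z - w) = f z - f w) ->
      (forall z, `|f z| <= normc z) -> f (u n) @[n --> \oo] --> f l.
    move=> fB fz; apply/subr_cvg0; apply: norm_cvg0.
    apply: (@cvg0_squeeze (fun n => `|f (u n) - f l|) _ _ ul) => n.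
    by rewrite normr_ge0 -fB fz.
  split; apply: sq => [z w|z]; rewrite ?ReImE//;
    by [exact: Re_le_normc|exact: Im_le_normc].
have : `|complex.Re (u n) - complex.Re l| + `|complex.Im (u n) - complex.Im l|
    @[n --> \oo] --> (0 + 0 : R).
  by apply: cvgD; rewrite -(@normr0 _ R); apply: cvg_norm; exact/subr_cvg0.
rewrite addr0 => H; rewrite /ccvg; apply: (cvg0_squeeze _ H) => n; rewrite normc_ge0 (le_trans (normc_le_ReIm _))//.
by rewrite !ReImE.
Qed.

Lemma ccvg_unique u l l' : ccvg u l -> ccvg u l' -> l = l'.
Proof.
move=> /ccvgP[r1 i1] /ccvgP[r2 i2]; apply: complexP.
  exact: cvg_unique r1 r2.
exact: cvg_unique i1 i2.
Qed.

Lemma ccvg_cst l : ccvg (fun=> l) l.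
Proof. by rewrite /ccvg; under eq_fun do rewrite subrr normc0; exact: cvg_cst. Qed.

Lemma ccvg_squeeze u l (w : nat -> R) : (forall n, normc (u n - l) <= w n) ->
  w n @[n --> \oo] --> (0 : R) -> ccvg u l.
Proof.
by move=> uw w0; rewrite /ccvg; apply: (cvg0_squeeze _ w0) => n; rewrite normc_ge0 uw.
Qed.

End ComplexSequences.

Section ComplexIntegral.
Context d (T : measurableType d) (R : realType).
Variables (mu : {measure set T -> \bar R}) (D : set T).
Hypothesis mD : measurable D.
Implicit Types (h k : T -> R[i]) (g : T -> R).

Definition cint h : R[i] :=
  Complex (\int[mu]_(t in D) (fun t => complex.Re (h t)) t)
          (\int[mu]_(t in D) (fun t => complex.Im (h t)) t).

Definition cmeasurable h :=
  measurable_fun D (fun t => complex.Re (h t) : R) /\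
  measurable_fun D (fun t => complex.Im (h t) : R).

Definition cintegrable h :=
  mu.-integrable D (EFin \o (fun t => complex.Re (h t))) /\
  mu.-integrable D (EFin \o (fun t => complex.Im (h t))).

Lemma cintegrable_measurable h : cintegrable h -> cmeasurable h.
Proof.
by move=> [/integrableP[/measurable_EFinP ? _] /integrableP[/measurable_EFinP ? _]].
Qed.

Lemma cmeasurableM h k : cmeasurable h -> cmeasurable k ->
  cmeasurable (fun t => h t * k t).
Proof.
move=> [h1 h2] [k1 k2]; split.
  under eq_fun do rewrite ReM; by apply: measurable_funB; exact: measurable_funM.
under eq_fun do rewrite ImM; by apply: measurable_funD; exact: measurable_funM.
Qed.

Lemma cmeasurable_real g : measurable_fun D g -> cmeasurable (fun t => (g t)%:C%C).
Proof. by move=> mg; split => //=; exact: measurable_cst. Qed.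

Lemma cmeasurable_expi g : measurable_fun D g -> cmeasurable (fun t => expi (g t)).
Proof.
move=> mg; split; rewrite /expi /=.
  by apply: (measurableT_comp _ mg); apply: continuous_measurable_fun; exact: continuous_cos.
by apply: (measurableT_comp _ mg); apply: continuous_measurable_fun; exact: continuous_sin.
Qed.

Lemma cintegrable_le h g : cmeasurable h -> mu.-integrable D (EFin \o g) ->
  (forall t, D t -> normc (h t) <= g t) -> cintegrable h.
Proof.
move=> [h1 h2] ig hg; split; apply: le_integrable ig => //.
- exact/measurable_EFinP.
- move=> t Dt /=; rewrite lee_fin (le_trans (Re_le_normc _))//.
  exact: le_trans (hg t Dt) (ler_norm _).
- exact/measurable_EFinP.
- move=> t Dt /=; rewrite lee_fin (le_trans (Im_le_normc _))//.
  exact: le_trans (hg t Dt) (ler_norm _).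
Qed.

Lemma cintegrableD h k : cintegrable h -> cintegrable k ->
  cintegrable (fun t => h t + k t).
Proof.
move=> [h1 h2] [k1 k2]; split.
  have := integrableD mD h1 k1; apply: eq_integrable => // t _.
  by rewrite /= ReD.
have := integrableD mD h2 k2; apply: eq_integrable => // t _.
by rewrite /= ImD.
Qed.

Lemma integrableZE (a : R) (f : T -> R) : mu.-integrable D (EFin \o f) ->
  mu.-integrable D (EFin \o (fun t => a * f t)).
Proof.
move=> fi; have := integrableZl mD a fi; apply: eq_integrable => // t _.
Qed.

Lemma integrableDE (f g : T -> R) : mu.-integrable D (EFin \o f) ->
  mu.-integrable D (EFin \o g) -> mu.-integrable D (EFin \o (fun t => f t + g t)).
Proof. by move=> fi gi; have := integrableD mD fi gi; apply: eq_integrable. Qed.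

Lemma integrableBE (f g : T -> R) : mu.-integrable D (EFin \o f) ->
  mu.-integrable D (EFin \o g) -> mu.-integrable D (EFin \o (fun t => f t - g t)).
Proof. by move=> fi gi; have := integrableB mD fi gi; apply: eq_integrable. Qed.

Lemma cintegrableZ (a : R[i]) h : cintegrable h -> cintegrable (fun t => a * h t).
Proof.
move=> [h1 h2]; split.
  under [X in EFin \o X]eq_fun do rewrite ReM.
  by apply: integrableBE; exact: integrableZE.
under [X in EFin \o X]eq_fun do rewrite ImM.
by apply: integrableDE; exact: integrableZE.
Qed.

Lemma cintD h k : cintegrable h -> cintegrable k ->
  cint (fun t => h t + k t) = cint h + cint k.
Proof.
move=> [h1 h2] [k1 k2]; apply: complexP; rewrite ?ReD ?ImD /=.
  by under eq_Rintegral do rewrite ReD; exact: RintegralD.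
by under eq_Rintegral do rewrite ImD; exact: RintegralD.
Qed.

Lemma cintZ (a : R[i]) h : cintegrable h -> cint (fun t => a * h t) = a * cint h.
Proof.
move=> [h1 h2]; apply: complexP; rewrite ?ReM ?ImM /=.
  under eq_Rintegral do rewrite ReM.
  by rewrite RintegralB//; [rewrite !RintegralZl|exact: integrableZE|exact: integrableZE].
under eq_Rintegral do rewrite ImM.
by rewrite RintegralD//; [rewrite !RintegralZl|exact: integrableZE|exact: integrableZE].
Qed.

Lemma cint_le h g : cintegrable h -> mu.-integrable D (EFin \o g) ->
  (forall t, D t -> normc (h t) <= g t) ->
  normc (cint h) <= 2 * \int[mu]_(t in D) g t.
Proof.
move=> [h1 h2] ig hg; rewrite (le_trans (normc_le_ReIm _))// mulrDl mul1r.
apply: lerD; apply: le_trans (le_normr_Rintegral mD _) _ => //;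
  apply: le_Rintegral => //; try exact: integrable_norm.
- by move=> t Dt; apply: le_trans (hg t Dt); exact: Re_le_normc.
- by move=> t Dt; apply: le_trans (hg t Dt); exact: Im_le_normc.
Qed.

Lemma cint_dominated (h_ : nat -> T -> R[i]) h g :
  (forall n, cmeasurable (h_ n)) -> cmeasurable h ->
  mu.-integrable D (EFin \o g) ->
  (forall n t, D t -> normc (h_ n t) <= g t) ->
  (forall t, D t -> ccvg (h_ ^~ t) (h t)) ->
  ccvg (fun n => cint (h_ n)) (cint h).
Proof.
move=> mh_ mh ig hg hh; apply/ccvgP.
have part (f : R[i] -> R) : (forall z, `|f z| <= normc z) ->
   (forall n, measurable_fun D (fun t => f (h_ n t))) ->
   measurable_fun D (fun t => f (h t)) ->
   (forall t, D t -> f (h_ n t) @[n --> \oo] --> f (h t)) ->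
   \int[mu]_(t in D) f (h_ n t) @[n --> \oo] --> \int[mu]_(t in D) f (h t).
  move=> fz mf_ mf ff.
  have A n : measurable_fun D (fun t => (f (h_ n t))%:E) by exact/measurable_EFinP.
  have B : measurable_fun D (fun t => (f (h t))%:E) by exact/measurable_EFinP.
  have C : {ae mu, forall t, D t -> (fun n => (f (h_ n t))%:E) @ \oo --> (f (h t))%:E}.
    by apply: aeW => t Dt; apply: cvg_EFin; [exact: nearW|exact: ff].
  have E : {ae mu, forall t n, D t -> (`|(f (h_ n t))%:E| <= (EFin \o g) t)%E}.
    by apply: aeW => t n Dt; rewrite /= lee_fin (le_trans (fz _))// hg.
  have [fi _ H] := @dominated_convergence _ _ _ mu D mD _ _ _ A B C ig E.
  apply: fine_cvg; rewrite fineK; last exact: (integrable_fin_num mD fi).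
  exact: H.
split.
  apply: (part (@complex.Re R)) => [z|n||t Dt].
  - exact: Re_le_normc.
  - exact: (mh_ n).1.
  - exact: mh.1.
  - by have /ccvgP[] := hh t Dt.
apply: (part (@complex.Im R)) => [z|n||t Dt].
- exact: Im_le_normc.
- exact: (mh_ n).2.
- exact: mh.2.
- by have /ccvgP[] := hh t Dt.
Qed.

Lemma cint0 : cint (fun=> 0) = 0.
Proof. by apply: complexP; rewrite /= Rintegral_cst// mul0r. Qed.

Lemma eq_cint h k : (forall t, D t -> h t = k t) -> cint h = cint k.
Proof.
move=> hk; apply: complexP => /=.
  by apply: eq_Rintegral => t /set_mem/hk ->.
by apply: eq_Rintegral => t /set_mem/hk ->.
Qed.

End ComplexIntegral.

(** * Fubini's theorem and integrable tensor products *)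

Section ComplexFubini.
Context d1 d2 (T1 : measurableType d1) (T2 : measurableType d2) (R : realType).
Variables (m1 : {sigma_finite_measure set T1 -> \bar R}).
Variables (m2 : {sigma_finite_measure set T2 -> \bar R}).
Variable F : T1 * T2 -> R[i].
Hypothesis iF : cintegrable (m1 \x m2)%E setT F.

(** The real-valued integral takes the finite part of an extended one; integrability of every
    section ensures that nothing is lost in the inner integral. *)
Lemma cint_fubini12 : (forall x, cintegrable m2 setT (fun y => F (x, y))) ->
  cint (m1 \x m2)%E setT F = cint m1 setT (fun x => cint m2 setT (fun y => F (x, y))).
Proof.
move=> i2.
have part (f : R[i] -> R) : (m1 \x m2)%E.-integrable setT (EFin \o (fun z => f (F z))) ->
    (forall x, m2.-integrable setT (EFin \o (fun y => f (F (x, y))))) ->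
    \int[(m1 \x m2)%E]_z f (F z) = \int[m1]_x \int[m2]_y f (F (x, y)).
  move=> fi fi2; rewrite /Rintegral -(integral12_prod_meas1 fi).
  congr fine; apply: eq_integral => x _; rewrite fineK//.
  exact: (integrable_fin_num measurableT (fi2 x)).
apply: complexP => /=.
  by apply: (part (@complex.Re R)) => [|x]; [exact: iF.1|exact: (i2 x).1].
by apply: (part (@complex.Im R)) => [|x]; [exact: iF.2|exact: (i2 x).2].
Qed.

Lemma cint_fubini21 : (forall y, cintegrable m1 setT (fun x => F (x, y))) ->
  cint (m1 \x m2)%E setT F = cint m2 setT (fun y => cint m1 setT (fun x => F (x, y))).
Proof.
move=> i2.
have part (f : R[i] -> R) : (m1 \x m2)%E.-integrable setT (EFin \o (fun z => f (F z))) ->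
    (forall y, m1.-integrable setT (EFin \o (fun x => f (F (x, y))))) ->
    \int[(m1 \x m2)%E]_z f (F z) = \int[m2]_y \int[m1]_x f (F (x, y)).
  move=> fi fi2; rewrite /Rintegral -(integral21_prod_meas1 fi).
  congr fine; apply: eq_integral => x _; rewrite fineK//.
  exact: (integrable_fin_num measurableT (fi2 x)).
apply: complexP => /=.
  by apply: (part (@complex.Re R)) => [|x]; [exact: iF.1|exact: (i2 x).1].
by apply: (part (@complex.Im R)) => [|x]; [exact: iF.2|exact: (i2 x).2].
Qed.

End ComplexFubini.

Section ProductIntegrable.
Context d1 d2 (T1 : measurableType d1) (T2 : measurableType d2) (R : realType).
Variables (m1 : {sigma_finite_measure set T1 -> \bar R}).
Variables (m2 : {sigma_finite_measure set T2 -> \bar R}).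

Lemma integrable_tensor (g1 : T1 -> R) (g2 : T2 -> R) :
  (forall x, 0 <= g1 x) -> (forall y, 0 <= g2 y) ->
  m1.-integrable setT (EFin \o g1) -> m2.-integrable setT (EFin \o g2) ->
  (m1 \x m2)%E.-integrable setT (EFin \o (fun z => g1 z.1 * g2 z.2)).
Proof.
move=> g10 g20 /[dup] i1 /integrableP[/measurable_EFinP m1g _].
move=> /[dup] i2 /integrableP[/measurable_EFinP m2g _].
have mg : measurable_fun setT (EFin \o (fun z : T1 * T2 => g1 z.1 * g2 z.2)).
  apply/measurable_EFinP; apply: measurable_funM.
    exact: (measurableT_comp m1g measurable_fst).
  exact: (measurableT_comp m2g measurable_snd).
apply/(integrable12ltyP m1 m2 mg).
pose c2 := \int[m2]_y g2 y.
have E x : (\int[m2]_y `|(g1 x * g2 y)%R%:E| = (g1 x * c2)%R%:E)%E.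
  under eq_integral do rewrite /= ger0_norm ?mulr_ge0// EFinM.
  rewrite integralZl// /c2 /Rintegral EFinM fineK//.
  exact: (integrable_fin_num measurableT i2).
rewrite /=; under eq_integral do rewrite E.
have c20 : 0 <= c2 by exact: Rintegral_ge0.
have := integrableZr measurableT c2 i1.
move=> /integrableP[_]; apply: le_lt_trans; apply: ge0_le_integral => //.
- by move=> x _; rewrite lee_fin mulr_ge0.
- apply/measurable_EFinP; apply: measurable_funM => //; exact: measurable_cst.
- apply: measurableT_comp => //; apply/measurable_EFinP.
  by apply: measurable_funM => //; exact: measurable_cst.
- by move=> x _ /=; rewrite lee_fin ler_norm.
Qed.

End ProductIntegrable.

(** * Integrals over the line *)

Section LineIntegral.
Variable R : realType.
Notation lam := (@lebesgue_measure R).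
(* R itself carries a measurable structure with another display; lam lives on RT. *)
Notation RT := (measurableTypeR R).
Implicit Types (h H : R -> R[i]) (M a b t : R).

(** The common majorant on the line: two powers of the Schwartz weight dominate 1 + t^2. *)
Definition invsq t : R := (1 + t ^+ 2)^-1.

Lemma oneDsq_gt0 t : 0 < 1 + t ^+ 2.
Proof. by rewrite ltr_wpDr// sqr_ge0. Qed.

Lemma invsq_gt0 t : 0 < invsq t.
Proof. by rewrite invr_gt0 oneDsq_gt0. Qed.

Lemma invsq_ge0 t : 0 <= invsq t.
Proof. exact/ltW/invsq_gt0. Qed.

Lemma invsq_le1 t : invsq t <= 1.
Proof. by rewrite invf_le1 ?oneDsq_gt0// lerDl sqr_ge0. Qed.

Lemma continuous_invsq : continuous invsq.
Proof. exact: continuous_oneDsqrV. Qed.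

Lemma integrable_invsq : lam.-integrable setT (EFin \o invsq).
Proof.
apply/integrableP; split.
  apply/measurable_EFinP; apply: continuous_measurable_fun; exact: continuous_invsq.
under eq_integral do rewrite /= ger0_norm ?invsq_ge0//.
rewrite (ge0_symfun_integralT invsq_ge0 continuous_invsq); last first.
  by move=> t; rewrite /invsq /= sqrrN.
rewrite -set_itvcy.
have -> : (\int[lam]_(x in `[0%R, +oo[) (invsq x)%:E = (pi / 2)%:E)%E.
  exact: integral0y_oneDsqr.
by rewrite -EFinM ltry.
Qed.

Lemma weight_le_invsq t (c M : R) : (1 + `|t|) ^+ 2 * c <= M -> 0 <= c -> c <= M * invsq t.
Proof.
move=> cM c0; rewrite ler_pdivlMr ?oneDsq_gt0// mulrC; apply: le_trans cM.
rewrite ler_wpM2r// sqrrD expr1n mul1r real_normK ?num_real// -addrA lerD2l lerDr.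
by rewrite mulrn_wge0.
Qed.

Definition ccont h := continuous (fun t => complex.Re (h t) : R) /\
  continuous (fun t => complex.Im (h t) : R).

Definition cdecay h M := forall t, normc (h t) <= M * invsq t.

Lemma ccont_cder h dh : (forall t, cder h t (dh t)) -> ccont h.
Proof. by move=> hd; split=> t; have [] := cder_continuous (hd t). Qed.

Lemma ccontM h k : ccont h -> ccont k -> ccont (fun t => h t * k t).
Proof.
move=> [h1 h2] [k1 k2]; split.
  under eq_fun do rewrite ReM.
  by move=> t; exact: (cvgB (cvgM (h1 t) (k1 t)) (cvgM (h2 t) (k2 t))).
under eq_fun do rewrite ImM.
by move=> t; exact: (cvgD (cvgM (h1 t) (k2 t)) (cvgM (h2 t) (k1 t))).
Qed.

Lemma ccont_expi (f : R -> R) : continuous f -> ccont (fun t => expi (f t)).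
Proof.
move=> cf; split=> t; rewrite /expi /=.
  apply: (@continuous_comp _ _ _ f cos); [exact: cf|exact: continuous_cos].
apply: (@continuous_comp _ _ _ f sin); [exact: cf|exact: continuous_sin].
Qed.

Lemma ccont_real (f : R -> R) : continuous f -> ccont (fun t => (f t)%:C%C).
Proof. by move=> cf; split => //= t; exact: cvg_cst. Qed.

Lemma continuous_measurable_line (f : R -> R) : continuous f ->
  @measurable_fun _ _ RT R setT f.
Proof. by move=> /continuous_measurable_fun mf; exact: mf. Qed.

Lemma ccont_measurable h : ccont h -> @cmeasurable _ RT R setT h.
Proof. by move=> [h1 h2]; split; exact: continuous_measurable_line. Qed.

Lemma integrable_invsqZ M : lam.-integrable setT (EFin \o (fun t => M * invsq t)).
Proof. exact: (integrableZE measurableT _ integrable_invsq). Qed.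

Lemma cdecay_integrable h M : @cmeasurable _ RT R setT h -> cdecay h M -> cintegrable lam setT h.
Proof.
move=> mh hM; apply: (cintegrable_le measurableT mh (integrable_invsqZ M)) => t _.
exact: hM.
Qed.

Lemma cint_decay h M : @cmeasurable _ RT R setT h -> cdecay h M ->
  normc (cint lam setT h) <= 2 * (M * \int[lam]_t invsq t).
Proof.
move=> mh hM; rewrite -(RintegralZl _ measurableT integrable_invsq).
apply: cint_le => //; first exact: cdecay_integrable hM.
exact: integrable_invsqZ.
Qed.

Lemma cint_FTC H h a b : a < b -> (forall t, cder H t (h t)) -> ccont h ->
  cint lam `[a, b] h = H b - H a.
Proof.
move=> ab Hh [h1 h2].
have part (F f : R -> R) : (forall t, is_derive t 1 F (f t)) -> continuous f ->
    \int[lam]_(t in `[a, b]) f t = F b - F a.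
  move=> Ff cf.
  have cF : continuous F.
    by move=> t; apply/differentiable_continuous/derivable1_diffP; have [] := Ff t.
  rewrite /Rintegral (@continuous_FTC2 R f F a b)//.
  - exact: continuous_subspaceT.
  - split; first by move=> t _; have [] := Ff t.
      by apply: cvg_at_right_filter; exact: cF.
    by apply: cvg_at_left_filter; exact: cF.
  - by move=> t _; rewrite derive1E; have [] := Ff t.
apply: complexP; rewrite !ReImE.
  apply: (part (fun t => complex.Re (H t)) (fun t => complex.Re (h t))) => // t.
  by have [] := Hh t.
apply: (part (fun t => complex.Im (H t)) (fun t => complex.Im (h t))) => // t.
by have [] := Hh t.
Qed.

Lemma cint_indic (D : set R) h : measurable D ->
  cint lam D h = cint lam setT (fun t => (\1_D t)%:C%C * h t).
Proof.
move=> mD; apply: complexP => /=.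
  rewrite Rintegral_mkcond; apply: eq_Rintegral => t _.
  by rewrite ReM /= mul0r subr0 /patch indicE; case: ifP; rewrite ?mul1r ?mul0r.
rewrite Rintegral_mkcond; apply: eq_Rintegral => t _.
by rewrite ImM /= mul0r addr0 /patch indicE; case: ifP; rewrite ?mul1r ?mul0r.
Qed.

(** Dominated convergence for the indicators of [-n, n]. It reduces integrals over the line to
    antiderivatives and their limits. *)
Lemma cint_exhaust h : cintegrable lam setT h ->
  ccvg (fun n => cint lam `[- n%:R, n%:R] h) (cint lam setT h).
Proof.
move=> ih; have mh := cintegrable_measurable ih.
under [X in ccvg X _]eq_fun do rewrite cint_indic//.
have [i1 i2] := ih.
have ig : lam.-integrable setT (EFin \o (fun t => `|complex.Re (h t)| + `|complex.Im (h t)|)).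
  by apply: (integrableDE measurableT); exact: integrable_norm.
apply: (cint_dominated measurableT _ mh ig) => [n|n t _|t _].
- by apply: cmeasurableM => //; apply: cmeasurable_real; exact: measurable_indic.
- rewrite normcM normc_real indicE; case: (_ \in _); rewrite /= ?normr1 ?normr0 ?mul1r ?mul0r.
    exact: normc_le_ReIm.
  exact: addr_ge0.
- apply/cvgrPdist_le => e e0; near=> n.
  rewrite indicE mem_set ?mul1r ?subrr ?normc0 ?subrr ?normr0 ?ltW//=.
  rewrite in_itv /= -ler_norml.
  by near: n; exact: nbhs_infty_ger.
Unshelve. all: by end_near. Qed.

Lemma cdecay_cvg h M (s : nat -> R) : (forall n, `|s n| = n%:R) -> cdecay h M ->
  ccvg (fun n => h (s n)) 0.
Proof.
move=> sn hM; apply: (@ccvg_squeeze _ _ _ (fun n => M * harmonic n)) => [n|].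
  rewrite subr0; apply: le_trans (hM _) _.
  have M0 : 0 <= M.
    by have := le_trans (normc_ge0 _) (hM 0); rewrite pmulr_lge0// invsq_gt0.
  (* [harmonic n] is 1 / (n + 1), and 1 + n^2 is at least n + 1 for a natural number n. *)
  rewrite ler_wpM2l// lef_pV2 ?posrE ?oneDsq_gt0//.
  rewrite -[s n ^+ 2]real_normK ?num_real// sn -natrX -natr1 addrC lerD2l ler_nat.
  by case: n {sn} => // n; rewrite expnS expn1 leq_pmulr.
rewrite -[X in _ --> X](mulr0 M); apply: cvgM; first exact: cvg_cst.
exact: cvg_harmonic.
Qed.

(** The boundary terms at n and -n vanish in the limit. Applied to a product, this is integration by
    parts. *)
Lemma cint_derivative H h M N : (forall t, cder H t (h t)) -> ccont h ->
  cdecay H M -> cdecay h N -> cint lam setT h = 0.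
Proof.
move=> Hh ch HM hN.
have ih : cintegrable lam setT h by apply: cdecay_integrable hN; exact: ccont_measurable.
apply: (ccvg_unique (cint_exhaust ih)).
have H1 := @cdecay_cvg H M (fun n => n%:R) (fun n => ger0_norm (ler0n _ n)) HM.
have H2 : ccvg (fun n => H (- n%:R)) 0.
  by apply: cdecay_cvg HM => n; rewrite normrN ger0_norm.
have : normc (H n%:R - 0) + normc (H (- n%:R) - 0) @[n --> \oo] --> (0 + 0 : R).
  by apply: cvgD.
(* Index 0 is separate, because [cint_FTC] requires a nondegenerate interval. *)
rewrite addr0; apply: ccvg_squeeze => -[|n].
  rewrite subr0 oppr0 set_itv1 /cint !Rintegral_set1 subr0.
  by rewrite (_ : Complex 0 0 = 0)// normc0 addr_ge0 ?normc_ge0.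
rewrite !subr0 (cint_FTC _ Hh ch) ?gtrN//.
by apply: le_trans (normcD _ _) _; rewrite normcN.
Qed.

End LineIntegral.

(** * Fourier inversion on the line *)

Section PoissonKernel.
Variable R : realType.
Notation lam := (@lebesgue_measure R).
Notation RT := (measurableTypeR R).
Implicit Types (e u s t x : R).

Definition abel e s : R := expR (- (e * `|s|)).

(** The Poisson kernel without the normalization 1 / (2 pi); its mass 2 pi becomes the constant of
    the inversion formula. *)
Definition poisson e u : R := 2 * e / (e ^+ 2 + u ^+ 2).

Lemma abel_ge0 e s : 0 <= abel e s.
Proof. exact: expR_ge0. Qed.

Lemma continuous_abel e : continuous (abel e).
Proof.
move=> s; apply: (@continuous_comp _ _ _ (fun s => - (e * `|s|)) expR); last exact: continuous_expR.
by apply: cvgN; apply: cvgM; [exact: cvg_cst|apply: cvg_norm; exact: cvg_id].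
Qed.

(** From exp y >= (1 + y / 2)^2 with y = e |s|, and (1 + e |s| / 2)^2 >= (e^2 / 4) (1 + s^2) because
    e <= 1. *)
Lemma abel_decay e s : 0 < e <= 1 -> abel e s <= (4 / e ^+ 2) * invsq s.
Proof.
move=> /andP[e0 e1].
have y0 : 0 <= e * `|s| / 2 by rewrite !mulr_ge0// ltW.
have H : (1 + e * `|s| / 2) ^+ 2 <= expR (e * `|s|).
  rewrite [X in expR X](_ : _ = e * `|s| / 2 + e * `|s| / 2); last by field.
  by rewrite expRD -expr2 ler_pXn2r ?nnegrE ?addr_ge0 ?expR_ge0// expR_ge1Dx.
rewrite /abel expRN (_ : 4 / e ^+ 2 * invsq s = (e ^+ 2 / 4 * (1 + s ^+ 2))^-1); last first.
  by rewrite /invsq !invfM invrK [4 * _]mulrC.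
rewrite lef_pV2 ?posrE ?expR_gt0//; last first.
  by rewrite mulr_gt0 ?oneDsq_gt0// divr_gt0// exprn_gt0.
apply: le_trans H; rewrite -[s ^+ 2]real_normK ?num_real//.
have : e ^+ 2 <= 4 by rewrite (le_trans (exprn_ile1 _ (ltW e0) e1))// ler1n.
have := normr_ge0 s; set a := `|s| => a0 ee.
have : 0 <= e * a by rewrite mulr_ge0// ltW.
nra.
Qed.

Lemma cmeasurable_kernel e u :
  @cmeasurable _ RT R setT (fun s => (abel e s)%:C%C * expi (s * u)).
Proof.
apply: ccont_measurable; apply: ccontM; first exact/ccont_real/continuous_abel.
by apply: ccont_expi => s; apply: cvgM; [exact: cvg_id|exact: cvg_cst].
Qed.

Lemma cdecay_kernel e u : 0 < e <= 1 ->
  cdecay (fun s => (abel e s)%:C%C * expi (s * u)) (4 / e ^+ 2).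
Proof.
move=> e01 s; rewrite normcM normc_real normc_expi mulr1 ger0_norm ?abel_ge0//.
exact: abel_decay.
Qed.

Lemma cder_exp (a u : R) s : cder (fun s => (expR (a * s))%:C%C * expi (s * u)) s
  (Complex a u * ((expR (a * s))%:C%C * expi (s * u))).
Proof.
have d1 : is_derive s (1 : R) (fun s : R => a * s) a.
  by apply: is_derive_eq; rewrite /GRing.scale /= mulr1.
have d2 : is_derive s (1 : R) (fun s : R => s * u) u.
  by apply: is_derive_eq; rewrite /GRing.scale /= mulr1 mulr0 add0r.
have := cderM (cder_real (is_derive1_comp (is_derive_expR (a * s)) d1))
  (cder_comp d2 (cder_expi (s * u))).
move/cder_eq; apply.
rewrite (_ : Complex a u = a%:C%C + u%:C%C * 'i%C); first last.
  by apply: complexP; rewrite !ReImE /=; ring.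
rewrite rmorphM; ring.
Qed.

Lemma cint_exp (a u x y : R) : x < y -> a != 0 ->
  cint lam `[x, y] (fun s => (expR (a * s))%:C%C * expi (s * u)) =
  (Complex a u)^-1 * ((expR (a * y))%:C%C * expi (y * u)) -
  (Complex a u)^-1 * ((expR (a * x))%:C%C * expi (x * u)).
Proof.
move=> xy a0.
have c0 : Complex a u != 0 by rewrite eq_complex /= negb_and a0.
apply: (@cint_FTC R (fun s => (Complex a u)^-1 * ((expR (a * s))%:C%C * expi (s * u)))) => //.
  move=> s; apply: cder_eq; first exact: cderZ (cder_exp a u s).
  by rewrite mulKf.
exact: (ccont_cder (cder_exp a u)).
Qed.

Lemma cint_split (h : R -> R[i]) (x y z : R) : x < y -> y < z -> cintegrable lam setT h ->
  cint lam `[x, z] h = cint lam `[x, y] h + cint lam `[y, z] h.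
Proof.
move=> xy yz [h1 h2].
have part (f : R -> R) : lam.-integrable setT (EFin \o f) ->
   \int[lam]_(t in `[x, z]) f t = \int[lam]_(t in `[x, y]) f t + \int[lam]_(t in `[y, z]) f t.
  move=> fi.
  have fxz : lam.-integrable `[x, z] (EFin \o f) by exact: integrableS fi.
  apply/eqP; rewrite addrC -subr_eq (Rintegral_itvB fxz) ?bnd_simp ?ltW//.
  rewrite Rintegral_itv_obnd_cbnd//.
  exact: integrableS fi.
by apply: complexP; rewrite ?ReImE; exact: part.
Qed.

Lemma expRN_harmonic e n : 0 < e <= 1 -> expR (- (e * n%:R)) <= e^-1 * harmonic n.
Proof.
move=> /andP[e0 e1]; rewrite expRN -invfM lef_pV2 ?posrE ?expR_gt0 ?mulr_gt0//.
apply: le_trans (expR_ge1Dx _); rewrite -natr1 mulrDr mulr1 addrC lerD2r.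
exact: e1.
Qed.

(** On each half-line the integrand is the exponential of (a + i u) s with a = e or a = - e, which
    has an elementary antiderivative. The values at 0 give 1 / (e + i u) - 1 / (- e + i u), and the
    outer boundary terms decay like exp (- e n). *)
Lemma cint_abel e u : 0 < e <= 1 ->
  cint lam setT (fun s => (abel e s)%:C%C * expi (s * u)) = (poisson e u)%:C%C.
Proof.
move=> e01; have /andP[e0 e1] := e01.
have ih := cdecay_integrable (cmeasurable_kernel e u) (cdecay_kernel u e01).
apply: (ccvg_unique (cint_exhaust ih)).
have -> : (poisson e u)%:C%C = (Complex e u)^-1 - (Complex (- e) u)^-1.
  have p0 : e ^+ 2 + u ^+ 2 != 0.
    by rewrite gt_eqF// ltr_pwDl ?sqr_ge0// exprn_gt0.
  by apply: complexP; rewrite /= /poisson /= ?sqrrN; field.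
set c1 := (Complex e u)^-1; set c2 := (Complex (- e) u)^-1.
(* The term [normc (c1 - c2)] serves index 0 alone, where the interval is a point and the error is
   the whole limit. *)
apply: (@ccvg_squeeze _ _ _ (fun n => (normc c1 + normc c2 + normc (c1 - c2)) *
   (e^-1 * harmonic n))) => [[|n]|].
  rewrite oppr0 set_itv1 /cint !Rintegral_set1 (_ : Complex 0 0 = 0)//.
  rewrite sub0r normcN /harmonic /= invr1 mulr1.
  have ie : 1 <= e^-1 by rewrite invf_ge1.
  apply: le_trans (ler_peMr _ ie); last by rewrite !addr_ge0 ?normc_ge0.
  by rewrite lerDr addr_ge0 ?normc_ge0.
rewrite (@cint_split _ _ 0 _ _ _ ih) ?oppr_lt0//.
rewrite (_ : cint lam `[0, _] _ =
   cint lam `[0, n.+1%:R] (fun s => (expR (- e * s))%:C%C * expi (s * u))); last first.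
  apply: eq_cint => t /=; rewrite in_itv /= => /andP[t0 _].
  by rewrite /abel ger0_norm// mulNr.
rewrite (_ : cint lam `[_, 0] _ =
   cint lam `[- n.+1%:R, 0] (fun s => (expR (e * s))%:C%C * expi (s * u))); last first.
  apply: eq_cint => t /=; rewrite in_itv /= => /andP[_ t0].
  by rewrite /abel ler0_norm// mulrN opprK.
rewrite !cint_exp ?oppr_lt0 ?oppr_eq0 ?gt_eqF// !mulr0 !mul0r expR0 expi0 mulr1 -/c1 -/c2.
rewrite (_ : _ - _ = c2 * ((expR (- e * n.+1%:R))%:C%C * expi (n.+1%:R * u)) -
   c1 * ((expR (e * - n.+1%:R))%:C%C * expi (- n.+1%:R * u))); last by rewrite !mulr1; ring.
apply: le_trans (normcD _ _) _; rewrite normcN !normcM !normc_expi !normc_real !mulr1.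
rewrite !ger0_norm ?expR_ge0// mulrN mulNr -mulrDl [normc c2 + _]addrC.
apply: ler_pM; rewrite ?addr_ge0 ?normc_ge0 ?expR_ge0 ?lerDl ?normc_ge0//.
exact: expRN_harmonic.
rewrite -[X in _ --> X](mulr0 (normc c1 + normc c2 + normc (c1 - c2))).
apply: cvgM; first exact: cvg_cst.
rewrite -[X in _ --> X](mulr0 e^-1); apply: cvgM; first exact: cvg_cst.
exact: cvg_harmonic.
Qed.

Lemma poisson_ge0 e u : 0 < e -> 0 <= poisson e u.
Proof.
by move=> e0; rewrite divr_ge0 ?mulr_ge0 ?ltW// ltr_pwDl ?sqr_ge0// exprn_gt0.
Qed.

(** An inequality of Peetre type: it moves the translation by [x] into a constant, so that
    translated kernels share the majorant [invsq]. *)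
Lemma invsq_shift t x : invsq (t + x) <= 2 * (1 + x ^+ 2) * invsq t.
Proof.
rewrite /invsq ler_pdivlMr ?oneDsq_gt0// ler_pdivrMl ?oneDsq_gt0//.
have := sqr_ge0 (t + x + x); have := sqr_ge0 ((t + x) * x).
nra.
Qed.

Lemma poisson_decay e u : 0 < e <= 1 -> poisson e u <= 2 / e * invsq u.
Proof.
move=> /andP[e0 e1]; rewrite /poisson /invsq ler_pdivlMr ?oneDsq_gt0//.
rewrite mulrAC ler_pdivrMr ?ltr_pwDl ?sqr_ge0 ?exprn_gt0//.
rewrite [2 / e * _]mulrAC ler_pdivlMr// -!mulrA ler_wpM2l//.
have : e ^+ 2 <= 1 by rewrite exprn_ile1// ltW.
have := sqr_ge0 u; rewrite !expr2; nra.
Qed.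

Lemma continuous_poisson e x : 0 < e -> continuous (fun t => poisson e (t + x)).
Proof.
move=> e0 t; apply: cvgM; first exact: cvg_cst.
apply: cvgV; first by rewrite gt_eqF// ltr_pwDl ?sqr_ge0// exprn_gt0.
apply: cvgD; first exact: cvg_cst.
apply: (@continuous_comp _ _ _ (fun t => t + x) (fun u => u ^+ 2)); last exact: exprn_continuous.
by apply: cvgD; [exact: cvg_id|exact: cvg_cst].
Qed.

Lemma integrable_poisson e x : 0 < e <= 1 ->
  lam.-integrable setT (EFin \o (fun t => poisson e (t + x))).
Proof.
move=> e01; have /andP[e0 e1] := e01.
apply: (le_integrable measurableT _ _ (integrable_invsqZ (2 / e * (2 * (1 + x ^+ 2))))).
  by apply/measurable_EFinP; apply: continuous_measurable_line; exact: continuous_poisson.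
move=> t _ /=; rewrite lee_fin !ger0_norm ?poisson_ge0//; last first.
  by rewrite !mulr_ge0 ?invsq_ge0 ?invr_ge0 ?ltW// oneDsq_gt0.
apply: le_trans (poisson_decay _ e01) _; rewrite -[leRHS]mulrA.
by apply: ler_wpM2l; [rewrite divr_ge0 ?ltW|exact: invsq_shift].
Qed.

Lemma cder_atan e x t : 0 < e ->
  cder (fun t => (2 * atan (e^-1 * (t + x)))%:C%C) t (poisson e (t + x))%:C%C.
Proof.
move=> e0; apply: cder_real.
have d1 : is_derive t (1 : R) (fun t : R => e^-1 * (t + x)) e^-1.
  by apply: is_derive_eq; rewrite /GRing.scale /= addr0 mulr1.
have H := is_deriveZ 2 (@is_derive1_comp _ (@atan R) (fun t => e^-1 * (t + x)) t _ _
  (is_derive1_atan _) d1).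
apply: (is_derive_eq H); rewrite /GRing.scale /= /poisson.
have e1 : e != 0 by rewrite gt_eqF.
have p1 : 1 + (e^-1 * (t + x)) ^+ 2 != 0 by rewrite gt_eqF// oneDsq_gt0.
have p2 : e ^+ 2 + (t + x) ^+ 2 != 0.
  by rewrite gt_eqF// ltr_pwDl ?sqr_ge0// exprn_gt0.
rewrite (_ : 1 + _ = (e ^+ 2 + (t + x) ^+ 2) / e ^+ 2); last by field.
by field; rewrite e1 p2.
Qed.

Lemma cvg_atan_affine e x : 0 < e ->
  (2 * atan (e^-1 * (n%:R + x))) @[n --> \oo] --> (pi : R).
Proof.
move=> e0; rewrite [X in _ --> X](_ : _ = 2 * (pi / 2)); last by field.
apply: cvgM; first exact: cvg_cst.
have := (cvg_pinftyP (@atan R) (pi / 2)).1 (@cvgy_atan R); apply.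
apply/cvgryPge => A; near=> n.
rewrite ler_pdivlMl// -lerBlDr.
by near: n; exact: nbhs_infty_ger.
Unshelve. all: by end_near. Qed.

Lemma cint_poisson e x : 0 < e <= 1 ->
  cint lam setT (fun t => (poisson e (t + x))%:C%C) = (2 * pi)%:C%C.
Proof.
move=> e01; have /andP[e0 e1] := e01.
have ih : cintegrable lam setT (fun t => (poisson e (t + x))%:C%C).
  by split => /=; [exact: integrable_poisson|exact: integrable0].
apply: (ccvg_unique (cint_exhaust ih)).
(* Shifting the index excludes the degenerate interval at n = 0. The antiderivative is 2 atan ((t +
   x) / e), and each end contributes pi. *)
rewrite /ccvg -(cvg_shiftS (fun n => normc (cint lam `[- n%:R, n%:R] _ - _))).
have cp : ccont (fun t => (poisson e (t + x))%:C%C).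
  exact/ccont_real/continuous_poisson.
under eq_fun => n.
  rewrite (cint_FTC _ (fun t => cder_atan x t e0) cp) ?gtrN//.
  rewrite -!rmorphB normc_real.
  rewrite (_ : e^-1 * (- n.+1%:R + x) = - (e^-1 * (n.+1%:R - x))); last by ring.
  rewrite atanN mulrN opprK.
  over.
have H : (2 * atan (e^-1 * (n.+1%:R + x)) + 2 * atan (e^-1 * (n.+1%:R - x)) - 2 * pi)
    @[n --> \oo] --> (pi + pi - 2 * pi : R).
  apply: cvgB; last exact: cvg_cst.
  by apply: cvgD; [have := cvg_atan_affine x e0|have := cvg_atan_affine (- x) e0];
    rewrite -cvg_shiftS.
rewrite (_ : pi + pi - 2 * pi = 0) in H; last by ring.
by have := cvg_norm H; rewrite normr0; apply.
Qed.

End PoissonKernel.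

(** * The inversion formula by Abel summation *)

Section LineInversion.
Variable R : realType.
Notation lam := (@lebesgue_measure R).
Notation RT := (measurableTypeR R).

Definition ft1 (h : R -> R[i]) (s : R) : R[i] := cint lam setT (fun t => h t * expi (t * s)).

Variables (h : R -> R[i]) (M L N : R).
Hypothesis ch : ccont h.
Hypothesis hM : cdecay h M.
Hypothesis hL : forall s t, normc (h s - h t) <= L * `|s - t|.
Hypothesis cFh : ccont (ft1 h).
Hypothesis FhN : cdecay (ft1 h) N.

Let M0 : 0 <= M.
Proof. by have := le_trans (normc_ge0 _) (hM 0); rewrite pmulr_lge0// invsq_gt0. Qed.

Let cmul (x : R) : continuous (fun s : R => s * x).
Proof. by move=> s; apply: cvgM; [exact: cvg_id|exact: cvg_cst]. Qed.

Lemma abel_cvg1 (s : R) (e : R) : 0 <= e -> `|abel e s - 1| <= e * `|s|.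
Proof.
move=> e0; have y0 : 0 <= e * `|s| by rewrite mulr_ge0.
rewrite ler0_norm ?subr_le0 ?expR_le1 ?oppr_le0// opprB lerBlDl -lerBlDr.
exact: expR_ge1Dx.
Qed.

Lemma abel_le1 (s : R) (e : R) : 0 <= e -> abel e s <= 1.
Proof. by move=> e0; rewrite expR_le1 oppr_le0 mulr_ge0. Qed.

Lemma harmonic01 n : 0 < (harmonic n : R) <= 1.
Proof. by rewrite /harmonic /= invr_gt0 ltr0n/= invf_le1// ler1n. Qed.

Let Fx x s := ft1 h s * expi (s * x).

Let cFx x : ccont (Fx x).
Proof. exact: (ccontM cFh (ccont_expi (@cmul x))). Qed.

Let FxN x : cdecay (Fx x) N.
Proof. by move=> s; rewrite normcM normc_expi mulr1. Qed.

Let abel_summation x :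
  ccvg (fun n => cint lam setT (fun s => (abel (harmonic n) s)%:C%C * Fx x s))
       (cint lam setT (Fx x)).
Proof.
apply: (@cint_dominated _ RT _ lam setT measurableT _ _ (fun s => N * invsq s)).
- by move=> n; apply: ccont_measurable; apply: ccontM (cFx x); exact/ccont_real/continuous_abel.
- exact: ccont_measurable (cFx x).
- exact: integrable_invsqZ.
- move=> n s _; rewrite normcM normc_real ger0_norm ?abel_ge0//.
  have /andP[e0 _] := harmonic01 n.
  apply: le_trans (FxN x s); rewrite ler_piMl ?normc_ge0//; apply: abel_le1; exact: ltW.
- move=> s _; apply: (@ccvg_squeeze _ _ _ (fun n => harmonic n * (`|s| * normc (Fx x s)))).
    move=> n; rewrite -[X in _ - X]mul1r -mulrBl normcM -(rmorphB _ _ 1) normc_real.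
    rewrite mulrA ler_wpM2r ?normc_ge0//; apply: abel_cvg1.
    by have /andP[/ltW] := harmonic01 n.
  rewrite -[X in _ --> X](mul0r (`|s| * normc (Fx x s))).
  by apply: cvgM; [exact: cvg_harmonic|exact: cvg_cst].
Qed.

(** The Abel factor is what makes the integrand integrable in (s, t) jointly, since h(t) exp (i t s)
    has no decay in s. Integrating over s first leaves the Poisson kernel. *)
Let fubini_poisson x e : 0 < e <= 1 ->
  cint lam setT (fun s => (abel e s)%:C%C * Fx x s) =
  cint lam setT (fun t => h t * (poisson e (t + x))%:C%C).
Proof.
move=> e01; have /andP[e0 e1] := e01.
pose F (p : RT * RT) : R[i] :=
  ((abel e p.1)%:C%C * expi (p.1 * x)) * (h p.2 * expi (p.2 * p.1)).
have mfst : measurable_fun setT (fun p : RT * RT => p.1 : R) by exact: measurable_fst.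
have msnd : measurable_fun setT (fun p : RT * RT => p.2 : R) by exact: measurable_snd.
have mF : cmeasurable setT F.
  apply: cmeasurableM; apply: cmeasurableM.
  - apply: cmeasurable_real; apply: (measurableT_comp _ mfst).
    by apply: continuous_measurable_fun; exact: continuous_abel.
  - apply: cmeasurable_expi; apply: measurable_funM => //; exact: measurable_cst.
  - have [h1 h2] := ch; split.
      exact: (measurableT_comp (continuous_measurable_fun h1) msnd).
    exact: (measurableT_comp (continuous_measurable_fun h2) msnd).
  - by apply: cmeasurable_expi; exact: measurable_funM.
have nF s t : normc (F (s, t)) = abel e s * normc (h t).
  by rewrite /F /= !normcM !normc_expi !mulr1 normc_real ger0_norm ?abel_ge0.
have iF : cintegrable (lam \x lam)%E setT F.
  apply: (@cintegrable_le _ _ _ (lam \x lam)%E setT measurableT F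
    (fun p => (4 / e ^+ 2 * invsq p.1) * (M * invsq p.2)) mF).
    apply: (@integrable_tensor _ _ RT RT R lam lam (fun s => 4 / e ^+ 2 * invsq s)
      (fun t => M * invsq t)).
    - by move=> s; rewrite mulr_ge0 ?divr_ge0 ?invsq_ge0// exprn_ge0// ltW.
    - by move=> t; rewrite mulr_ge0 ?invsq_ge0.
    - exact: integrable_invsqZ.
    - exact: integrable_invsqZ.
  move=> [s t] _; rewrite nF; apply: ler_pM; rewrite ?abel_ge0 ?normc_ge0//.
  exact: abel_decay.
have i1 s : cintegrable lam setT (fun t => h t * expi (t * s)).
  apply: (@cdecay_integrable _ _ M).
    apply: ccont_measurable; exact: (ccontM ch (ccont_expi (@cmul s))).
  by move=> t; rewrite normcM normc_expi mulr1.
have i2 u : cintegrable lam setT (fun s => (abel e s)%:C%C * expi (s * u)).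
  exact: cdecay_integrable (cmeasurable_kernel e u) (cdecay_kernel u e01).
have E t s : F (s, t) = h t * ((abel e s)%:C%C * expi (s * (t + x))).
  by rewrite /F /= mulrDr expiD [t * s]mulrC; ring.
transitivity (cint (lam \x lam)%E setT F).
  rewrite (cint_fubini12 iF) => [|s]; last first.
    have := (cintegrableZ measurableT ((abel e s)%:C%C * expi (s * x)) (i1 s)); exact.
  apply: eq_cint => s _.
  apply: (etrans _ (esym (cintZ measurableT ((abel e s)%:C%C * expi (s * x)) (i1 s)))).
  by rewrite -mulrA; congr (_ * _); rewrite mulrC.
rewrite (cint_fubini21 iF) => [|t]; last first.
  by under eq_fun do rewrite E; exact: (cintegrableZ measurableT _ (i2 _)).
apply: eq_cint => t _; rewrite -(cint_abel _ e01).
apply: (etrans _ (cintZ measurableT (h t) (i2 (t + x)))).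
by apply: eq_cint => s _; rewrite E.
Qed.

(* Domination of the approximation error uniformly in e: the Lipschitz bound on
   c is used for a <= 1 and the bound by the supremum for a > 1. *)
Lemma poisson_bound (l K e a c : R) : 0 < e -> e <= 1 -> 0 <= l -> 0 <= K -> 0 <= a ->
  0 <= c -> c <= l * a -> c <= 2 * K ->
  c * (2 * e) * (1 + a ^+ 2) <= (2 * l + 8 * K) * (e ^+ 2 + a ^+ 2).
Proof.
move=> e0 e1 l0 K0 a0 c0 cla cK.
have e20 := sqr_ge0 e; have a20 := sqr_ge0 a.
have ce0 : 0 <= c * (2 * e) by rewrite mulr_ge0// mulr_ge0// ltW.
have [a1|a1] := leP a 1.
  have h1 : c * (2 * e) <= l * (e ^+ 2 + a ^+ 2).
    apply: (@le_trans _ _ (l * a * (2 * e))).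
      by rewrite ler_wpM2r// mulr_ge0// ltW.
    by rewrite -mulrA ler_wpM2l//; have := sqr_ge0 (e - a); nra.
  have h2 : 1 + a ^+ 2 <= 2 by rewrite expr2; nra.
  apply: (@le_trans _ _ (l * (e ^+ 2 + a ^+ 2) * 2)).
    by apply: ler_pM; rewrite ?addr_ge0.
  by rewrite [leRHS]mulrDl [l * _ * 2]mulrC mulrA lerDl !mulr_ge0// addr_ge0.
have h1 : c * (2 * e) <= 4 * K by nra.
have h2 : 1 + a ^+ 2 <= 2 * (e ^+ 2 + a ^+ 2) by nra.
apply: (@le_trans _ _ (4 * K * (2 * (e ^+ 2 + a ^+ 2)))).
  by apply: ler_pM; rewrite ?addr_ge0.
have : 0 <= l * (e ^+ 2 + a ^+ 2) by rewrite mulr_ge0// addr_ge0.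
nra.
Qed.

(** [poisson_bound] with a = |t + x|, l = |L| and K = M; the majorant no longer depends on [n]. *)
Let diff_bound x t n : normc ((h t - h (- x)) * (poisson (harmonic n) (t + x))%:C%C) <=
  (2 * `|L| + 8 * M) * invsq (t + x).
Proof.
have /andP[e0 e1] := harmonic01 n; set e : R := harmonic n in e0 e1 *.
rewrite normcM normc_real (ger0_norm (poisson_ge0 _ e0)).
have b1 : normc (h t - h (- x)) <= `|L| * `|t + x|.
  have := hL t (- x); rewrite opprK => /le_trans; apply.
  by rewrite ler_wpM2r// ler_norm.
have b2 : normc (h t - h (- x)) <= 2 * M.
  rewrite (le_trans (normcD _ _))// normcN mulrDl mul1r.
  have hle v : normc (h v) <= M.
    apply: le_trans (hM v) _; rewrite -[leRHS]mulr1.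
    by apply: ler_wpM2l; [exact: M0|exact: invsq_le1].
  exact: lerD.
move: (normc_ge0 (h t - h (- x))) b1 b2; set c := normc _; set u := t + x => c0 b1 b2.
rewrite /poisson /invsq mulrA ler_pdivrMr; last first.
  by rewrite ltr_pwDl ?sqr_ge0// exprn_gt0.
rewrite mulrAC ler_pdivlMr ?oneDsq_gt0//.
have -> : u ^+ 2 = `|u| ^+ 2 by rewrite real_normK ?num_real.
exact: poisson_bound.
Qed.

Let poisson_cvg0 u : u != 0 -> poisson (harmonic n) u @[n --> \oo] --> (0 : R).
Proof.
move=> u0; have u2 : 0 < u ^+ 2 by rewrite exprn_even_gt0.
apply: (@cvg0_squeeze _ _ (fun n => 2 / u ^+ 2 * harmonic n)) => [n|].
  have /andP[e0 e1] := harmonic01 n; rewrite poisson_ge0//= /poisson.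
  rewrite [leRHS]mulrAC ler_pM2l ?mulr_gt0// lef_pV2 ?posrE//.
    by rewrite lerDr sqr_ge0.
  by rewrite ltr_pwDr ?sqr_ge0.
rewrite -[X in _ --> X](mulr0 (2 / u ^+ 2)).
by apply: cvgM; [exact: cvg_cst|exact: cvg_harmonic].
Qed.

(** Subtracting the constant h(- x) isolates the term 2 pi h(- x), exact for every n by
    [cint_poisson]. The remainder tends to 0 by dominated convergence. *)
Let poisson_limit x :
  ccvg (fun n => cint lam setT (fun t => h t * (poisson (harmonic n) (t + x))%:C%C))
       ((2 * pi)%:C%C * h (- x)).
Proof.
have mp n : @cmeasurable _ RT R setT (fun t => (poisson (harmonic n) (t + x))%:C%C).
  have /andP[e0 e1] := harmonic01 n.
  exact/ccont_measurable/ccont_real/continuous_poisson.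
have ip n : cintegrable lam setT (fun t => (poisson (harmonic n) (t + x))%:C%C).
  split => /=; last exact: integrable0.
  by apply: integrable_poisson; exact: harmonic01.
have md : @cmeasurable _ RT R setT (fun t => h t - h (- x)).
  have [h1 h2] := ch; split.
    under eq_fun do rewrite ReD ReN.
    apply: measurable_funB; last exact: measurable_cst.
    exact: continuous_measurable_line.
  under eq_fun do rewrite ImD ImN.
  apply: measurable_funB; last exact: measurable_cst.
  exact: continuous_measurable_line.
pose K := (2 * `|L| + 8 * M) * (2 * (1 + x ^+ 2)).
have dK n t : normc ((h t - h (- x)) * (poisson (harmonic n) (t + x))%:C%C) <= K * invsq t.
  apply: le_trans (diff_bound x t n) _; rewrite -mulrA; apply: ler_wpM2l.
    by rewrite addr_ge0 ?mulr_ge0.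
  exact: invsq_shift.
have idiff n : cintegrable lam setT (fun t => (h t - h (- x)) * (poisson (harmonic n) (t + x))%:C%C).
  by apply: (@cdecay_integrable _ _ K) => //; exact: cmeasurableM.
have D : ccvg (fun n => cint lam setT
    (fun t => (h t - h (- x)) * (poisson (harmonic n) (t + x))%:C%C)) (cint lam setT (fun=> 0)).
  apply: (@cint_dominated _ RT _ lam setT measurableT _ _ (fun s => K * invsq s)).
  - by move=> n; exact: cmeasurableM.
  - by split; exact: measurable_cst.
  - exact: integrable_invsqZ.
  - by move=> n t _; exact: dK.
  (* At t = - x the kernel blows up but the difference of values of [h] is 0; elsewhere the kernel
     tends to 0. *)
  - move=> t _; have [tx|tx] := eqVneq (t + x) 0.
      rewrite (_ : - x = t); last by apply/eqP; rewrite eq_sym -addr_eq0 tx.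
      by under eq_fun do rewrite subrr mul0r; exact: ccvg_cst.
    apply: (@ccvg_squeeze _ _ _ (fun n => normc (h t - h (- x)) * poisson (harmonic n) (t + x))).
      move=> n; rewrite subr0 normcM normc_real ger0_norm// poisson_ge0//.
      by have /andP[] := harmonic01 n.
    rewrite -[X in _ --> X](mulr0 (normc (h t - h (- x)))).
    by apply: cvgM; [exact: cvg_cst|exact: poisson_cvg0].
have c0 : cint lam setT (fun=> 0 : R[i]) = 0.
  by apply: complexP; rewrite /= Rintegral_cst// mul0r.
have ihp n : cintegrable lam setT (fun t => h t * (poisson (harmonic n) (t + x))%:C%C).
  have -> : (fun t => h t * (poisson (harmonic n) (t + x))%:C%C) =
      (fun t => (h t - h (- x)) * (poisson (harmonic n) (t + x))%:C%C +
       h (- x) * (poisson (harmonic n) (t + x))%:C%C).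
    by apply/funext => t; rewrite -mulrDl subrK.
  by apply: cintegrableD => //; exact: cintegrableZ.
have E n : cint lam setT (fun t => (h t - h (- x)) * (poisson (harmonic n) (t + x))%:C%C) =
    cint lam setT (fun t => h t * (poisson (harmonic n) (t + x))%:C%C) -
    (2 * pi)%:C%C * h (- x).
  rewrite -(cint_poisson x (harmonic01 n)) mulrC -mulNr -cintZ// -cintD//; last exact: cintegrableZ.
  by apply: eq_cint => t _; ring.
rewrite c0 in D; move: D; rewrite /ccvg.
by under eq_fun do rewrite E subr0.
Qed.

Theorem line_fourier_inversion (x : R) :
  ft1 (ft1 h) x = (2 * pi)%:C%C * h (- x).
Proof.
apply: (@ccvg_unique _ (fun n => cint lam setT (fun s => (abel (harmonic n) s)%:C%C * Fx x s))).
  exact: abel_summation.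
under [X in ccvg X _]eq_fun do rewrite (fubini_poisson _ (harmonic01 _)).
exact: poisson_limit.
Qed.

End LineInversion.

(** * Differentiation under the integral sign *)

Section UnderIntegral.
Context d (T : measurableType d) (R : realType) (mu : {measure set T -> \bar R}).

Lemma cder_under_integral (k dk : R -> T -> R[i]) (g : T -> R) (a : R) :
  (forall u, cintegrable mu setT (k u)) ->
  (forall u t, cder (k ^~ t) u (dk u t)) ->
  mu.-integrable setT (EFin \o g) -> (forall u t, normc (dk u t) <= g t) ->
  cder (fun u => cint mu setT (k u)) a (cint mu setT (dk a)).
Proof.
move=> ik kd ig dg.
have g0 t : 0 <= g t by apply: le_trans (dg 0 t); exact: normc_ge0.
have part (f df : R -> T -> R) : (forall u, mu.-integrable setT (EFin \o f u)) ->
   (forall (u : R) t, is_derive u 1 (f ^~ t) (df u t)) -> (forall u t, `|df u t| <= g t) ->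
   is_derive a 1 (fun u => \int[mu]_t f u t) (\int[mu]_t df a t).
  move=> fi fd fg.
  have Ia : `]a - 1, a + 1[%classic a.
    by rewrite /= in_itv /= ltrDl ltrBlDr ltrDl ltr01.
  have E u t : partial1of2 f u t = df u t.
    by rewrite partial1of2E; have [] := fd u t.
  have der u t : `]a - 1, a + 1[%classic u -> setT t -> derivable (f ^~ t) u 1.
    by move=> _ _; have [] := fd u t.
  have bnd u t : `]a - 1, a + 1[%classic u -> setT t -> `|partial1of2 f u t| <= g t.
    by move=> _ _; rewrite E.
  apply: DeriveDef.
    exact: (derivable_under_integral measurableT Ia (fun u _ => fi u) der g0 ig bnd).
  rewrite -derive1E.
  rewrite (differentiation_under_integral measurableT Ia (fun u _ => fi u) der g0 ig bnd).
  by apply: eq_Rintegral => t _; rewrite E.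
split.
  apply: (part (fun u t => complex.Re (k u t)) (fun u t => complex.Re (dk u t))).
  - by move=> u; exact: (ik u).1.
  - by move=> u t; have [] := kd u t.
  - by move=> u t; apply: le_trans (dg u t); exact: Re_le_normc.
apply: (part (fun u t => complex.Im (k u t)) (fun u t => complex.Im (dk u t))).
- by move=> u; exact: (ik u).2.
- by move=> u t; have [] := kd u t.
- by move=> u t; apply: le_trans (dg u t); exact: Im_le_normc.
Qed.

End UnderIntegral.

(** * Fourier transform in one coordinate *)

Section PartialFourier.
Variables (R : realType) (m : nat).
Notation lam := (@lebesgue_measure R).
Notation RT := (measurableTypeR R).
Notation schw := (@is_schwartz R m).
Implicit Types (f g : 'rV[R]_m -> R[i]) (x y : 'rV[R]_m) (i j : 'I_m) (M : R).

Definition slice f y i : R -> R[i] := fun t => f (upd y i t).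

(** The frequency is written in the place of the integrated coordinate, so that transforms in
    different coordinates can be composed on the same R^m. *)
Definition pft i f : 'rV[R]_m -> R[i] := fun y => ft1 (slice f y i) (y ord0 i).

Lemma slice_cder f y i t : smooth f -> cder (slice f y i) t (slice (partial i f) y i t).
Proof.
by move=> sf; apply/cpart_upd; exact: (smooth_cpart [::] i _ sf).
Qed.

Lemma slice_ccont f y i : smooth f -> ccont (slice f y i).
Proof. by move=> sf; exact: (ccont_cder (fun t => slice_cder y i t sf)). Qed.

Lemma exprn_le (a b : R) k : 0 <= a -> a <= b -> a ^+ k <= b ^+ k.
Proof. by move=> a0 ab; rewrite lerXn2r ?nnegrE// (le_trans a0). Qed.

Lemma abs_le_norm_upd y i t : `|t| <= `|upd y i t|.
Proof. by have := coord_le_norm (upd y i t) i; rewrite updE eqxx. Qed.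

Lemma norm_upd0_le y i t : `|upd y i 0| <= `|upd y i t|.
Proof.
by rewrite -(upd_upd y i t 0) (le_trans (norm_upd _ _ _))// normr0 max_l.
Qed.

(** The k + 2 powers of the weight are divided: k of them control the other coordinates, and two
    give integrability along the slice. *)
Lemma wbounded_slice k f M y i t : wbounded (k + 2) f M ->
  normc (slice f y i t) <= M / (1 + `|upd y i 0|) ^+ k * invsq t.
Proof.
move=> fM; apply: weight_le_invsq; last exact: normc_ge0.
have W0 : 0 < (1 + `|upd y i 0|) ^+ k by rewrite exprn_gt0// ltr_pwDl.
rewrite ler_pdivlMr// mulrAC; apply: le_trans (fM (upd y i t)).
apply: ler_wpM2r; first exact: normc_ge0.
rewrite exprD mulrC; apply: ler_pM; rewrite ?exprn_ge0 ?addr_ge0//.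
- by apply: exprn_le; rewrite ?addr_ge0// lerD2l norm_upd0_le.
- by apply: exprn_le; rewrite ?addr_ge0// lerD2l abs_le_norm_upd.
Qed.

Lemma slice_decay f M y i : wbounded 2 f M -> cdecay (slice f y i) M.
Proof.
move=> fM t; have := @wbounded_slice 0 f M y i t fM.
by rewrite expr0 divr1.
Qed.

Lemma continuous_mulr_line (s : R) : continuous (fun t : R => t * s).
Proof. by move=> t; apply: cvgM; [exact: cvg_id|exact: cvg_cst]. Qed.

Lemma ft_ccont (h : R -> R[i]) s : ccont h -> ccont (fun t => h t * expi (t * s)).
Proof. by move=> ch; apply: ccontM ch _; apply: ccont_expi; exact: continuous_mulr_line. Qed.

Lemma ft_decay (h : R -> R[i]) s M : cdecay h M -> cdecay (fun t => h t * expi (t * s)) M.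
Proof. by move=> hM t; rewrite normcM normc_expi mulr1; exact: hM. Qed.

Lemma ft_integrable (h : R -> R[i]) s M : ccont h -> cdecay h M ->
  cintegrable lam setT (fun t => h t * expi (t * s)).
Proof.
move=> ch hM; apply: cdecay_integrable (ft_decay s hM).
by apply: ccont_measurable; exact: ft_ccont.
Qed.

Lemma wbounded_seminorm k f M : seminorm_le k f M -> wbounded k f M.
Proof. by move=> fM; exact: (fM [::]). Qed.

Lemma schwartz_wbounded k f : schw f -> exists M, wbounded k f M.
Proof.
by move=> Sf; have [M fM] := is_schwartz_bounded k Sf; exists M; exact: wbounded_seminorm.
Qed.

Lemma schwartz_partial i f : schw f -> schw (partial i f).
Proof. exact: (@is_schwartz_dpartial R m [:: i]). Qed.

Lemma pft_partial_neq i j f y : schw f -> j != i ->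
  cpart j (pft i f) y (pft i (partial j f) y).
Proof.
move=> Sf ji; have [M fM] := schwartz_wbounded 2 Sf.
have [N gN] := schwartz_wbounded 2 (schwartz_partial j Sf).
have -> : pft i (partial j f) y =
    cint lam setT (fun t => partial j f (upd (upd y j (y ord0 j)) i t) * expi (t * y ord0 i)).
  by rewrite upd_id.
rewrite /cpart; apply: (@cder_eq R _ _ _ _ _ (erefl _)).
have -> : (fun u => pft i f (upd y j u)) =
   (fun u => cint lam setT (fun t => f (upd (upd y j u) i t) * expi (t * y ord0 i))).
  apply/funext => u; rewrite /pft /ft1 updE [i == j]eq_sym (negbTE ji).
  by apply: eq_cint.
apply: (@cder_under_integral _ RT R lam
  (fun u t => f (upd (upd y j u) i t) * expi (t * y ord0 i))
  (fun u t => partial j f (upd (upd y j u) i t) * expi (t * y ord0 i))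
  (fun t => N * invsq t)).
- move=> u; apply: (@ft_integrable (slice f (upd y j u) i) _ M).
    exact: slice_ccont Sf.1.
  exact: slice_decay.
- move=> u t; rewrite -[X in cder _ _ X]addr0 -[X in _ + X](mulr0 (f (upd (upd y j u) i t))).
  apply: (cderM _ (cder_cst _ _)).
  under eq_fun do rewrite updC//; rewrite updC//.
  exact: slice_cder Sf.1.
- exact: integrable_invsqZ.
- by move=> u t; exact: (ft_decay _ (slice_decay _ _ gN)).
Qed.

Lemma cder_expi_mul t u : cder (fun u : R => expi (t * u)) u ('i%C * t%:C%C * expi (t * u)).
Proof.
have d1 : is_derive u (1 : R) (fun u : R => t * u) t.
  by apply: is_derive_eq; rewrite /GRing.scale /= mulr1.
by apply: cder_eq (cder_comp d1 (cder_expi _)) _; rewrite mulrCA mulrA.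
Qed.

Lemma pft_partial_eq i f y : schw f ->
  cpart i (pft i f) y ('i%C * pft i (coordmul i f) y).
Proof.
move=> Sf; have [M fM] := schwartz_wbounded 2 Sf.
have Sg := is_schwartz_coordmul i Sf; have [N gN] := schwartz_wbounded 2 Sg.
rewrite /cpart.
have -> : (fun u => pft i f (upd y i u)) =
   (fun u => cint lam setT (fun t => f (upd y i t) * expi (t * u))).
  apply/funext => u; rewrite /pft /ft1 updE eqxx.
  by apply: eq_cint => t _; rewrite /slice upd_upd.
rewrite /pft /ft1 -cintZ//; last first.
  apply: (@ft_integrable (slice (coordmul i f) y i) _ N); first exact: slice_ccont Sg.1.
  exact: slice_decay.
apply: (@cder_under_integral _ RT R lam
  (fun u t => f (upd y i t) * expi (t * u))
  (fun u t => 'i%C * (slice (coordmul i f) y i t * expi (t * u)))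
  (fun t => N * invsq t)).
- move=> u; apply: (@ft_integrable (slice f y i) _ M).
    exact: slice_ccont Sf.1.
  exact: slice_decay.
- move=> u t; apply: cder_eq (cderZ _ (cder_expi_mul t u)) _.
  by rewrite /slice /coordmul updE eqxx; ring.
- exact: integrable_invsqZ.
- move=> u t; rewrite normcM normc_i mul1r.
  exact: (ft_decay _ (slice_decay _ _ gN)).
Qed.

(** Integration by parts: the derivative of f exp (i t b) along the slice, with b = y_i, has
    integral 0. *)
Lemma pft_of_partial i f y : schw f ->
  pft i (partial i f) y = - 'i%C * (y ord0 i)%:C%C * pft i f y.
Proof.
move=> Sf; have [M fM] := schwartz_wbounded 2 Sf.
have Sg := schwartz_partial i Sf; have [N gN] := schwartz_wbounded 2 Sg.
set b := y ord0 i.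
have cH t : cder (fun t => slice f y i t * expi (t * b)) t
    (slice (partial i f) y i t * expi (t * b) + 'i%C * b%:C%C * (slice f y i t * expi (t * b))).
  apply: cder_eq; first apply: cderM (slice_cder y i t Sf.1) _.
    under eq_fun do rewrite mulrC; exact: cder_expi_mul.
  by rewrite [b * t]mulrC; ring.
have i1 := ft_integrable b (slice_ccont y i Sg.1) (slice_decay y i gN).
have i2 := ft_integrable b (slice_ccont y i Sf.1) (slice_decay y i fM).
have : pft i (partial i f) y + 'i%C * b%:C%C * pft i f y = 0.
  rewrite /pft /ft1 -/b -(cintZ _ _ i2)// -cintD//; last exact: cintegrableZ.
  apply: (@cint_derivative R (fun t => slice f y i t * expi (t * b)) _ M
     (N + normc ('i%C * b%:C%C) * M)) => //.
  - have c1 := ft_ccont b (slice_ccont y i Sg.1).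
    have c2 := ft_ccont b (slice_ccont y i Sf.1).
    have c3 : ccont (fun t => 'i%C * b%:C%C * (slice f y i t * expi (t * b))).
      by apply: ccontM => //; split=> t; exact: cvg_cst.
    split.
      under eq_fun do rewrite ReD; move=> t; exact: (cvgD (c1.1 t) (c3.1 t)).
    under eq_fun do rewrite ImD; move=> t; exact: (cvgD (c1.2 t) (c3.2 t)).
  - exact: ft_decay (slice_decay _ _ fM).
  - move=> t; apply: le_trans (normcD _ _) _; rewrite mulrDl; apply: lerD.
      exact: (ft_decay _ (slice_decay _ _ gN)).
    rewrite normcM -mulrA ler_wpM2l ?normc_ge0//.
    exact: (ft_decay _ (slice_decay _ _ fM)).
by move/eqP; rewrite addr_eq0 => /eqP ->; rewrite !mulNr.
Qed.

Lemma pft_of_partials i k f y : schw f ->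
  normc (pft i (dpartial (nseq k i) f) y) = `|y ord0 i| ^+ k * normc (pft i f y).
Proof.
move=> Sf; elim: k => [|k IHk]; first by rewrite expr0 mul1r.
rewrite [nseq _ _]/= [dpartial _ _]/= pft_of_partial; last exact: is_schwartz_dpartial.
by rewrite !normcM normcN normc_i mul1r normc_real IHk exprS mulrA.
Qed.

Let I0 : R := \int[lam]_t invsq t.

Lemma pft_wbound k i f M y : smooth f -> wbounded (k + 2) f M ->
  (1 + `|upd y i 0|) ^+ k * normc (pft i f y) <= 2 * I0 * M.
Proof.
move=> sf fM.
have W0 : 0 < (1 + `|upd y i 0|) ^+ k by rewrite exprn_gt0// ltr_pwDl.
have := @cint_decay R (fun t => slice f y i t * expi (t * y ord0 i)) (M / (1 + `|upd y i 0|) ^+ k).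
rewrite -/(ft1 _ _) -/(pft i f y) -/I0 => H.
rewrite mulrC -ler_pdivlMr//; apply: le_trans (H _ _) _.
- by apply: ccont_measurable; apply: ft_ccont; exact: slice_ccont.
- by apply: ft_decay => t; exact: wbounded_slice.
- by rewrite [M / _ * _]mulrAC !mulrA [2 * M * I0]mulrAC.
Qed.

Lemma pow_1D_le (a : R) k : 0 <= a -> (1 + a) ^+ k <= 2 ^+ k * (1 + a ^+ k).
Proof.
move=> a0; have [a1|a1] := leP a 1.
  apply: (@le_trans _ _ (2 ^+ k)).
    by apply: exprn_le; rewrite ?addr_ge0// -[2]/(1 + 1) lerD2l.
  by rewrite ler_peMr ?exprn_ge0// lerDl exprn_ge0.
apply: (@le_trans _ _ (2 ^+ k * a ^+ k)).
  rewrite -exprMn; apply: exprn_le; rewrite ?addr_ge0// mulrDl mul1r lerD2r.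
  exact: ltW.
by rewrite ler_wpM2l ?exprn_ge0// lerDr.
Qed.

Lemma weight_upd k y i :
  (1 + `|y|) ^+ k <= (1 + `|upd y i 0|) ^+ k * (1 + `|y ord0 i|) ^+ k.
Proof.
rewrite -exprMn; apply: exprn_le; first by rewrite addr_ge0.
rewrite mulrDl mul1r mulrDr mulr1.
have := norm_upd (upd y i 0) i (y ord0 i); rewrite upd_upd upd_id => /le_trans H.
rewrite -addrA lerD2l; apply: H.
have ab : 0 <= `|upd y i 0| * `|y ord0 i| by rewrite mulr_ge0.
by rewrite ge_max; apply/andP; split; [rewrite addrCA lerDl addr_ge0|rewrite lerDl addr_ge0].
Qed.

(** The weight is split into its part in y_i and its part in the other coordinates. The latter
    passes under the integral; powers of |y_i| are exchanged for derivatives in the i-th coordinate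
    by [pft_of_partials]. *)
Lemma pft_order0 i : order0 schw (pft i).
Proof.
(* The index leaves room for k derivatives and for the weight k + 2 of [pft_wbound]. The factor 2^k
   is from [pow_1D_le], and 4 I0 is the sum of two bounds 2 I0, for f and for its k-th
   derivative. *)
move=> k; exists (k + (k + 2))%N, (2 ^+ k * (4 * I0)).
have I00 : 0 <= I0 by apply: Rintegral_ge0 => t _; exact: invsq_ge0.
split; first by rewrite mulr_ge0 ?exprn_ge0// mulr_ge0.
move=> f M Sf fM y.
have b1 : wbounded (k + 2) f M.
  by apply: (@wboundedW _ _ _ _ _ _ _ (leq_addl _ _) (lexx M)); apply: wbounded_seminorm fM.
have b2 : wbounded (k + 2) (dpartial (nseq k i) f) M.
  apply: (@wboundedW _ _ _ _ _ _ _ (leq_addl k _) (lexx M)).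
  by apply: fM; rewrite size_nseq leq_addr.
have e1 := @pft_wbound k i f M y Sf.1 b1.
have e2 := @pft_wbound k i _ M y (smooth_dpartial _ Sf.1) b2.
rewrite pft_of_partials// in e2.
have W0 : 0 <= (1 + `|upd y i 0|) ^+ k by rewrite exprn_ge0// addr_ge0.
apply: (@le_trans _ _ ((1 + `|upd y i 0|) ^+ k * (2 ^+ k * (1 + `|y ord0 i| ^+ k)) * normc (pft i f y))).
  rewrite ler_wpM2r ?normc_ge0// (le_trans (weight_upd _ _ i))// ler_wpM2l//.
  exact: pow_1D_le.
have := lerD e1 e2; set W := _ ^+ k in W0 *; set p := normc _; set a := _ ^+ k => H.
rewrite (_ : _ * p = 2 ^+ k * (W * p + W * (a * p))); last by ring.
rewrite -mulrA ler_wpM2l ?exprn_ge0//; apply: le_trans H _.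
by rewrite -mulrDl -mulrDl -natrD.
Qed.

Section Stable.
Variable P : set ('rV[R]_m -> R[i]).
Hypothesis PS : P `<=` schw.
Hypothesis P_partial : forall j f, P f -> P (partial j f).
Hypothesis P_coordmul : forall j f, P f -> P (coordmul j f).

(** Letting [D] range over all tame operators preserving [P] absorbs what differentiation produces:
    a derivative in direction j moves onto [D f] if j differs from i, and becomes multiplication by
    the i-th coordinate if j = i. *)
Definition pft_ops i : set (('rV[R]_m -> R[i]) -> 'rV[R]_m -> R[i]) :=
  [set T | exists D, [/\ tame P D, forall f, P f -> P (D f) & T = pft i \o D]].

Lemma pft_ops_order0 i T : pft_ops i T -> order0 P T.
Proof.
move=> [D [tD PD ->]]; apply: (@order0_comp R m P schw (pft i) D _ tD (pft_order0 i)).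
by move=> f /PD/PS.
Qed.

Lemma pft_ops_partial i T j : pft_ops i T -> exists U, op_span (pft_ops i) U /\
  forall f x, P f -> cpart j (T f) x (U f x).
Proof.
move=> [D [tD PD ->]]; have [->|ji] := eqVneq j i.
  exists (fun f x => 'i%C * (pft i \o (coordmul i \o D)) f x); split.
    apply/span_scale/span_gen; exists (coordmul i \o D); split=> //.
    -  apply: (@tame_comp R m P schw (coordmul i) D _ tD (tame_coordmul R i)).
      by move=> f /PD/PS.
    - by move=> f Pf; exact/P_coordmul/PD.
  by move=> f x /PD/PS Sf; exact: pft_partial_eq.
exists (pft i \o (partial j \o D)); split.
  apply/span_gen; exists (partial j \o D); split=> //.
  - apply: (@tame_comp R m P schw (partial j) D _ tD (tame_dpartial R [:: j])).
    by move=> f /PD/PS.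
  - by move=> f Pf; exact/P_partial/PD.
by move=> f x /PD/PS Sf; exact: pft_partial_neq.
Qed.

Lemma pft_in_ops i : pft_ops i (pft i).
Proof. by exists id; split=> //; exact: tame_id. Qed.

Lemma tame_pft_on i : tame P (pft i).
Proof.
apply: (span_tame PS (@pft_ops_order0 i) (@pft_ops_partial i)).
exact/span_gen/pft_in_ops.
Qed.

End Stable.

Lemma tame_pft i : tame schw (pft i).
Proof.
apply: tame_pft_on => // j f; [exact: schwartz_partial|exact: is_schwartz_coordmul].
Qed.

Lemma is_schwartz_pft i f : schw f -> schw (pft i f).
Proof. exact: (tame_pft i).1. Qed.

(** Transforming a slice gives the slice of the transform, so the formula on the line applies. Its
    Lipschitz hypothesis holds with constant 2 L, [L] bounding the partial derivative. *)
Theorem pft_inversion i f y : schw f ->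
  pft i (pft i f) y = (2 * pi)%:C%C * f (upd y i (- y ord0 i)).
Proof.
move=> Sf; have [M fM] := schwartz_wbounded 2 Sf.
have [L gL] := schwartz_wbounded 0 (schwartz_partial i Sf).
have SF := is_schwartz_pft i Sf.
have [N FN] := schwartz_wbounded 2 SF.
have E : ft1 (slice f y i) = slice (pft i f) y i.
  apply/funext => s; rewrite /slice /pft updE eqxx.
  by apply: eq_cint => t _; rewrite /slice upd_upd.
have := @line_fourier_inversion R (slice f y i) M (2 * L) N
  (slice_ccont y i Sf.1) (slice_decay y i fM).
rewrite E => H; apply: H.
- move=> s t.
  apply: (@mean_value_bound R (slice f y i) (slice (partial i f) y i)) => u _.
    exact: slice_cder Sf.1.
  by exact: wbounded0 gL.
- exact: slice_ccont SF.1.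
- exact: slice_decay.
Qed.

End PartialFourier.

(** * Inverse transforms, commuting derivatives, flat functions *)

Section PartialFourierInverse.
Variables (R : realType) (m : nat).
Notation schw := (@is_schwartz R m).
Implicit Types (f g : 'rV[R]_m -> R[i]) (x y : 'rV[R]_m) (i j : 'I_m).

Lemma pft_linear i (a : R[i]) f g : schw f -> schw g ->
  pft i (a *: f + g) = a *: pft i f + pft i g.
Proof.
move=> Sf Sg; apply/funext => y.
have [M fM] := schwartz_wbounded 2 Sf; have [N gN] := schwartz_wbounded 2 Sg.
have i1 := ft_integrable (y ord0 i) (slice_ccont y i Sf.1) (slice_decay y i fM).
have i2 := ft_integrable (y ord0 i) (slice_ccont y i Sg.1) (slice_decay y i gN).
rewrite (_ : (a *: pft i f + pft i g) y = a * pft i f y + pft i g y)//.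
rewrite /pft /ft1 -(cintZ measurableT a i1).
have i3 := cintegrableZ measurableT a i1.
apply: etrans (cintD measurableT i3 i2).
by apply: eq_cint => t _; rewrite mulrA -mulrDl.
Qed.

Lemma pftZ i (a : R[i]) f : schw f -> pft i (a *: f) = a *: pft i f.
Proof.
move=> Sf; have S0 : schw 0 by rewrite -(scale0r f); exact: is_schwartzZ.
have z : pft i (0 : 'rV[R]_m -> R[i]) = (0 : 'rV[R]_m -> R[i]).
  apply/funext => y; rewrite /pft /ft1.
  apply: (etrans (y := cint (@lebesgue_measure R) setT (fun=> 0 : R[i]))).
    by apply: eq_cint => t _; rewrite /slice mul0r.
  exact: cint0.
by have := pft_linear i a Sf S0; rewrite z !addr0.
Qed.

(** As a multiple of an iterate of [pft], it inherits linearity, tameness and stability of flat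
    functions. *)
Definition ipft i f := ((2 * pi)%:C%C ^- 2) *: pft i (pft i (pft i f)).

Let c : R[i] := ((2 * pi)%:C%C).

Let c2 : c ^+ 2 != 0.
Proof.
rewrite expf_eq0 /=; apply/negP => /eqP/(congr1 (@complex.Re R)) /=.
by apply/eqP; rewrite mulf_neq0// gt_eqF// pi_gt0.
Qed.

(** Two transforms reflect the i-th coordinate up to the factor 2 pi, and reflecting twice is the
    identity. *)
Lemma pft4 i f : schw f -> pft i (pft i (pft i (pft i f))) = c ^+ 2 *: f.
Proof.
move=> Sf; apply/funext => y.
rewrite pft_inversion; last by do 2 apply: is_schwartz_pft.
rewrite pft_inversion// updE eqxx opprK upd_upd upd_id mulrA.
by rewrite -expr2.
Qed.

Lemma pftK i f : schw f -> ipft i (pft i f) = f.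
Proof.
by move=> Sf; rewrite /ipft pft4// scalerA mulVf// scale1r.
Qed.

Lemma ipftK i f : schw f -> pft i (ipft i f) = f.
Proof.
move=> Sf; rewrite /ipft pftZ; last by do 3 apply: is_schwartz_pft.
by rewrite pft4// scalerA mulVf// scale1r.
Qed.

Lemma tame_ipft i : tame schw (ipft i).
Proof.
have t2 : tame schw (fun f => pft i (pft i f)).
  by apply: (@tame_comp R m schw schw (pft i) (pft i)); [exact: is_schwartz_pft|exact: tame_pft..].
have t3 : tame schw (fun f => pft i (pft i (pft i f))).
  apply: (@tame_comp R m schw schw (pft i) (fun f => pft i (pft i f))) => //.
    exact: t2.1.
  exact: tame_pft.
apply: (@tame_comp R m schw schw (fun f => (c ^- 2) *: f) (fun f => pft i (pft i (pft i f)))) => //.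
  exact: t3.1.
exact: tame_scale.
Qed.

Lemma pft_inj i f g : schw f -> schw g -> pft i f = pft i g -> f = g.
Proof. by move=> Sf Sg fg; rewrite -(pftK i Sf) fg pftK. Qed.

(* Symmetry of second derivatives is read off on the Fourier side, where
   [partial i] becomes a multiplication. *)
Lemma partialC i j f : schw f -> partial i (partial j f) = partial j (partial i f).
Proof.
move=> Sf; have [->//|ij] := eqVneq i j.
have Si := schwartz_partial i Sf; have Sj := schwartz_partial j Sf.
apply: (@pft_inj i); [exact: schwartz_partial..|].
have E g : schw g -> pft i (partial j g) = partial j (pft i g).
  move=> Sg; apply/funext => y; apply: esym; apply: cpart_partial.
  by apply: pft_partial_neq => //; rewrite eq_sym.
apply/funext => y.
transitivity (- 'i%C * (y ord0 i)%:C%C * partial j (pft i f) y).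
  transitivity (- 'i%C * (y ord0 i)%:C%C * pft i (partial j f) y); first exact: pft_of_partial.
  by rewrite (E _ Sf).
transitivity (partial j (pft i (partial i f)) y); last by rewrite (E _ Si).
have -> : pft i (partial i f) = (fun y => - 'i%C * (y ord0 i)%:C%C * pft i f y).
  by apply/funext => z; exact: pft_of_partial.
apply: esym; apply: cpart_partial.
have := smooth_cpart [::] j y (is_schwartz_pft i Sf).1.
rewrite /cpart; move/(cderZ (- 'i%C * (y ord0 i)%:C%C)).
by under [X in _ -> cder X _ _]eq_fun do rewrite updE (negbTE ij).
Qed.

Variable l : 'I_m.

Definition psi : set ('rV[R]_m -> R[i]) := [set f | schw f /\
  forall k x, x ord0 l = 0 -> dpartial (nseq k l) f x = 0].

Lemma psi_schwartz : psi `<=` schw.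
Proof. by move=> f []. Qed.

Lemma psi_vanish f x : psi f -> x ord0 l = 0 -> f x = 0.
Proof. by move=> [_ /(_ 0%N x)]. Qed.

Lemma dpartial_nseq_partial k j f : schw f ->
  dpartial (nseq k l) (partial j f) = partial j (dpartial (nseq k l) f).
Proof.
move=> Sf; elim: k => [//|k IHk] /=; rewrite -/(dpartial _ _) IHk partialC//.
exact: is_schwartz_dpartial.
Qed.

(** For j = l this raises the number of derivatives by one. For j different from l, commuting
    derivatives leaves a derivative along the hyperplane of a function vanishing on it. *)
Lemma psi_partial j f : psi f -> psi (partial j f).
Proof.
move=> [Sf f0]; split=> [|k x xl]; first exact: schwartz_partial.
rewrite dpartial_nseq_partial//.
have [->|jl] := eqVneq j l; first exact: (f0 k.+1).
apply: cpart_partial; rewrite /cpart.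
under eq_fun do rewrite f0 ?updE 1?eq_sym ?(negbTE jl)//.
exact: cder_cst.
Qed.

(** Induction on the number of derivatives over all flat [f]: the innermost one replaces x_j f by a
    multiple of f plus x_j times the l-derivative of f, which is flat again. *)
Lemma psi_coordmul j f : psi f -> psi (coordmul j f).
Proof.
move=> Pf; split=> [|k]; first by apply: is_schwartz_coordmul; exact: psi_schwartz.
elim: k f Pf => [|k IHk] f Pf x xl.
  by rewrite /= /coordmul (psi_vanish Pf xl) mulr0.
have [Sf f0] := Pf.
rewrite -addn1 nseqD cats1 dpartial_rcons.
have -> : partial l (coordmul j f) = (j == l)%:R%:C%C *: f + coordmul j (partial l f).
  apply/funext => y; apply: cpart_partial; apply: coordmul_cpart.
  exact: (smooth_cpart [::] l y Sf.1).
have Sl := schwartz_partial l Sf.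
rewrite dpartialD; [|exact: smoothZ Sf.1|exact: (is_schwartz_coordmul j Sl).1].
rewrite dpartialZ; last exact: Sf.1.
rewrite [LHS](_ : _ = (j == l)%:R%:C%C * dpartial (nseq k l) f x +
  dpartial (nseq k l) (coordmul j (partial l f)) x)//.
by rewrite f0// mulr0 add0r IHk//; exact: psi_partial.
Qed.

Lemma psi_scale (a : R[i]) f : psi f -> psi (a *: f).
Proof.
move=> [Sf f0]; split=> [|k x xl]; first exact: is_schwartzZ.
rewrite dpartialZ; last exact: Sf.1.
by rewrite [LHS](_ : _ = a * dpartial (nseq k l) f x)// f0// mulr0.
Qed.

(** For i different from l the derivatives in x_l pass under the integral, and the integration stays
    inside the hyperplane, where they vanish. *)
Lemma psi_pft i f : i != l -> psi f -> psi (pft i f).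
Proof.
move=> il [Sf f0]; split=> [|k x xl]; first exact: is_schwartz_pft.
have -> : dpartial (nseq k l) (pft i f) = pft i (dpartial (nseq k l) f).
  elim: k => [//|k IHk] /=; rewrite -/(dpartial _ _) IHk; apply/funext => y.
  apply: cpart_partial; apply: pft_partial_neq; last by rewrite eq_sym.
  exact: is_schwartz_dpartial.
rewrite /pft /ft1; apply: (etrans (y := cint (@lebesgue_measure R) setT (fun=> 0 : R[i]))).
  by apply: eq_cint => t _; rewrite /slice f0 ?mul0r// updE eq_sym (negbTE il).
exact: cint0.
Qed.

Lemma psi_ipft i f : i != l -> psi f -> psi (ipft i f).
Proof. by move=> il Pf; apply: psi_scale; do 3 apply: psi_pft => //. Qed.

End PartialFourierInverse.

(** * Dilations by a power of one coordinate *)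

Section Dilation.
Variables (R : realType) (m : nat) (l : 'I_m).
Notation schw := (@is_schwartz R m).
Implicit Types (f g : 'rV[R]_m -> R[i]) (x y : 'rV[R]_m) (i j : 'I_m) (e p : int) (M : R).

Lemma is_derive_exprz p (u : R) : u != 0 ->
  is_derive u (1 : R) (fun v : R => v ^ p) (p%:~R * u ^ (p - 1)).
Proof.
move=> u0.
have H n : is_derive u (1 : R) (fun v : R => v ^+ n) (n%:R * u ^+ n.-1).
  by apply: DeriveDef; [exact: exprn_derivable|rewrite exp_derive /GRing.scale /= mulr1].
case: p => n.
  case: n => [|n].
    by rewrite mul0r; under eq_fun do rewrite expr0z; exact: is_derive_cst.
  rewrite (_ : Posz n.+1 - 1 = Posz n); first exact: (H n.+1).
  by rewrite -addn1 PoszD addrK.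
have un : u ^+ n.+1 != 0 by rewrite expf_neq0.
have HV := @is_deriveV R (fun v => v ^+ n.+1) u _ 1 un (H n.+1).
apply: (is_derive_eq HV).
have -> : Negz n - 1 = Negz n.+1 by rewrite !NegzE -opprD -PoszD addn1.
rewrite [LHS](_ : _ = - (u ^+ n.+1) ^- 2 * (n.+1%:R * u ^+ n))//.
rewrite [RHS](_ : _ = - n.+1%:R * (u ^+ n.+2)^-1)//.
have w0 : u ^+ n != 0 by rewrite expf_neq0.
rewrite [u ^+ n.+2]exprS [u ^+ n.+1]exprS; field.
by rewrite u0 w0.
Qed.

(** An integer exponent covers both D (e = 1) and its inverse (e = -1). *)
Definition dil_pt e x : 'rV[R]_m :=
  \row_j (if j == l then x ord0 l else x ord0 l ^ e * x ord0 j).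

(* The factor x_l ^ p closes the class under differentiation in x_l; the value 0 at
   x_l = 0 is the limit when f is flat there. *)
Definition dil e p f : 'rV[R]_m -> R[i] := fun x =>
  if x ord0 l == 0 then 0 else (x ord0 l ^ p)%:C%C * f (dil_pt e x).

Lemma dil_ptE e x j : dil_pt e x ord0 j =
  if j == l then x ord0 l else x ord0 l ^ e * x ord0 j.
Proof. by rewrite mxE. Qed.

Lemma dil_pt_l e x : dil_pt e x ord0 l = x ord0 l.
Proof. by rewrite dil_ptE eqxx. Qed.

Lemma dil_pt_comp e1 e2 x : x ord0 l != 0 ->
  dil_pt e1 (dil_pt e2 x) = dil_pt (e1 + e2) x.
Proof.
move=> x0; apply/rowP => j; rewrite !dil_ptE eqxx; case: eqP => // _.
by rewrite mulrA expfzDr.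
Qed.

Lemma dil_pt0 x : dil_pt 0 x = x.
Proof. by apply/rowP => j; rewrite dil_ptE; case: eqP => [->|_]; rewrite ?expr0z ?mul1r. Qed.

Lemma dil_comp e p q f x : dil e p (dil (- e) q f) x = if x ord0 l == 0 then 0 else
  (x ord0 l ^ (p + q))%:C%C * f x.
Proof.
rewrite /dil dil_pt_l; case: (eqVneq (x ord0 l) 0) => // x0.
by rewrite dil_pt_comp// addNr dil_pt0 mulrA -rmorphM expfzDr.
Qed.

(* Each step of the induction is one mean value estimate from the hyperplane x_l = 0. *)
Lemma psi_flat q k f M : psi l f -> seminorm_le (k + q) f M ->
  forall y, (1 + `|upd y l 0|) ^+ k * normc (f y) <= (2 * `|y ord0 l|) ^+ q * M.
Proof.
elim: q f => [|q IHq] f Pf fM y.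
  rewrite expr0 mul1r; apply: le_trans (wbounded_seminorm fM y); rewrite addn0.
  rewrite ler_wpM2r ?normc_ge0//; apply: exprn_le; first by rewrite addr_ge0.
  by rewrite lerD2l -{2}(upd_id y l) norm_upd0_le.
have W0 : 0 < (1 + `|upd y l 0|) ^+ k by rewrite exprn_gt0// ltr_pwDl.
have M0 := seminorm_le_ge0 fM.
have f1 : seminorm_le (k + q) (partial l f) M.
  by apply: (@seminorm_le_dpartial _ _ _ _ [:: l] _ _ fM); rewrite addn1 addnS.
have := @mean_value_bound R (slice f y l) (slice (partial l f) y l) 0 (y ord0 l)
  ((2 * `|y ord0 l|) ^+ q * M / (1 + `|upd y l 0|) ^+ k).
rewrite (_ : slice f y l (y ord0 l) - slice f y l 0 = f y) ?subr0; last first.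
  by rewrite /slice upd_id [f (upd y l 0)](psi_vanish Pf) ?subr0// updE eqxx.
move=> H; rewrite mulrC -ler_pdivlMr//; apply: le_trans (H _ _) _.
- by move=> t _; apply: slice_cder; exact: (psi_schwartz Pf).1.
- move=> t tab; rewrite ler_pdivlMr// mulrC.
  have := IHq _ (psi_partial l Pf) f1 (upd y l t).
  rewrite upd_upd updE eqxx => /le_trans; apply; rewrite ler_wpM2r//.
  apply: exprn_le; first by rewrite mulr_ge0.
  rewrite ler_wpM2l//; move: tab; rewrite ge_min le_max => /andP[].
  have [y0|y0] := leP 0 (y ord0 l).
    move=> /orP[t0|yt] /orP[t0'|ty]; rewrite ?(ger0_norm y0).
    + by rewrite (_ : t = 0) ?normr0//; apply/eqP; rewrite eq_le t0 t0'.
    + by rewrite ger0_norm.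
    + by rewrite (ger0_norm (le_trans y0 yt)) (le_trans t0').
    + by rewrite ger0_norm// (le_trans y0 yt).
  move=> /orP[t0|yt] /orP[t0'|ty]; rewrite ?(ltr0_norm y0).
  + by rewrite (_ : t = 0) ?normr0 ?oppr_ge0 ?ltW//; apply/eqP; rewrite eq_le t0 t0'.
  + by have := le_trans t0 (ltW (le_lt_trans ty y0)); rewrite ger0_norm; lra.
  + by rewrite ler0_norm// lerN2.
  + by rewrite ler0_norm ?lerN2// (le_trans ty) ?ltW.
rewrite exprS le_eqVlt; apply/orP; left; apply/eqP; field.
by rewrite gt_eqF// ltr_pwDl.
Qed.

(** Nonnegative powers of y_l are absorbed by the weight, negative ones by flatness. This is where
    division by y_l becomes harmless. *)
Lemma psi_exprz_bound p k : exists k' C, 0 <= C /\ forall f M, psi l f ->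
  seminorm_le k' f M -> forall y, y ord0 l != 0 ->
  `|y ord0 l ^ p| * ((1 + `|y|) ^+ k * normc (f y)) <= C * M.
Proof.
case: p => q.
  exists (k + q)%N, 1; split=> // f M Pf fM y _; rewrite mul1r.
  apply: le_trans (wbounded_seminorm fM y); rewrite exprD mulrA.
  rewrite ler_wpM2r ?normc_ge0// mulrC ler_wpM2l ?exprn_ge0 ?addr_ge0//.
  rewrite -exprnP normrX; apply: exprn_le => //.
  by rewrite (le_trans (coord_le_norm y l))// lerDr.
set n := q.+1; exists (k + n)%N, (2 ^+ k * 2 ^+ n); split; first by rewrite mulr_ge0 ?exprn_ge0.
move=> f M Pf fM y y0; have M0 := seminorm_le_ge0 fM.
have yn0 : 0 < `|y ord0 l| by rewrite normr_gt0.
rewrite NegzE -exprnN normfV normrX ler_pdivrMl ?exprn_gt0//.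
(* Near the hyperplane [psi_flat] supplies the factor |y_l|^n, and dropping y_l from the weight
   costs at most 2^k. Away from it |y_l|^n >= 1 suffices. *)
have [y1|y1] := leP `|y ord0 l| 1.
  apply: (@le_trans _ _ (2 ^+ k * ((1 + `|upd y l 0|) ^+ k * normc (f y)))).
    rewrite mulrA ler_wpM2r ?normc_ge0//; apply: le_trans (weight_upd k y l) _.
    rewrite mulrC ler_wpM2r ?exprn_ge0 ?addr_ge0//; apply: exprn_le; first by rewrite addr_ge0.
    by rewrite -[2]/(1 + 1) lerD2l.
  have := psi_flat Pf fM y; rewrite exprMn => H.
  rewrite [leRHS](_ : _ = 2 ^+ k * (2 ^+ n * `|y ord0 l| ^+ n * M)); last by ring.
  by rewrite ler_wpM2l ?exprn_ge0.
apply: (@le_trans _ _ M).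
  apply: (@wboundedW _ _ _ _ _ M _ (leq_addr n k)) => //; exact: wbounded_seminorm.
rewrite mulrA ler_peMl// -[leLHS]mulr1; apply: ler_pM => //.
  by rewrite exprn_ege1// ltW.
by rewrite -exprD exprn_ege1// ler1n.
Qed.

(** The coordinates of [x] other than x_l are recovered from the dilated point by multiplying with
    x_l^(- e), so weights are compared at the cost of the k-th power of that factor. *)
Lemma dil_pt_weight e k x : x ord0 l != 0 ->
  (1 + `|x|) ^+ k <= 2 ^+ k * (1 + `|x ord0 l ^ (- (e * k))|) * (1 + `|dil_pt e x|) ^+ k.
Proof.
move=> x0; set a := `|x ord0 l ^ (- e)|.
have ak : `|x ord0 l ^ (- (e * k))| = a ^+ k.
  by rewrite /a -mulNr -exprz_exp -exprnP normrX.
rewrite ak; have a0 : 0 <= a by exact: normr_ge0.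
apply: (@le_trans _ _ (((1 + a) * (1 + `|dil_pt e x|)) ^+ k)); last first.
  rewrite exprMn ler_wpM2r ?exprn_ge0 ?addr_ge0//; exact: pow_1D_le.
apply: exprn_le; first by rewrite addr_ge0.
rewrite mulrDl mul1r -addrA lerD2l.
suff H : `|x| <= Num.max `|dil_pt e x| (a * `|dil_pt e x|).
  apply: le_trans H _; rewrite ge_max; apply/andP; split.
    by rewrite lerDl mulr_ge0 ?addr_ge0.
  by rewrite mulrDr mulr1 addrA lerDr addr_ge0.
apply: norm_le_coord => [|j]; first by rewrite le_max normr_ge0.
rewrite le_max; have [->|jl] := eqVneq j l.
  by rewrite -{1}(dil_pt_l e x) coord_le_norm.
apply/orP; right; apply: (@le_trans _ _ (a * `|dil_pt e x ord0 j|)); last first.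
  by rewrite ler_wpM2l// coord_le_norm.
by rewrite dil_ptE (negbTE jl) /a -normrM mulrA -expfzDr// addNr expr0z mul1r.
Qed.

Lemma dil_order0 e p : order0 (psi l) (dil e p).
Proof.
(* The exponent p matches the summand 1 in [dil_pt_weight], and p - e k the summand containing
   x_l^(- e k). *)
move=> k; have [k1 [C1 [C10 H1]]] := psi_exprz_bound p k.
have [k2 [C2 [C20 H2]]] := psi_exprz_bound (p - e * k) k.
exists (maxn k1 k2), (2 ^+ k * (C1 + C2)); split; first by rewrite mulr_ge0 ?exprn_ge0 ?addr_ge0.
move=> f M Pf fM x; have M0 := seminorm_le_ge0 fM; rewrite /dil.
case: (eqVneq (x ord0 l) 0) => x0.
  by rewrite normc0 mulr0 !mulr_ge0 ?exprn_ge0 ?addr_ge0.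
set y := dil_pt e x; have y0 : y ord0 l != 0 by rewrite dil_pt_l.
have h1 := H1 f M Pf (seminorm_leW (leq_maxl _ _) (lexx _) fM) y y0.
have h2 := H2 f M Pf (seminorm_leW (leq_maxr _ _) (lexx _) fM) y y0.
rewrite normcM normc_real.
apply: (@le_trans _ _ (2 ^+ k * (1 + `|x ord0 l ^ (- (e * k))|) * (1 + `|y|) ^+ k *
   (`|x ord0 l ^ p| * normc (f y)))).
  by rewrite ler_wpM2r ?mulr_ge0 ?normc_ge0//; exact: dil_pt_weight.
have := lerD h1 h2; rewrite !dil_pt_l expfzDr// normrM.
set c := normc _; set w := _ ^+ k; set a := `|_|; set b := `|_| => H.
rewrite [leLHS](_ : _ = 2 ^+ k * (a * (w * c) + a * b * (w * c))); last by ring.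
by rewrite -[leRHS]mulrA ler_wpM2l ?exprn_ge0// mulrDl.
Qed.

Lemma cder_near (h k : R -> R[i]) t d : (\forall s \near t, h s = k s) ->
  cder h t d -> cder k t d.
Proof.
move=> hk [h1 h2]; split.
  by apply: near_eq_is_derive h1; near=> s; congr complex.Re; near: s.
by apply: near_eq_is_derive h2; near=> s; congr complex.Im; near: s.
Unshelve. all: by end_near. Qed.

Lemma near_neq0 (t : R) : t != 0 -> \forall s \near t, s != 0.
Proof.
move=> t0; near=> s; apply/eqP => s0.
suff : `|t - s| < `|t| by rewrite s0 subr0 ltxx.
near: s; have := @cvgr_dist_lt R R R (nbhs t) _ id t (@cvg_id _ (nbhs t)).
by apply; rewrite normr_gt0.
Unshelve. all: by end_near. Qed.

(** The inner derivative x_l^e raises the exponent of the prefactor from p to p + e. *)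
Lemma dil_cpart_neq e p f x j : psi l f -> j != l ->
  cpart j (dil e p f) x (dil e (p + e) (partial j f) x).
Proof.
move=> Pf jl; rewrite /cpart /dil; under eq_fun do rewrite updE [l == j]eq_sym (negbTE jl).
have [x0|x0] := eqVneq (x ord0 l) 0; first exact: cder_cst.
have E u : dil_pt e (upd x j u) = upd (dil_pt e x) j (x ord0 l ^ e * u).
  apply/rowP => k; rewrite updE !dil_ptE !updE [l == j]eq_sym (negbTE jl).
  by case: (eqVneq k l) => [->|_]; [rewrite eq_sym (negbTE jl)|case: eqP].
under eq_fun do rewrite E.
have d1 : is_derive (x ord0 j) (1 : R) (fun u : R => x ord0 l ^ e * u) (x ord0 l ^ e).
  by apply: is_derive_eq; rewrite /GRing.scale /= mulr1.
have := cderZ (x ord0 l ^ p)%:C%C (cder_comp d1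
  (slice_cder (dil_pt e x) j (x ord0 l ^ e * x ord0 j) (psi_schwartz Pf).1)).
move/cder_eq; apply; rewrite expfzDr// rmorphM -mulrA; congr (_ * (_ * _)).
rewrite /slice; congr (partial j f _).
by rewrite -[RHS](upd_id _ j) dil_ptE (negbTE jl).
Qed.

Lemma cder_flat (h : R -> R[i]) (K : R) : (forall u, normc (h u) <= K * u ^+ 2) -> cder h 0 0.
Proof.
move=> hK.
have K0 : 0 <= K.
  by have := le_trans (normc_ge0 _) (hK 1); rewrite expr1n mulr1.
have part (f : R -> R) : (forall u, `|f u| <= K * u ^+ 2) -> is_derive (0 : R) 1 f 0.
  move=> fK.
  have f0 : f 0 = 0.
    by apply/eqP; rewrite -normr_le0 (le_trans (fK 0))// expr0n mulr0.
  have lim0 : (h^-1 *: (f (h *: 1 + 0) - f 0) : R) @[h --> (0:R)^'] --> (0 : R).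
    apply/cvgrPdist_le => e e0; near=> u.
    rewrite sub0r normrN f0 subr0 addr0 [u *: 1]mulr1 normrZ normfV.
    have u0 : u != 0 by near: u; exact: nbhs_dnbhs_neq.
    rewrite ler_pdivrMl ?normr_gt0//; apply: le_trans (fK u) _.
    rewrite -real_normK ?num_real// expr2 mulrA mulrC ler_wpM2l//.
    have Ku : `|u| * (K + 1) <= e.
      rewrite -ler_pdivlMr ?ltr_wpDl//.
      by near: u; apply: dnbhs0_le; rewrite divr_gt0// ltr_wpDl.
    by apply: le_trans Ku; rewrite mulrC ler_wpM2l// lerDl.
  by apply: DeriveDef; [exact: cvgP lim0|exact: cvg_lim lim0].
split; apply: part => u; apply: le_trans (hK u); [exact: Re_le_normc|exact: Im_le_normc].
Unshelve. all: by end_near. Qed.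

(** Off the hyperplane this is the product rule with the chain rule of [cder_curve]: the derivative
    e x_l^(e - 1) x_j equals e x_l^(-1) times the j-th coordinate of the dilated point, whence
    [coordmul j] and the exponent p - 1. On the hyperplane both sides are 0 by flatness. *)
Lemma dil_cpart_l e p f x : psi l f -> cpart l (dil e p f) x
  (p%:~R%:C%C * dil e (p - 1) f x + (dil e p (partial l f) x +
   \sum_j ((j != l)%:R * e%:~R)%:C%C * dil e (p - 1) (coordmul j (partial j f)) x)).
Proof.
move=> Pf; have [x0|x0] := eqVneq (x ord0 l) 0.
  have d0 q g : dil e q g x = 0 by rewrite /dil x0 eqxx.
  rewrite !d0 mulr0 !add0r big1 => [|j _]; last by rewrite d0 mulr0.
  rewrite /cpart x0.
  (* Bounding the dilation with exponent p - 2 leaves a factor u^2, so [cder_flat] gives derivative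
     0. *)
  have [k' [C [C0 H]]] := @dil_order0 e (p - 2) 0.
  have [M fM] := is_schwartz_bounded k' (psi_schwartz Pf).
  apply: (@cder_flat _ (C * M)) => u.
  have := H f M Pf fM (upd x l u); rewrite expr0 mul1r /dil updE eqxx.
  have [u0|u0] := eqVneq u 0; first by rewrite u0 normc0 expr0n mulr0.
  rewrite !normcM !normc_real => H'.
  rewrite (_ : `|u ^ p| = u ^+ 2 * `|u ^ (p - 2)|).
    by rewrite -[leLHS]mulrA [leRHS]mulrC ler_wpM2l ?sqr_ge0.
  by rewrite -[u ^+ 2]ger0_norm ?sqr_ge0// -normrM exprnP -expfzDr// addrC subrK.
rewrite /cpart.
set c := fun u : R => (\row_j (if j == l then u else u ^ e * x ord0 j)) : 'rV[R]_m.
pose dc j : R := if j == l then 1 else e%:~R * x ord0 l ^ (e - 1) * x ord0 j.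
have cE u : dil_pt e (upd x l u) = c u.
  by apply/rowP => j; rewrite dil_ptE !updE eqxx mxE; case: (j == l).
have cx : c (x ord0 l) = dil_pt e x by rewrite -cE upd_id.
have cd j : is_derive (x ord0 l) (1 : R) (fun u => c u ord0 j : R) (dc j).
  under eq_fun do rewrite mxE; rewrite /dc; case: (j == l); first exact: is_derive_id.
  have H := is_deriveM (is_derive_exprz e x0) (is_derive_cst (x ord0 j) (x ord0 l) 1).
  by apply: (is_derive_eq H); rewrite /GRing.scale /= mulr0 add0r mulrC.
have H := cderM (cder_real (is_derive_exprz p x0)) (cder_curve (psi_schwartz Pf).1 cd).
apply: (@cder_near (fun u => (u ^ p)%:C%C * f (c u))).
  have := near_neq0 x0; apply: filterS => u u0.
  by rewrite /dil updE eqxx (negbTE u0) cE.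
apply: (cder_eq H); rewrite cx /dil (negbTE x0).
rewrite rmorphM -mulrA; congr (_ + _).
rewrite (bigD1 l)//= [in RHS](bigD1 l)//= eqxx mul0r mul0r add0r.
rewrite {1}/dc eqxx mul1r mulrDr; congr (_ + _).
rewrite mulr_sumr; apply: eq_bigr => j jl; rewrite jl mul1r /dc (negbTE jl).
rewrite /coordmul dil_ptE (negbTE jl) !mulrA -!rmorphM; congr (_%:C%C * _).
have key : x ord0 l ^ p * x ord0 l ^ (e - 1) = x ord0 l ^ (p - 1) * x ord0 l ^ e.
  by rewrite -!expfzDr//; congr (_ ^ _); ring.
transitivity (e%:~R * (x ord0 l ^ p * x ord0 l ^ (e - 1)) * x ord0 j); first by ring.
by rewrite key; ring.
Qed.

(** The exponent [p] varies while [e] is fixed, and [D] takes up the derivatives and coordinate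
    multiplications created by [dil_cpart_neq] and [dil_cpart_l]. *)
Definition dil_ops e : set (('rV[R]_m -> R[i]) -> 'rV[R]_m -> R[i]) :=
  [set T | exists p D, [/\ tame (psi l) D, forall f, psi l f -> psi l (D f) &
     T = dil e p \o D]].

Lemma dil_ops_order0 e T : dil_ops e T -> order0 (psi l) T.
Proof.
move=> [p [D [tD PD ->]]].
exact: (@order0_comp R m (psi l) (psi l) (dil e p) D PD tD (dil_order0 e p)).
Qed.

Lemma dil_op_gen e p D : tame (psi l) D -> (forall f, psi l f -> psi l (D f)) ->
  op_span (dil_ops e) (fun f => dil e p (D f)).
Proof. by move=> tD PD; apply: span_gen; exists p, D. Qed.

Lemma dil_ops_partial e T j : dil_ops e T -> exists U, op_span (dil_ops e) U /\
  forall f x, psi l f -> cpart j (T f) x (U f x).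
Proof.
move=> [p [D [tD PD ->]]].
have PS := @psi_schwartz R m l.
have tp k : tame (psi l) (partial k \o D).
  apply: (@tame_comp R m (psi l) (psi l) (partial k) D PD tD).
  exact: (tame_sub PS (tame_dpartial R [:: k])).
have Pp k f : psi l f -> psi l ((partial k \o D) f).
  by move=> Pf; exact/psi_partial/PD.
have tq k : tame (psi l) (coordmul k \o (partial k \o D)).
  apply: (@tame_comp R m (psi l) (psi l) (coordmul k) _ (Pp k) (tp k)).
  exact: (tame_sub PS (tame_coordmul R k)).
have Pq k f : psi l f -> psi l ((coordmul k \o (partial k \o D)) f).
  by move=> Pf; exact/psi_coordmul/Pp.
have [->|jl] := eqVneq j l; last first.
  exists (fun f => dil e (p + e) (partial j (D f))); split.
    exact: (dil_op_gen _ _ (tp j) (Pp j)).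
  by move=> f x Pf; apply: dil_cpart_neq => //; exact: PD.
exists (fun f x => p%:~R%:C%C * dil e (p - 1) (D f) x + (dil e p (partial l (D f)) x +
   \sum_j ((j != l)%:R * e%:~R)%:C%C * dil e (p - 1) (coordmul j (partial j (D f))) x)).
split; last by move=> f x Pf; apply: dil_cpart_l; exact: PD.
apply: span_add; first by apply: span_scale; exact: dil_op_gen.
apply: span_add; first exact: (dil_op_gen _ _ (tp l) (Pp l)).
apply: (@span_sum R m _ 'I_m (fun k f x => ((k != l)%:R * e%:~R)%:C%C *
  dil e (p - 1) (coordmul k (partial k (D f))) x)) => k.
apply: span_scale; exact: (dil_op_gen _ _ (tq k) (Pq k)).
Qed.

Lemma dil_in_span e p : op_span (dil_ops e) (dil e p).
Proof. by apply: (@dil_op_gen e p id) => //; apply: tame_id; exact: psi_schwartz. Qed.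

Lemma tame_dil e p : tame (psi l) (dil e p).
Proof.
apply: (span_tame (@psi_schwartz R m l) (@dil_ops_order0 e) (@dil_ops_partial e)).
exact: dil_in_span.
Qed.

(** Every generator is 0 on the hyperplane by the convention in [dil]. Derivatives of dilations lie
    in the span, so flatness in [psi_dil] follows at once. *)
Lemma dil_span_vanish e U f x : op_span (dil_ops e) U -> x ord0 l = 0 -> U f x = 0.
Proof.
move=> GU x0; elim: GU => [T [p [D [_ _ ->]]]||T V _ IHT _ IHV|a T _ IHT] //=.
- by rewrite /dil x0 eqxx.
- by rewrite IHT IHV addr0.
- by rewrite IHT mulr0.
Qed.

Lemma psi_dil e p f : psi l f -> psi l (dil e p f).
Proof.
move=> Pf; split=> [|k x x0]; first exact: (tame_dil e p).1.
have [U [GU UE]] := span_dpartial (@dil_ops_partial e) (nseq k l) (dil_in_span e p).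
by rewrite UE//; exact: (dil_span_vanish f GU x0).
Qed.

Lemma dilK e f : psi l f -> dil e 0 (dil (- e) 0 f) = f.
Proof.
move=> Pf; apply/funext => x; rewrite dil_comp addr0 expr0z mul1r.
(* On the hyperplane the left side is 0 by convention, and [f] is 0 there because it is flat. *)
by case: eqVneq => // x0; rewrite (psi_vanish Pf x0).
Qed.

End Dilation.

(** * Iterated partial transforms as integrals over tuples *)

Section ContinuousMeasurable.
Context d (T : measurableType d) (R : realType) (m : nat).

Let grid (n : nat) (u : R) : R := (Num.floor (n.+1%:R * u))%:~R / n.+1%:R.

Let grid_dist n (u : R) : `|u - grid n u| <= harmonic n.
Proof.
have n0 : (0 : R) < n.+1%:R by [].
have /andP[f1 f2] := floor_itv (n.+1%:R * u).
rewrite intrD1 in f2.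
rewrite /grid /harmonic /=.
rewrite -[X in `|X - _|](mulfK (x := n.+1%:R) _ u) ?gt_eqF// -mulrBl normrM.
rewrite [`|_^-1|]ger0_norm ?invr_ge0// -[leRHS]mul1r ler_wpM2r ?invr_ge0//.
by rewrite mulrC ger0_norm ?subr_ge0// lerBlDl ltW// addrC.
Qed.

(* 'rV[R]_m carries no sigma-algebra; G is the limit of its values at the points
   of the lattices of mesh 1 / (n + 1), which take countably many values. *)
Lemma measurable_continuous_coords (G : 'rV[R]_m -> R) (c : 'I_m -> T -> R) :
  continuous G -> (forall j, measurable_fun setT (c j)) ->
  measurable_fun setT (fun t => G (\row_j c j t)).
Proof.
move=> cG mc.
apply: (@measurable_fun_cvg _ _ _ _ (fun n t => G (\row_j grid n (c j t)))); last first.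
  move=> t _; set z : 'rV[R]_m := \row_j c j t.
  suff gz : (fun n => \row_j grid n (c j t) : 'rV[R]_m) @ \oo --> z.
    exact: (@cvg_comp _ _ _ (fun n => \row_j grid n (c j t) : 'rV[R]_m) G _ (nbhs z) _ gz (cG z)).
  apply/cvgrPdist_le => e e0.
  have h0 : (harmonic n : R) @[n --> \oo] --> 0 by exact: cvg_harmonic.
  have /cvgrPdist_le/(_ _ e0) := h0.
  apply: filterS => n; rewrite sub0r normrN => ne.
  apply: norm_le_coord => [|j]; first exact: ltW.
  rewrite !mxE; apply: le_trans (grid_dist n (c j t)) _.
  exact: le_trans (ler_norm _) ne.
move=> n _ Y mY; rewrite setTI.
(* The integer vector [z] labels a lattice cell. The preimage is a union of cells over the countable
   set of labels. *)
pose E (z : {ffun 'I_m -> int}) j : set T := [set t | Num.floor (n.+1%:R * c j t) = z j].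
pose B (z : {ffun 'I_m -> int}) : set T :=
  [set t | Y (G (\row_j ((z j)%:~R / n.+1%:R))) /\ forall j, E z j t].
have -> : (fun t => G (\row_j grid n (c j t))) @^-1` Y = \bigcup_z B z.
  apply/seteqP; split=> t /=.
    move=> Yt; exists [ffun j => Num.floor (n.+1%:R * c j t)] => //; split=> [|j].
      rewrite (_ : \row_j _ = \row_j grid n (c j t))//.
      by apply/rowP => j; rewrite !mxE ffunE.
    by rewrite /E /= ffunE.
  move=> [z _ [Yz Ez]]; rewrite (_ : \row_j _ = \row_j ((z j)%:~R / n.+1%:R))//.
  by apply/rowP => j; rewrite !mxE /grid (Ez j).
apply: countable_bigcupT_measurable; first exact: countableP.
move=> z; have mE j : measurable (E z j).
  have -> : E z j = (fun t => n.+1%:R * c j t) @^-1` `[(z j)%:~R, (z j + 1)%:~R[.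
    apply/seteqP; split=> t /=; rewrite in_itv /=.
      by rewrite /E /= => <-; exact: floor_itv.
    by move=> H; exact: floor_def.
  rewrite -[X in measurable X]setTI.
  by apply: measurable_funM => //; exact: measurable_cst.
(* The finite intersection over coordinates is obtained as the complement of a countable union. *)
have mI : measurable (~` (\bigcup_j ~` E z j)).
  apply: measurableC; apply: countable_bigcupT_measurable; first exact: countableP.
  by move=> j; exact: measurableC.
rewrite setC_bigcup in mI.
have [Yz|nYz] := pselect (Y (G (\row_j ((z j)%:~R / n.+1%:R)))); last first.
  by rewrite (_ : B z = set0) // -subset0 => t [].
rewrite (_ : B z = \bigcap_i ~` (~` E z i))//.
apply/seteqP; split=> t /=.
  by move=> [_ Et] j _ nE; exact: nE (Et j).
by move=> Et; split=> // j; apply: contrapT => nE; exact: (Et j I).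
Qed.

End ContinuousMeasurable.

Section CoordinateUpdates.
Variables (R : realType) (m : nat).
Implicit Types (f g : 'rV[R]_m -> R[i]) (x y z : 'rV[R]_m) (i j : 'I_m)
  (s : seq 'I_m) (ts : seq R).

Fixpoint updl y s ts : 'rV[R]_m :=
  match s, ts with
  | i :: s', t :: ts' => updl (upd y i t) s' ts'
  | _, _ => y
  end.

Lemma updl_notin y s ts j : j \notin s -> updl y s ts ord0 j = y ord0 j.
Proof.
elim: s y ts => [|i s IHs] y [|t ts] //=; rewrite inE negb_or => /andP[ji js].
by rewrite IHs// updE (negbTE ji).
Qed.

Lemma updl_map y s ts : uniq s -> size ts = size s -> [seq updl y s ts ord0 j | j <- s] = ts.
Proof.
elim: s y ts => [|i s IHs] y [|t ts] //= /andP[nis us] [tss].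
by rewrite updl_notin// updE eqxx IHs.
Qed.

Lemma updl_upd y s ts i t : i \notin s -> updl (upd y i t) s ts = upd (updl y s ts) i t.
Proof.
elim: s y ts => [|j s IHs] y [|u ts] //=; rewrite inE negb_or => /andP[ij js].
by rewrite updC ?IHs.
Qed.

Lemma updl_nth y s ts j : uniq s -> size ts = size s -> j \in s ->
  updl y s ts ord0 j = nth 0 ts (index j s).
Proof.
move=> us tss js; rewrite -[in RHS](updl_map y us tss).
by rewrite (nth_map j) ?index_mem// nth_index.
Qed.

End CoordinateUpdates.

Section SigmaFiniteBundle.
Context d (T : measurableType d) (R : realType).
Variables (mu : {measure set T -> \bar R}) (H : sigma_finite setT mu).

(* A copy of mu, to equip an already bundled measure with sigma-finiteness. *)
Definition sigma_finite_bundle of sigma_finite setT mu : set T -> \bar R := mu.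

HB.instance Definition _ := Measure.copy (sigma_finite_bundle H) mu.

HB.instance Definition _ := Measure_isSigmaFinite.Build _ _ _ (sigma_finite_bundle H) H.

End SigmaFiniteBundle.

(** * Sigma-finiteness of Lebesgue measure on tuples *)

Section LebesgueTuple.
Variable R : realType.
Notation lam := (@lebesgue_measure R).
Notation RT := (measurableTypeR R).

Let cube n (N : nat) : set (n.-tuple RT) := [set t | forall i, `|tnth t i : R| <= N%:R].

Let measurable_cube n N : measurable (@cube n N).
Proof.
rewrite (_ : @cube n N = \bigcap_i (fun t => tnth t i) @^-1` `[- (N%:R : R), N%:R]).
  rewrite -[X in measurable X]setCK setC_bigcap; apply: measurableC.
  apply: countable_bigcupT_measurable; first exact: countableP.
  move=> i; apply: measurableC; rewrite -[X in measurable X]setTI.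
  by apply: measurable_tnth => //; exact: measurable_itv.
apply/seteqP; split=> t /=.
  by move=> H i _ /=; rewrite in_itv /= -ler_norml.
by move=> H i; have := H i I; rewrite /= in_itv /= -ler_norml.
Qed.

(** Induction on the dimension: pulled back along [tcons], a cube is a cube of one dimension less
    times an interval. *)
Let lebesgue_cube n N : (lebesgue_tuple R n (@cube n N) < +oo)%E.
Proof.
elim: n => [|n IHn]; first by rewrite /= diracE ltry.
rewrite /= /lebesgue_step /pushforward.
rewrite (_ : _ @^-1` _ = @cube n N `*` `[- (N%:R : R), N%:R]); last first.
  apply/seteqP; split=> -[t x] /=.
    move=> H; split; last by have := H ord0; rewrite tnth0 in_itv /= -ler_norml.
    by move=> i; have := H (lift ord0 i); rewrite tnthS.
  move=> [H]; rewrite in_itv /= -ler_norml => xN i.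
  by case: (unliftP ord0 i) => [j ->|->]; rewrite ?tnth0 ?tnthS.
rewrite product_measure1E; [|exact: measurable_cube|exact: measurable_itv].
apply: lte_mul_pinfty => //; first by rewrite ge0_fin_numE.
have := @lebesgue_measure_itv R `[- N%:R, N%:R]; rewrite /= => ->.
by case: ifP => _; rewrite ?ltry// -EFinB ltry.
Qed.

Lemma lebesgue_tuple_sigma_finite n : sigma_finite setT (lebesgue_tuple R n).
Proof.
exists (@cube n); last by move=> N; split; [exact: measurable_cube|exact: lebesgue_cube].
apply/esym; rewrite -subTset => t _.
(* The sum of the ceilings bounds all coordinates simultaneously. *)
exists (\sum_i `|Num.ceil `|tnth t i : R| |)%N => // i.
apply: le_trans (ceil_ge _) _.
rewrite (bigD1 i)//= natrD -[X in X <= _]addr0; apply: lerD => //.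
by rewrite natr_absz intr_norm ler_norm.
Qed.


End LebesgueTuple.

Section TupleIntegral.
Variable R : realType.
Notation lam := (@lebesgue_measure R).
Notation RT := (measurableTypeR R).
Notation ltuple n := (sigma_finite_bundle (@lebesgue_tuple_sigma_finite R n)).

Definition prod_invsq (ts : seq R) : R := \prod_(x <- ts) invsq x.

Lemma prod_invsq_ge0 ts : 0 <= prod_invsq ts.
Proof. by apply: prodr_ge0 => x _; exact: invsq_ge0. Qed.

Lemma measurable_prod_invsq n :
  measurable_fun setT (fun t : n.-tuple RT => prod_invsq t).
Proof.
rewrite /prod_invsq; under eq_fun do rewrite big_tuple.
elim: (index_enum _) => [|i r IHr].
  by under eq_fun do rewrite big_nil; exact: measurable_cst.
under eq_fun do rewrite big_cons; apply: measurable_funM => //.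
apply: measurableT_comp; last exact: measurable_tnth.
exact: continuous_measurable_line (@continuous_invsq R).
Qed.

Lemma integrable_prod_invsq n :
  (lebesgue_tuple R n).-integrable setT (EFin \o (fun t : n.-tuple RT => prod_invsq t)).
Proof.
elim: n => [|n IHn].
  apply/integrableP; split; first by apply/measurable_EFinP; exact: measurable_prod_invsq.
  rewrite [X in (X < _)%E](_ : _ = (\int[lebesgue_tuple R 0]_t (cst 1%:E) t)%E); last first.
    by apply: eq_integral => t _; rewrite /= tuple0 /prod_invsq big_nil normr1.
  by rewrite integral_cst// mul1e /= diracE ltry.
apply: (integrable_pushforward (@measurable_tcons R n)) => //.
  by apply/measurable_EFinP; exact: measurable_prod_invsq.
have := @integrable_tensor _ _ _ _ R (ltuple n) lam _ _
  (fun t : n.-tuple RT => prod_invsq_ge0 t) (@invsq_ge0 R) IHn (@integrable_invsq R).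
apply: eq_integrable => // -[t x] _ /=.
by rewrite /prod_invsq big_cons mulrC.
Qed.

Lemma integrable_prod_invsqZ n (K : R) :
  (lebesgue_tuple R n).-integrable setT (EFin \o (fun t : n.-tuple RT => K * prod_invsq t)).
Proof. exact: (integrableZE measurableT _ (integrable_prod_invsq n)). Qed.

Lemma integrable_prod_invsq_line n (K : R) : (ltuple n \x lam)%E.-integrable setT
  (EFin \o (fun p : n.-tuple RT * RT => K * (prod_invsq p.1 * invsq p.2))).
Proof.
apply: (integrableZE measurableT).
apply: (@integrable_tensor _ _ _ _ R (ltuple n) lam _ _
  (fun t : n.-tuple RT => prod_invsq_ge0 t) (@invsq_ge0 R)).
- exact: integrable_prod_invsq.
- exact: integrable_invsq.
Qed.

Lemma cint_tuple0 (h : 0.-tuple RT -> R[i]) :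
  cint (lebesgue_tuple R 0) setT h = h [tuple].
Proof.
have part (f : 0.-tuple RT -> R) : \int[lebesgue_tuple R 0]_t f t = f [tuple].
  rewrite (_ : f = cst (f [tuple])); last by apply/funext => t; rewrite /= tuple0.
  by rewrite Rintegral_cst//= indicT mulr1.
by apply: complexP; rewrite /= part.
Qed.

(** Change of variables along [tcons]. The majorant gives integrability on the product, which both
    this step and a later use of Fubini's theorem require. *)
Lemma cint_tupleS n (h : n.+1.-tuple RT -> R[i]) (K : R) : cmeasurable setT h ->
  (forall t, normc (h t) <= K * prod_invsq t) ->
  cintegrable (ltuple n \x lam)%E setT (fun p => h (tcons p)) /\
  cint (lebesgue_tuple R n.+1) setT h = cint (ltuple n \x lam)%E setT (fun p => h (tcons p)).
Proof.
move=> mh hK.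
have ih : cintegrable (ltuple n \x lam)%E setT (fun p => h (tcons p)).
  apply: (cintegrable_le measurableT _ (integrable_prod_invsq_line n K)).
    have [h1 h2] := mh; split.
      exact: (measurableT_comp h1 (@measurable_tcons R n)).
    exact: (measurableT_comp h2 (@measurable_tcons R n)).
  move=> [t x] _; apply: le_trans (hK _) _.
  by rewrite /prod_invsq /= big_cons [invsq x * _]mulrC.
split=> //.
have part (f : n.+1.-tuple RT -> R) : measurable_fun setT f ->
    (ltuple n \x lam)%E.-integrable setT (EFin \o (f \o @tcons R n)) ->
    \int[lebesgue_tuple R n.+1]_t f t = \int[(ltuple n \x lam)%E]_p f (tcons p).
  move=> mf fi; congr fine.
  exact: (@integral_pushforward _ _ _ _ R _ (@measurable_tcons R n) (ltuple n \x lam)%E setT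
    (EFin \o f) ((measurable_EFinP _ _).2 mf) fi measurableT).
apply: complexP => /=.
  by apply: (part (fun t => complex.Re (h t))); [exact: mh.1|exact: ih.1].
by apply: (part (fun t => complex.Im (h t))); [exact: mh.2|exact: ih.2].
Qed.

End TupleIntegral.

(** * Iterated partial transforms *)

Section IteratedFourier.
Variables (R : realType) (m : nat).
Notation lam := (@lebesgue_measure R).
Notation RT := (measurableTypeR R).
Notation ltuple n := (sigma_finite_bundle (@lebesgue_tuple_sigma_finite R n)).
Notation schw := (@is_schwartz R m).
Implicit Types (f g : 'rV[R]_m -> R[i]) (x y z : 'rV[R]_m) (i j : 'I_m)
  (s : seq 'I_m) (ts : seq R).

Fixpoint pfts s g : 'rV[R]_m -> R[i] := if s is i :: s' then pfts s' (pft i g) else g.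

Lemma pfts_cat s s' g : pfts (s ++ s') g = pfts s' (pfts s g).
Proof. by elim: s g => //= i s IHs g. Qed.

Section Measurability.
Context d (T : measurableType d).

Lemma cmeasurable_smooth g (Z : T -> 'rV[R]_m) : smooth g ->
  (forall j, measurable_fun setT (fun t => Z t ord0 j)) -> cmeasurable setT (fun t => g (Z t)).
Proof.
move=> sg mZ; have [c1 c2 _] := sg [::].
have E : Z = (fun t => \row_j Z t ord0 j) by apply/funext => t; apply/rowP => j; rewrite mxE.
by rewrite E; split; [exact: (measurable_continuous_coords c1 mZ)|
  exact: (measurable_continuous_coords c2 mZ)].
Qed.

Lemma measurable_phase (Z W : T -> 'rV[R]_m) s :
  (forall j, measurable_fun setT (fun t => Z t ord0 j)) ->
  (forall j, measurable_fun setT (fun t => W t ord0 j)) ->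
  measurable_fun setT (fun t => \sum_(j <- s) Z t ord0 j * W t ord0 j).
Proof.
move=> mZ mW; elim: s => [|j s IHs].
  by under eq_fun do rewrite big_nil; exact: measurable_cst.
under eq_fun do rewrite big_cons; apply: measurable_funD => //.
exact: measurable_funM.
Qed.

Lemma measurable_updl (Y : T -> 'rV[R]_m) n (tau : T -> n.-tuple RT) s : uniq s -> size s = n ->
  (forall j, measurable_fun setT (fun t => Y t ord0 j)) -> measurable_fun setT tau ->
  forall j, measurable_fun setT (fun t => updl (Y t) s (tau t) ord0 j).
Proof.
move=> us sn mY mtau j; have [js|js] := boolP (j \in s); last first.
  by under eq_fun do rewrite updl_notin//; exact: mY.
have jn : (index j s < n)%N by rewrite -sn index_mem.
rewrite (_ : (fun t => _) = (fun t => tnth (tau t) (Ordinal jn))).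
  exact: (measurableT_comp (measurable_tnth _) mtau).
apply/funext => t; rewrite updl_nth ?size_tuple//.
by rewrite (tnth_nth 0).
Qed.

End Measurability.

Lemma prod_weight_bound s z : \prod_(j <- s) (1 + z ord0 j ^+ 2) <= (1 + `|z|) ^+ (2 * size s).
Proof.
elim: s => [|j s IHs]; first by rewrite big_nil muln0 expr0.
rewrite big_cons mulnS exprD; apply: ler_pM => //.
- exact/ltW/oneDsq_gt0.
- by apply: prodr_ge0 => k _; exact/ltW/oneDsq_gt0.
- rewrite sqrrD expr1n mul1r -addrA lerD2l -[z ord0 j ^+ 2]real_normK ?num_real//.
  apply: (@le_trans _ _ (`|z| ^+ 2)); first exact/exprn_le/coord_le_norm.
  by rewrite lerDr mulrn_wge0.
Qed.

Lemma wbounded_prod s g M z : wbounded (2 * size s) g M ->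
  normc (g z) <= M * \prod_(j <- s) invsq (z ord0 j).
Proof.
move=> gM; rewrite [\prod_(j <- s) _](_ : _ = (\prod_(j <- s) (1 + z ord0 j ^+ 2))^-1); last first.
  by rewrite prodfV.
have P0 : 0 < \prod_(j <- s) (1 + z ord0 j ^+ 2).
  by apply: prodr_gt0 => j _; exact: oneDsq_gt0.
rewrite ler_pdivlMr// mulrC; apply: le_trans (gM z).
by rewrite ler_wpM2r ?normc_ge0// prod_weight_bound.
Qed.

Lemma updl_prod_invsq y s ts : uniq s -> size ts = size s ->
  \prod_(j <- s) invsq (updl y s ts ord0 j) = prod_invsq ts.
Proof.
move=> us tss; rewrite -[in RHS](updl_map y us tss) /prod_invsq.
by rewrite [RHS]big_map.
Qed.

(** Induction on the list for all [g]: Fubini's theorem integrates the head coordinate first, which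
    turns [g] into [pft i g], and the tail is the induction hypothesis. *)
Lemma pfts_integral n s g y : uniq s -> size s = n -> schw g ->
  pfts s g y = cint (lebesgue_tuple R n) setT (fun t : n.-tuple RT =>
    g (updl y s t) * expi (\sum_(j <- s) updl y s t ord0 j * y ord0 j)).
Proof.
elim: n s g => [|n IHn] [|i s] // g.
  by rewrite cint_tuple0 /= big_nil expi0 mulr1.
move=> us' [sn] Sg; have /andP[nis us] := us'.
have [M gM] := schwartz_wbounded (2 * size (i :: s)) Sg.
have mz : forall j, measurable_fun setT
    (fun t : n.+1.-tuple RT => updl y (i :: s) t ord0 j).
  apply: (@measurable_updl _ _ (fun=> y) n.+1 id) => //; by rewrite /= sn.
pose h (t : n.+1.-tuple RT) := g (updl y (i :: s) t) *
    expi (\sum_(j <- i :: s) updl y (i :: s) t ord0 j * y ord0 j).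
have mh : cmeasurable setT h.
  apply: cmeasurableM; first exact: (cmeasurable_smooth Sg.1 mz).
  apply: cmeasurable_expi; apply: measurable_phase => // j; exact: measurable_cst.
have hM t : normc (h t) <= M * prod_invsq t.
  rewrite normcM normc_expi mulr1 -(updl_prod_invsq y us'); first exact: wbounded_prod.
  by rewrite size_tuple /= sn.
have [ih E0] := cint_tupleS mh hM; apply: (etrans _ (esym E0)).
(* The phase is additive over the list, so the variable [x] enters only through a slice and its own
   exponential. *)
have E (t : n.-tuple RT) (x : RT) : h (tcons (t, x)) =
    expi (\sum_(j <- s) updl y s t ord0 j * y ord0 j) *
    (slice g (updl y s t) i x * expi (x * (updl y s t) ord0 i)).
  rewrite /h /= updl_upd// big_cons updE eqxx expiD /slice updl_notin//.
  rewrite [X in _ * (_ * X) = _](_ : _ = expi (\sum_(j <- s) updl y s t ord0 j * y ord0 j)).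
    by ring.
  congr expi; rewrite !big_seq; apply: eq_bigr => j js; rewrite updE.
  by case: eqP => [ji|//]; rewrite ji (negbTE nis) in js.
have [N gN] := schwartz_wbounded 2 Sg.
have isl z : cintegrable lam setT (fun u : RT => slice g z i u * expi (u * z ord0 i)).
  by apply: (@ft_integrable _ _ _ N); [exact: slice_ccont Sg.1|exact: slice_decay].
rewrite (cint_fubini12 ih); last first.
  move=> t; under eq_fun do rewrite E.
  exact: (cintegrableZ measurableT _ (isl (updl y s t))).
apply: (etrans (IHn s (pft i g) us sn (is_schwartz_pft i Sg))).
apply: eq_cint => t _; rewrite mulrC.
apply: (etrans (esym (cintZ measurableT _ (isl (updl y s t))))).
by apply: eq_cint => x _; rewrite E.
Qed.

End IteratedFourier.

(** * The transversal Radon transform *)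

Section FourierAndRadon.
Variable R : realType.
Notation lam := (@lebesgue_measure R).
Notation RT := (measurableTypeR R).
Notation ltuple n := (sigma_finite_bundle (@lebesgue_tuple_sigma_finite R n)).

Section IteratedTransforms.
Variable m : nat.
Notation schw := (@is_schwartz R m).
Implicit Types (f g : 'rV[R]_m -> R[i]) (s : seq 'I_m).

(** The head acts last here and first in [pfts], so that each inverse meets its own transform
    without reordering. *)
Fixpoint ipfts s g : 'rV[R]_m -> R[i] := if s is i :: s' then ipft i (ipfts s' g) else g.

Lemma is_schwartz_ipft i f : schw f -> schw (ipft i f).
Proof. exact: (tame_ipft R i).1. Qed.

Lemma is_schwartz_pfts s f : schw f -> schw (pfts s f).
Proof. by elim: s f => //= i s IHs f Sf; apply: IHs; exact: is_schwartz_pft. Qed.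

Lemma is_schwartz_ipfts s f : schw f -> schw (ipfts s f).
Proof. by move=> Sf; elim: s => //= i s; exact: is_schwartz_ipft. Qed.

Lemma pftsK s f : schw f -> ipfts s (pfts s f) = f.
Proof.
elim: s f => //= i s IHs f Sf; rewrite IHs; last exact: is_schwartz_pft.
exact: pftK.
Qed.

Lemma ipftsK s f : schw f -> pfts s (ipfts s f) = f.
Proof.
move=> Sf; elim: s => //= i s IHs; rewrite ipftK//; exact: is_schwartz_ipfts.
Qed.

Lemma tame_pfts s : tame schw (pfts s).
Proof.
elim: s => [|i s IHs] /=; first exact: tame_id.
by apply: (@tame_comp R m schw schw (pfts s) (pft i)) IHs; [exact: is_schwartz_pft|exact: tame_pft].
Qed.

Lemma tame_ipfts s : tame schw (ipfts s).
Proof.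
elim: s => [|i s IHs] /=; first exact: tame_id.
apply: (@tame_comp R m schw schw (ipft i) (ipfts s)) => //; last exact: tame_ipft.
exact: is_schwartz_ipfts.
Qed.

Lemma psi_pfts l s f : l \notin s -> psi l f -> psi l (pfts s f).
Proof.
elim: s f => //= i s IHs f; rewrite inE negb_or => /andP[li ls] Pf.
by apply: IHs => //; apply: psi_pft; rewrite // eq_sym.
Qed.

Lemma psi_ipfts l s f : l \notin s -> psi l f -> psi l (ipfts s f).
Proof.
move=> ls Pf; elim: s ls => //= i s IHs; rewrite inE negb_or => /andP[li ls].
by apply: psi_ipft; [rewrite eq_sym|exact: IHs].
Qed.

Lemma fourier_pfts g : schw g -> fourier g = pfts (enum 'I_m) g.
Proof.
move=> Sg; apply/funext => y.
rewrite (@pfts_integral _ _ m (enum 'I_m)) ?enum_uniq ?size_enum_ord//.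
rewrite [LHS](_ : _ = cint (lebesgue_tuple R m) setT (fun t : m.-tuple RT =>
  g (row_of_tuple t) * expi (dot (row_of_tuple t) y)))//.
apply: eq_cint => t _.
have -> : updl y (enum 'I_m) t = row_of_tuple t.
  apply/rowP => j; rewrite updl_nth ?enum_uniq ?size_enum_ord ?size_tuple ?mem_enum//.
  by rewrite index_enum_ord mxE (tnth_nth 0).
by rewrite /dot big_enum.
Qed.

End IteratedTransforms.

Variable n : nat.
Notation schw := (@is_schwartz R (n + 1)).
Notation L := (last_idx n).
Implicit Types (f g : 'rV[R]_(n + 1) -> R[i]) (y : 'rV[R]_(n + 1)).

Definition front : seq 'I_(n + 1) := [seq lshift 1 i | i <- enum 'I_n].

Lemma front_uniq : uniq front.
Proof. by rewrite map_inj_uniq ?enum_uniq//; exact: lshift_inj. Qed.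

Lemma size_front : size front = n.
Proof. by rewrite size_map size_enum_ord. Qed.

Lemma last_notin_front : L \notin front.
Proof.
by apply/mapP => -[i _ /(congr1 val)] /= E; have := ltn_ord i; rewrite -E addn0 ltnn.
Qed.

Lemma mem_front j : (j \in front) = (j != L).
Proof.
apply/idP/idP => [jf|jL]; first by apply: contraNneq last_notin_front => <-.
case: (split_ordP j) jL => i ->; first by rewrite (map_f _ (mem_enum _ i)).
by rewrite (ord1 i) eqxx.
Qed.

Lemma enum_front : enum 'I_(n + 1) = front ++ [:: L].
Proof.
apply: (inj_map val_inj); rewrite val_enum_ord map_cat /= addn0 iotaD add0n /=.
rewrite /front -map_comp (@eq_map _ _ _ val)//.
by rewrite val_enum_ord.
Qed.

Lemma fourier_last g : schw g -> fourier g = pft L (pfts front g).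
Proof. by move=> Sg; rewrite fourier_pfts// enum_front pfts_cat. Qed.

Lemma updl_front y (t : n.-tuple R) :
  updl y front t = row_mx (row_of_tuple t) (y ord0 L)%:M.
Proof.
apply/rowP => j; case: (split_ordP j) => i ->; last first.
  by rewrite (ord1 i) row_mxEr mxE eqxx mulr1n updl_notin ?last_notin_front.
rewrite row_mxEl mxE updl_nth ?front_uniq ?size_front ?size_tuple//.
  rewrite /front index_map; last exact: lshift_inj.
  by rewrite index_enum_ord (tnth_nth 0).
by rewrite (map_f _ (mem_enum _ i)).
Qed.

Lemma measurable_row_of_tuple (t : n.-tuple RT -> R) y : measurable_fun setT t ->
  forall j, measurable_fun setT
    (fun u : n.-tuple RT => (row_mx (row_of_tuple u) (t u)%:M : 'rV[R]_(n + 1)) ord0 j).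
Proof.
move=> mt j; case: (split_ordP j) => i ->.
  under eq_fun do rewrite row_mxEl mxE; exact: measurable_tnth.
by under eq_fun do rewrite row_mxEr mxE !ord1 eqxx mulr1n.
Qed.

Lemma measurable_dot (a : 'rV[R]_n) (b : R) :
  measurable_fun setT (fun u : n.-tuple RT => dot a (row_of_tuple u) + b).
Proof.
apply: measurable_funD => //; apply: measurable_sum => i.
by under eq_fun do rewrite mxE; apply: measurable_funM => //; exact: measurable_tnth.
Qed.

Definition hyperplane y (t : n.-tuple R) : 'rV[R]_(n + 1) :=
  row_mx (row_of_tuple t) (dot (lsubmx y) (row_of_tuple t) + y ord0 L)%:M.

Lemma radonTE f y : radonT f y =
  cint (lebesgue_tuple R n) setT (fun t : n.-tuple RT => f (hyperplane y t)).
Proof. by []. Qed.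

(** The decay of [f] in the first coordinates alone suffices: two powers of the weight for each of
    them, whatever the last coordinate is. *)
Lemma radon_integrable f y : schw f ->
  cintegrable (lebesgue_tuple R n) setT (fun t : n.-tuple RT => f (hyperplane y t)).
Proof.
move=> Sf; have [M fM] := schwartz_wbounded (2 * size front) Sf.
apply: (cintegrable_le measurableT _ (integrable_prod_invsqZ n M)).
  apply: (cmeasurable_smooth Sf.1); apply: measurable_row_of_tuple => //.
  exact: measurable_dot.
move=> t _; apply: le_trans (wbounded_prod _ fM) _.
set z := hyperplane y t.
(* Written in this form, the front coordinates of [z] are visibly those of [t], so the product of
   majorants is [prod_invsq t]. *)
have -> : z = updl z front t.
  by rewrite updl_front /z row_mxEr mxE eqxx mulr1n.
by rewrite updl_prod_invsq ?front_uniq// size_tuple size_front.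
Qed.

Lemma radonT_linear (a : R[i]) f g : schw f -> schw g ->
  radonT (a *: f + g) = a *: radonT f + radonT g.
Proof.
move=> Sf Sg; apply/funext => y.
have i1 := radon_integrable y Sf; have i2 := radon_integrable y Sg.
have i3 := cintegrableZ measurableT a i1.
rewrite [RHS](_ : _ = a * radonT f y + radonT g y)// !radonTE -(cintZ measurableT a i1).
exact: (cintD measurableT i3 i2).
Qed.

(** Both sides are iterated integrals of the same [H(t, u)] = g(t, u) exp (i u (a . t + b)), with y
    = (a, b); decay of [g] in all variables justifies the exchange. *)
Lemma radonT_pft g : psi L g ->
  radonT (pft L g) = pft L (dil L 1 0 (pfts front g)).
Proof.
move=> Pg; apply/funext => y; have Sg := psi_schwartz Pg.
pose s := front ++ [:: L].
have us : uniq s by rewrite /s -enum_front enum_uniq.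
have [M gM] := schwartz_wbounded (2 * size s) Sg.
pose c (t : n.-tuple RT) := dot (lsubmx y) (row_of_tuple t) + y ord0 L.
pose H (p : n.-tuple RT * RT) := g (updl (upd y L p.2) front p.1) * expi (p.2 * c p.1).
have HE t (u : R) : H (t, u) = slice (fun x => g x) (hyperplane y t) L u * expi (u * c t).
  rewrite /H /slice /=; congr (g _ * _); rewrite updl_front updE eqxx.
  apply/rowP => j; rewrite updE; case: (split_ordP j) => i ->.
    by rewrite -[_ == _]negbK -mem_front map_f ?mem_enum// !row_mxEl.
  by rewrite (ord1 i) eqxx row_mxEr mxE eqxx.
have mH : cmeasurable setT H.
  apply: cmeasurableM.
    apply: (cmeasurable_smooth Sg.1).
    apply: measurable_updl => //; [exact: front_uniq|exact: size_front|move=> j].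
    under eq_fun do rewrite updE; case: (j == L); first exact: measurable_snd.
    exact: measurable_cst.
  apply: cmeasurable_expi; apply: measurable_funM; first exact: measurable_snd.
  exact: (measurableT_comp (measurable_dot _ _) measurable_fst).
have HM p : normc (H p) <= M * (prod_invsq p.1 * invsq p.2).
  rewrite normcM normc_expi mulr1; apply: le_trans (wbounded_prod _ gM) _.
  rewrite /s big_cat big_seq1 /= updl_notin ?last_notin_front// updE eqxx.
  by rewrite updl_prod_invsq ?front_uniq// size_tuple size_front.
have iH : cintegrable (ltuple n \x lam)%E setT H.
  by apply: (cintegrable_le measurableT mH (integrable_prod_invsq_line n M)) => p _.
have i2 t : cintegrable lam setT (fun u => H (t, u)).
  apply: (cintegrable_le measurableT _ (integrable_invsqZ (M * prod_invsq t))).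
    have [m1 m2] := mH; split.
      exact: (measurableT_comp m1 (pair1_measurable t)).
    exact: (measurableT_comp m2 (pair1_measurable t)).
  by move=> u _; apply: le_trans (HM _) _; rewrite mulrA.
have i1 u : cintegrable (ltuple n) setT (fun t => H (t, u)).
  apply: (cintegrable_le measurableT _ (integrable_prod_invsqZ n (M * invsq u))).
    have [m1 m2] := mH; split.
      exact: (measurableT_comp m1 (pair2_measurable u)).
    exact: (measurableT_comp m2 (pair2_measurable u)).
  by move=> t _; apply: le_trans (HM _) _; rewrite -mulrA [invsq u * _]mulrC.
transitivity (cint (ltuple n \x lam)%E setT H).
  rewrite (cint_fubini12 iH i2) radonTE; apply: eq_cint => t _.
  rewrite /pft /ft1; apply: eq_cint => u _; rewrite HE.
  by rewrite row_mxEr mxE eqxx mulr1n.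
rewrite (cint_fubini21 iH i1); apply: eq_cint => u _.
(* This is the point (u a, u): the phase u a . t is the pairing of t with its first coordinates. *)
set w := dil_pt L 1 (upd y L u).
have wj j : w ord0 j = if j == L then u else u * y ord0 j.
  by rewrite dil_ptE !updE eqxx; case: (j == L).
(* At u = 0 the dilation is 0 by convention, in agreement with the transform of [g], which vanishes
   on the hyperplane. *)
have -> : slice (dil L 1 0 (pfts front g)) y L u = pfts front g w.
  rewrite /slice /dil updE eqxx expr0z mul1r; case: eqVneq => // u0.
  rewrite (psi_vanish (psi_pfts last_notin_front Pg))//.
  by rewrite wj eqxx.
pose K (t : n.-tuple RT) := g (updl w front t) *
  expi (\sum_(j <- front) updl w front t ord0 j * w ord0 j).
have HK t : H (t, u) = expi (u * y ord0 L) * K t.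
  rewrite /H /K mulrCA -expiD /= /c; congr (g _ * expi _).
    by rewrite !updl_front updE eqxx wj eqxx.
  rewrite mulrDr [RHS]addrC; congr (_ + _).
  rewrite /front big_map big_enum /dot mulr_sumr; apply: eq_bigr => i _.
  rewrite updl_front row_mxEl wj ifF; last first.
    by apply/negbTE; rewrite -mem_front map_f ?mem_enum.
  by rewrite !mxE mulrA mulrC.
(* [K] differs from a section of [H] by a constant phase, from which it inherits integrability. *)
have KH t : K t = expi (- (u * y ord0 L)) * H (t, u).
  by rewrite HK mulrA -expiD addNr expi0 mul1r.
have iK : cintegrable (ltuple n) setT K.
  rewrite (_ : K = (fun t => expi (- (u * y ord0 L)) * H (t, u))); last exact/funext.
  exact: (cintegrableZ measurableT).
rewrite (pfts_integral _ front_uniq size_front Sg) mulrC.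
apply: etrans (cintZ measurableT (expi (u * y ord0 L)) iK).
by apply: eq_cint => t _; exact: HK.
Qed.

End FourierAndRadon.

(** * Continuity and the isomorphism *)

Section SchwartzTopology.
Variables (R : realType) (m : nat).
Implicit Types (f g h : schwartz R m) (A B : set (schwartz R m)).

Lemma schwartz_norm_ltP k (f : 'rV[R]_m -> R[i]) (e : R) :
  (schwartz_norm k f < e%:E)%E <-> exists2 M, M < e & seminorm_le k f M.
Proof.
split=> [|[M Me /schwartz_normP fM]]; last by apply: le_lt_trans fM _; rewrite lte_fin.
case E : (schwartz_norm k f) => [r| |] //; first rewrite lte_fin => re.
  by exists r => //; apply/schwartz_normP; rewrite E.
by move=> _; exists (e - 1); [rewrite gtrBl|apply/schwartz_normP; rewrite E leNye].
Qed.

Let smooth_sub f g : smooth (schwartz_fun g - schwartz_fun f).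
Proof.
rewrite -scaleN1r; apply: smoothD; first exact: (schwartzP g).1.
by apply: smoothZ; exact: (schwartzP f).1.
Qed.

Lemma open_schwartz_ball k f (e : R) :
  open [set g | (schwartz_norm k (schwartz_fun g - schwartz_fun f)%R < e%:E)%E].
Proof.
move=> g /= /schwartz_norm_ltP[M Me gM]; exists k, (e - M); first by rewrite subr_gt0.
move=> h /schwartz_norm_ltP[N Ne hN]; apply/schwartz_norm_ltP; exists (N + M).
  by rewrite -ltrBrDr.
rewrite [X in seminorm_le _ X _](_ : _ =
  (schwartz_fun h - schwartz_fun g) + (schwartz_fun g - schwartz_fun f)).
  by apply: seminorm_leD => //; exact: smooth_sub.
by rewrite addrA subrK.
Qed.

(** Linearity enters only through differences: they must lie in [P], where the seminorm estimate is
    available, and [T] must respect them. *)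
Lemma tame_continuous (P : set ('rV[R]_m -> R[i])) T A B (F : set_type A -> set_type B) :
  tame P T ->
  (forall f g, A f -> A g -> P (schwartz_fun g - schwartz_fun f) /\
     T (schwartz_fun g - schwartz_fun f) = T g - T f) ->
  (forall f : set_type A, schwartz_fun (\val (F f)) = T (\val f)) ->
  continuous F.
Proof.
move=> [_ tT] lT FT; apply/continuousP => _ [V oV <-].
(* Points outside [A] satisfy the condition vacuously, so [W] meets [A] exactly in the preimage of
   [V]; its interior is the open set inducing that preimage. *)
pose W : set (schwartz R m) := [set h | forall f : set_type A, \val f = h -> V (\val (F f))].
exists (interior W); first exact: open_interior.
apply/seteqP; split=> f /=; first by move/interior_subset; apply.
rewrite set_valE => VFf; have [k [e e0 Ve]] := oV _ VFf.
have [k' [C [C0 TC]]] := tT k.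
(* [C] may be 0, so the radius is divided by C + 1. *)
have C1 : 0 < C + 1 by rewrite ltr_wpDl.
have e1 : 0 < e / (C + 1) by rewrite divr_gt0.
pose U := [set h | (schwartz_norm k' (schwartz_fun h - schwartz_fun (\val f))%R < (e / (C + 1))%R%:E)%E].
have oU : open U by exact: open_schwartz_ball.
have UW : U `<=` W.
  move=> h /schwartz_norm_ltP[M Me gM] g gh; rewrite -gh in gM; apply: Ve; apply/schwartz_norm_ltP.
  have [Pgf Tgf] := lT _ _ (set_valP f) (set_valP g).
  exists (C * M); last by rewrite !FT -Tgf; exact: TC.
  apply: (@le_lt_trans _ _ ((C + 1) * M)); last by rewrite mulrC -ltr_pdivlMr.
  by rewrite ler_wpM2r ?(seminorm_le_ge0 gM)// lerDl.
apply: (filterS UW); apply: open_nbhs_nbhs; split=> //.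
apply/schwartz_norm_ltP; exists 0 => //.
have [M fM] := is_schwartz_bounded k' (schwartzP (\val f)).
rewrite subrr -(scale0r (schwartz_fun (\val f))) -[X in seminorm_le _ _ X](mul0r M) -normc0.
by apply: seminorm_leZ => //; exact: (schwartzP (\val f)).1.
Qed.

End SchwartzTopology.

(** * Assembling the isomorphism *)

Section RadonIsomorphism.
Variable R : realType.

Section Linearity.
Variable m : nat.
Notation schw := (@is_schwartz R m).
Implicit Types (f g : 'rV[R]_m -> R[i]) (s : seq 'I_m) (l i : 'I_m) (a : R[i]).

Lemma ipft_linear i a f g : schw f -> schw g ->
  ipft i (a *: f + g) = a *: ipft i f + ipft i g.
Proof.
move=> Sf Sg; rewrite /ipft !pft_linear//; try by do ?apply: is_schwartz_pft.
by rewrite scalerDr !scalerA mulrC.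
Qed.

Lemma pfts_linear s a f g : schw f -> schw g ->
  pfts s (a *: f + g) = a *: pfts s f + pfts s g.
Proof.
elim: s f g => //= i s IHs f g Sf Sg.
by rewrite pft_linear// IHs//; exact: is_schwartz_pft.
Qed.

Lemma ipfts_linear s a f g : schw f -> schw g ->
  ipfts s (a *: f + g) = a *: ipfts s f + ipfts s g.
Proof.
move=> Sf Sg; elim: s => //= i s IHs.
by rewrite IHs ipft_linear//; exact: is_schwartz_ipfts.
Qed.

Lemma dil_linear l e p a f g :
  dil l e p (a *: f + g) = a *: dil l e p f + dil l e p g.
Proof.
apply/funext => x.
rewrite [RHS](_ : _ = a * dil l e p f x + dil l e p g x)// /dil.
case: ifP => _; first by rewrite mulr0 addr0.
rewrite [X in _ * X](_ : _ = a * f (dil_pt l e x) + g (dil_pt l e x))//.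
by rewrite mulrDr mulrCA.
Qed.

Lemma psi_linear l a f g : psi l f -> psi l g -> psi l (a *: f + g).
Proof.
move=> [Sf f0] [Sg g0]; split=> [|k x xl]; first by apply: is_schwartzD => //; exact: is_schwartzZ.
rewrite dpartialD; [|exact: smoothZ Sf.1|exact: Sg.1].
rewrite dpartialZ; last exact: Sf.1.
rewrite [LHS](_ : _ = a * dpartial (nseq k l) f x + dpartial (nseq k l) g x)//.
by rewrite f0// g0// mulr0 addr0.
Qed.

End Linearity.

Variable n : nat.
Notation schw := (@is_schwartz R (n + 1)).
Notation L := (last_idx n).
Notation psiL := (@psi R (n + 1) L).
Implicit Types (f g : 'rV[R]_(n + 1) -> R[i]).

(** Membership is tested by the inverse transform in the last coordinate, so no witness has to be
    carried along. *)
Definition phi : set ('rV[R]_(n + 1) -> R[i]) := [set f | schw f /\ psiL (ipft L f)].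

(** The full transform factors as the last-coordinate transform after the front ones, and the front
    transforms and their inverses preserve flatness. *)
Lemma PhiP (f : schwartz R (n + 1)) : Phi f <-> phi f.
Proof.
split=> [[g Pg gf]|[Sf Pf]].
  have Sg := schwartzP g; have Pg' : psiL g := conj Sg Pg.
  split; first exact: schwartzP.
  rewrite -gf (fourier_last Sg) pftK; last exact: is_schwartz_pfts.
  exact: psi_pfts (last_notin_front n) Pg'.
have Pg := psi_ipfts (last_notin_front n) Pf.
exists (Schwartz (psi_schwartz Pg)); first exact: Pg.2.
have Si := psi_schwartz Pf.
by rewrite fourier_last ?ipftsK ?ipftK //=; exact: (psi_schwartz Pg).
Qed.

(** A conjugation common to the Radon transform and its inverse, which differ only in [D]; what
    follows is proved for both at once. *)
Definition conj_last (D : ('rV[R]_(n + 1) -> R[i]) -> 'rV[R]_(n + 1) -> R[i]) f :=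
  pft L (D (ipft L f)).

Section Conjugate.
Variable D : ('rV[R]_(n + 1) -> R[i]) -> 'rV[R]_(n + 1) -> R[i].
Hypotheses (PD : forall g, psiL g -> psiL (D g)) (tD : tame psiL D).

Lemma phi_conj_last f : phi f -> phi (conj_last D f).
Proof.
move=> [Sf Pf]; have Sg := psi_schwartz (PD Pf).
by split; [exact: is_schwartz_pft|rewrite /conj_last pftK//; exact: PD].
Qed.

Lemma tame_conj_last : tame phi (conj_last D).
Proof.
have t1 : tame phi (ipft L) by apply: (tame_sub _ (tame_ipft R L)) => f [].
have P1 f : phi f -> psiL (ipft L f) by case.
have t2 : tame phi (fun f => D (ipft L f)) by apply: (@tame_comp R _ phi psiL D (ipft L)).
apply: (@tame_comp R _ phi schw (pft L) (fun f => D (ipft L f))) => //.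
  by move=> f Pf; apply: psi_schwartz; apply/PD/P1.
exact: tame_pft.
Qed.

Hypothesis lD : forall a f g, psiL f -> psiL g -> D (a *: f + g) = a *: D f + D g.

Lemma conj_last_sub f g : phi f -> phi g ->
  phi (g - f) /\ conj_last D (g - f) = conj_last D g - conj_last D f.
Proof.
move=> [Sf Pf] [Sg Pg].
have E (h k : 'rV[R]_(n + 1) -> R[i]) : k - h = -1 *: h + k by rewrite scaleN1r addrC.
rewrite !E; split.
  split; first by apply: is_schwartzD => //; exact: is_schwartzZ.
  by rewrite ipft_linear//; exact: psi_linear.
by rewrite /conj_last ipft_linear// lD// pft_linear//; apply: psi_schwartz; exact: PD.
Qed.

End Conjugate.

Definition to_front := fun f => dil L 1 0 (pfts (front n) f).
Definition from_front := fun f => ipfts (front n) (dil L (-1) 0 f).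

Lemma psi_to f : psiL f -> psiL (to_front f).
Proof. by move=> Pf; apply: psi_dil; exact: psi_pfts (last_notin_front n) Pf. Qed.

Lemma psi_from f : psiL f -> psiL (from_front f).
Proof. by move=> Pf; apply: psi_ipfts (last_notin_front n) _; exact: psi_dil. Qed.

Lemma tame_to : tame psiL to_front.
Proof.
apply: (@tame_comp R _ psiL psiL (dil L 1 0) (pfts (front n))).
- by move=> f; exact: psi_pfts (last_notin_front n).
- by apply: (tame_sub (@psi_schwartz _ _ _)); exact: tame_pfts.
- exact: tame_dil.
Qed.

Lemma tame_from : tame psiL from_front.
Proof.
apply: (@tame_comp R _ psiL psiL (ipfts (front n)) (dil L (-1) 0)).
- by move=> f; exact: psi_dil.
- exact: tame_dil.
- by apply: (tame_sub (@psi_schwartz _ _ _)); exact: tame_ipfts.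
Qed.

Lemma to_linear a f g : psiL f -> psiL g ->
  to_front (a *: f + g) = a *: to_front f + to_front g.
Proof.
move=> Pf Pg.
by rewrite /to_front (pfts_linear _ _ (psi_schwartz Pf) (psi_schwartz Pg)) dil_linear.
Qed.

Lemma from_linear a f g : psiL f -> psiL g ->
  from_front (a *: f + g) = a *: from_front f + from_front g.
Proof.
move=> Pf Pg; rewrite /from_front dil_linear ipfts_linear//;
  by apply: psi_schwartz; exact: psi_dil.
Qed.

Lemma from_toK f : psiL f -> from_front (to_front f) = f.
Proof.
move=> Pf; rewrite /from_front /to_front.
rewrite -{2}[1]opprK dilK; last exact: psi_pfts (last_notin_front n) Pf.
by rewrite pftsK//; exact: (psi_schwartz Pf).
Qed.

Lemma to_fromK f : psiL f -> to_front (from_front f) = f.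
Proof.
move=> Pf; rewrite /from_front /to_front ipftsK ?dilK//.
by apply: psi_schwartz; exact: psi_dil.
Qed.

(** Writing f = F_m g with g flat brings it to the form of [radonT_pft]. *)
Lemma radonT_phi f : phi f -> radonT f = conj_last to_front f.
Proof. by move=> [Sf Pf]; rewrite -{1}(ipftK L Sf) radonT_pft. Qed.

Definition lift (T : ('rV[R]_(n + 1) -> R[i]) -> 'rV[R]_(n + 1) -> R[i])
    (H : forall f, phi f -> phi (T f)) (f : set_type (@Phi R n)) : set_type (@Phi R n) :=
  let Pf := H _ ((PhiP (\val f)).1 (set_mem (valP f))) in
  let g := Schwartz Pf.1 in
  exist _ g (mem_set ((PhiP g).2 Pf)).

Lemma lift_val T (H : forall f, phi f -> phi (T f)) (u : set_type (@Phi R n)) :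
  schwartz_fun (\val (lift H u)) = T (schwartz_fun (\val u)).
Proof. by []. Qed.

Lemma set_type_fun_inj (A : set (schwartz R (n + 1))) (f g : set_type A) :
  schwartz_fun (\val f) = schwartz_fun (\val g) -> f = g.
Proof.
move=> fg; apply: val_inj; case: (\val f) (\val g) fg => f0 Sf [g0 Sg] /= fg.
by rewrite -fg in Sg *; congr Schwartz; exact: Prop_irrelevance.
Qed.

End RadonIsomorphism.

Theorem theorem5p2 (R : realType) (n : nat) (hm : (2 <= n + 1)%N) :
  schwartz_isomorphism (@radonT R n) (@Phi R n) (@Phi R n).
Proof.
split=> [a f g _ _|]; first exact: radonT_linear (schwartzP f) (schwartzP g).
have phiA (f : set_type (@Phi R n)) : phi (schwartz_fun (\val f)).
  by apply/PhiP/set_mem; exact: (valP f).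
have sub T (H : forall f g, phi f -> phi g -> phi (g - f) /\ T (g - f) = T g - T f)
    (f g : schwartz R (n + 1)) : Phi f -> Phi g ->
    phi (schwartz_fun g - schwartz_fun f) /\
    T (schwartz_fun g - schwartz_fun f) = T g - T f.
  by move=> /PhiP Pf /PhiP Pg; exact: H.
(* The inverse is conjugation of [from_front]; the inner transforms cancel, then [to_front] with
   [from_front], then the outer ones. *)
exists (lift (phi_conj_last (@psi_to R n))), (lift (phi_conj_last (@psi_from R n))).
split=> [f|f|f||].
- by rewrite lift_val radonT_phi.
- apply: set_type_fun_inj; rewrite !lift_val /conj_last.
  have [Sf Pf] := phiA f.
  rewrite pftK; last by apply: psi_schwartz; exact: psi_to.
  by rewrite from_toK// ipftK.
- apply: set_type_fun_inj; rewrite !lift_val /conj_last.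
  have [Sf Pf] := phiA f.
  rewrite pftK; last by apply: psi_schwartz; exact: psi_from.
  by rewrite to_fromK// ipftK.
- apply: (tame_continuous (tame_conj_last (@psi_to R n) (@tame_to R n))) => //.
  by apply: sub; exact: (conj_last_sub (@psi_to R n) (@to_linear R n)).
- apply: (tame_continuous (tame_conj_last (@psi_from R n) (@tame_from R n))) => //.
  by apply: sub; exact: (conj_last_sub (@psi_from R n) (@from_linear R n)).
Qed.
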